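(* Let $\Gamma$ be a countable discrete group, let $(B,\nu)$ be an ergodic non-singular $\Gamma$-space with the SH-property (singular hereditary property), and let $(X,\xi)$ be a non-trivial factor of $(B,\nu)$. Then every $\Gamma$-invariant von Neumann algebra $\mathcal{M}$ with $$L^\infty(X,\xi)\subset\mathcal{M}\subset L^\infty(X,\xi)\rtimes\Gamma$$ is a crossed product of the form $\mathcal{M}=L^\infty(X,\xi)\rtimes\Lambda$ for a normal subgroup $\Lambda\triangleleft\Gamma$.
   Context: Non-singular spaces. A non-singular $\Gamma$-space $(B,\nu)$ is a standard probability space with a measurable $\Gamma$-action preserving the class of $\nu$. A factor $(X,\xi)$ of $(B,\nu)$ is a non-singular $\Gamma$-space with a $\Gamma$-equivariant measurable map $B\to X$ pushing $\nu$ to $\xi$; thus $L^\infty(X,\xi)$ is viewed as a $\Gamma$-invariant von Neumann subalgebra of $L^\infty(B,\nu)$. It is non-trivial if $L^\infty(X,\xi)\neq\mathbb{C}$. Crossed product. $L^\infty(B,\nu)\rtimes\Gamma$ is the von Neumann crossed product, generated by $L^\infty(B,\nu)$ and unitaries $\lambda(g)$, $g\in\Gamma$, implementing the action; $\Gamma$ acts on it by conjugation by the $\lambda(g)$, and ''$\Gamma$-invariant'' refers to this action (similarly for $X$). For a subgroup $\Lambda\le\Gamma$, $L^\infty(X,\xi)\rtimes\Lambda$ is the von Neumann subalgebra generated by $L^\infty(X,\xi)$ and $\lambda(\Lambda)$. $\mathbb{E}:L^\infty(B,\nu)\rtimes\Gamma\to L^\infty(B,\nu)$ is the canonical faithful normal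 conditional expectation, with $\mathbb{E}(f\lambda(g))=0$ for $g\neq e$ and $\mathbb{E}(f)=f$ for $f\in L^\infty(B,\nu)$. Singularity. For a unital $C^*$-algebra $\mathcal{C}$, states $\tau,\tilde\tau$ on $\mathcal{C}$ are singular, $\tau\perp\tilde\tau$, if there is a net $a_i\in\mathcal{C}$, $0\le a_i\le 1$, with $\lim_i\tau(a_i)=1$ and $\lim_i\tilde\tau(a_i)=0$. If $\mathcal{N}$ is a $\Gamma$-von Neumann algebra (with separable predual) and $\Phi:\mathcal{N}\to L^\infty(B,\nu)$ is a $\Gamma$-equivariant ucp map, choose an ultraweakly dense $\Gamma$-invariant norm-separable $C^*$-subalgebra $\mathcal{C}\subset\mathcal{N}$; then there is a $\Gamma$-equivariant measurable map $\theta:B\to\mathcal{S}(\mathcal{C})$ into the state space of $\mathcal{C}$ with $\Phi(a)(b)=\theta(b)(a)$ for $a\in\mathcal{C}$ and a.e. $b$. $\Phi$ is called $\Gamma$-singular if $s.\theta(b)\perp\theta(b)$ for almost every $b\in B$ and every $s\in\Gamma\setminus\{e\}$, where $(s.\tau)(a)=\tau(s^{-1}.a)$. (This does not depend on the choice of $\mathcal{C}$.) SH-property. An ergodic non-singular $\Gamma$-space $(B,\nu)$ has the singular hereditary (SH) property if for every $\Gamma$-invariant von Neumann subalgebra $\mathcal{N}\subset L^\infty(B,\nu)\rtimes\Gamma$, either $\mathbb{E}|_{\mathcal{N}}$ is $\Gamma$-singular or $\mathbb{E}(\mathcal{N})=\mathbb{C}$. *)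

(* Defs.v *)
From HB Require Import structures.
From mathcomp Require Import all_boot all_order all_algebra.
From mathcomp Require Import complex.
From mathcomp Require Import all_classical all_reals all_analysis.

Set Implicit Arguments.
Unset Strict Implicit.
Unset Printing Implicit Defensive.

Import Order.TTheory GRing.Theory Num.Theory.
Import numFieldNormedType.Exports.
Import ComplexField.Normc.

Local Open Scope classical_set_scope.
Local Open Scope complex_scope.
Local Open Scope ring_scope.

(* Complex L^2 spaces and their bounded operators.

   The Hilbert space L^2(mu) is handled through its representatives: vectors
   are square integrable functions T -> R[i], and every notion below is
   insensitive to changes on mu-null sets.  An operator is a function on
   representatives; the values it takes outside of L^2 are irrelevant. *)

Section Lebesgue.
Context {R : realType} {d : measure_display} {T : measurableType d}.
Variable mu : {measure set T -> \bar R}.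

Definition cmeasurable (f : T -> R[i]) : Prop :=
  measurable_fun setT (fun t => complex.Re (f t)) /\
  measurable_fun setT (fun t => complex.Im (f t)).

Definition cintegral (f : T -> R[i]) : R[i] :=
  (\int[mu]_t complex.Re (f t)) +i* (\int[mu]_t complex.Im (f t)).

Definition Linf : set (T -> R[i]) :=
  [set f | cmeasurable f /\ exists M : R, \forall t \ae mu, normc (f t) <= M].

Definition L2 : set (T -> R[i]) :=
  [set xi | cmeasurable xi /\
            (\int[mu]_t ((normc (xi t)) ^+ 2)%:E < +oo)%E].

Definition L2dot (xi eta : T -> R[i]) : R[i] :=
  cintegral (fun t => xi t * (eta t)^*).

Definition L2norm (xi : T -> R[i]) : R :=
  Num.sqrt (\int[mu]_t (normc (xi t)) ^+ 2).

End Lebesgue.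

Definition op (R : realType) (T : Type) : Type := (T -> R[i]) -> (T -> R[i]).

Section Operators.
Context {R : realType} {d : measure_display} {T : measurableType d}.
Variable mu : {measure set T -> \bar R}.
Local Notation L2 := (L2 mu).
Local Notation dot := (L2dot mu).
Local Notation norm := (L2norm mu).

Definition op_lin (a : R[i]) (S S' : op R T) : op R T :=
  fun xi t => a * S xi t + S' xi t.

Definition op_eq (S S' : op R T) : Prop :=
  forall xi, L2 xi -> S xi = S' xi %[ae mu].

Definition op_norm_le (S : op R T) (c : R) : Prop :=
  forall xi, L2 xi -> norm (S xi) <= c * norm xi.

Definition bounded_op : set (op R T) :=
  [set S | [/\ forall xi, L2 xi -> L2 (S xi),
               forall (a : R[i]) xi eta, L2 xi -> L2 eta ->
                 S (fun t => a * xi t + eta t)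
                 = (fun t => a * S xi t + S eta t) %[ae mu]
             & exists c : R, op_norm_le S c] ].

Definition adjoint (S S' : op R T) : Prop :=
  forall xi eta, L2 xi -> L2 eta -> dot (S xi) eta = dot xi (S' eta).

Record star_algebra (A : set (op R T)) : Prop := StarAlgebra {
  star_bounded : A `<=` bounded_op;
  star_one : A idfun;
  star_lin : forall (a : R[i]) S S', A S -> A S' -> A (op_lin a S S');
  star_comp : forall S S', A S -> A S' -> A (S \o S');
  star_adj : forall S S', A S -> bounded_op S' -> adjoint S S' -> A S' }.

Definition wot_closed (A : set (op R T)) : Prop :=
  forall S, bounded_op S ->
    (forall (n : nat) (xi eta : 'I_n -> T -> R[i]) (e : R),
       (forall i, L2 (xi i)) -> (forall i, L2 (eta i)) -> 0 < e ->
       exists2 S', A S' &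
         forall i, normc (dot (S (xi i)) (eta i) - dot (S' (xi i)) (eta i)) < e)
    -> A S.

Definition vN_algebra (A : set (op R T)) : Prop :=
  star_algebra A /\ wot_closed A.

Definition vN_generated (A : set (op R T)) : set (op R T) :=
  [set S | forall M, vN_algebra M -> A `<=` M -> M S].

Definition norm_closed (A : set (op R T)) : Prop :=
  forall S, bounded_op S ->
    (forall e : R, 0 < e ->
       exists2 S', A S' & op_norm_le (op_lin (- 1) S' S) e) -> A S.

Definition cstar_algebra (A : set (op R T)) : Prop :=
  star_algebra A /\ norm_closed A.

Definition norm_separable (A : set (op R T)) : Prop :=
  exists2 D : nat -> op R T, (forall n, A (D n)) &
    forall S (e : R), A S -> 0 < e ->
      exists n, op_norm_le (op_lin (- 1) (D n) S) e.

(* The ultraweak topology is given by the functionals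
   S |-> \sum_k <S xi_k, eta_k> with (xi_k), (eta_k) square summable. *)
Definition square_summable (xi : nat -> T -> R[i]) : Prop :=
  (forall k, L2 (xi k)) /\
  (\sum_(0 <= k <oo) ((norm (xi k)) ^+ 2)%:E < +oo)%E.

Definition uw_functional (xi eta : nat -> T -> R[i]) (S : op R T) : R[i] :=
  limn (fun n => \sum_(k < n) (dot (S (xi k)) (eta k)) : R[i]^o).

Definition uw_dense (A N : set (op R T)) : Prop :=
  forall S, N S -> forall (n : nat) (xi eta : 'I_n -> nat -> T -> R[i]) (e : R),
    (forall i, square_summable (xi i)) -> (forall i, square_summable (eta i)) ->
    0 < e ->
    exists2 S', A S' &
      forall i, normc (uw_functional (xi i) (eta i) S
                       - uw_functional (xi i) (eta i) S') < e.

Record is_state (A : set (op R T)) (tau : op R T -> R[i]) : Prop := IsState {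
  state_eq : forall S S', A S -> A S' -> op_eq S S' -> tau S = tau S';
  state_lin : forall (a : R[i]) S S', A S -> A S' ->
    tau (op_lin a S S') = a * tau S + tau S';
  state_pos : forall S S', A S -> A S' -> adjoint S S' -> 0 <= tau (S' \o S);
  state_one : tau idfun = 1 }.

(* The order of R[i] compares the real parts and requires the imaginary parts
   to be equal, so the first inequality includes that S is self-adjoint. *)
Definition between01 (S : op R T) : Prop :=
  forall xi, L2 xi -> 0 <= dot (S xi) xi /\ dot (S xi) xi <= dot xi xi.

(* Nets are rendered as families indexed by a type with a proper filter. *)
Definition singular_states (A : set (op R T)) (tau tau' : op R T -> R[i]) : Prop :=
  exists (I : Type) (F : set_system I) (a : I -> op R T),
    [/\ ProperFilter F,
        forall i, A (a i) /\ between01 (a i),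
        (tau (a i) : R[i]^o) @[i --> F] --> (1 : R[i]^o)
      & (tau' (a i) : R[i]^o) @[i --> F] --> (0 : R[i]^o)].

End Operators.

Section Spaces.
Context {R : realType} {G : groupType} {d : measure_display}
  {T : measurableType d}.
Variables (nu : probability T R) (act : G -> T -> T).

Definition standard_borel : Prop :=
  exists (P : completePseudoMetricType R) (f : T -> P),
    [/\ hausdorff_space P, exists2 D : set P, countable D & dense D,
        bijective f
      & forall U : set P, measurable (f @^-1` U) <-> <<s open >> U].

Record nonsingular_space : Prop := NonsingularSpace {
  space_standard : standard_borel;
  act_one : forall x, act 1%g x = x;
  act_mul : forall g h x, act (g * h)%g x = act g (act h x);
  act_measurable : forall g, measurable_fun setT (act g);
  act_null : forall g A, measurable A ->
    (nu (act g @^-1` A) = 0%E <-> nu A = 0%E) }.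

Definition ergodic : Prop :=
  forall A, measurable A -> (forall g, act g @^-1` A = A) ->
    nu A = 0%E \/ nu A = 1%E.

Definition nontrivial_space : Prop :=
  exists2 f, Linf nu f & forall c : R[i], ~ (f = cst c %[ae nu]).

End Spaces.

Record factor_map (R : realType) (G : groupType)
    (dB : measure_display) (B : measurableType dB)
    (nu : probability B R) (actB : G -> B -> B)
    (dX : measure_display) (X : measurableType dX)
    (xi : probability X R) (actX : G -> X -> X) (p : B -> X) : Prop := FactorMap {
  factor_space : nonsingular_space xi actX;
  factor_measurable : measurable_fun setT p;
  factor_equivariant : forall g, \forall b \ae nu, p (actB g b) = actX g (p b);
  factor_push : forall A, measurable A -> nu (p @^-1` A) = xi A }.

Definition normal_subgroup (G : groupType) (L : set G) : Prop :=
  [/\ L 1%g, forall g h, L g -> L h -> L (g * h)%g,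
      forall g, L g -> L (g^-1)%g & forall g h, L h -> L (g * h * g^-1)%g].

Definition discrete_group (G : groupType) : Type := G.
HB.instance Definition _ (G : groupType) := Choice.on (discrete_group G).
HB.instance Definition _ (G : groupType) := isPointed.Build (discrete_group G) (1%g : G).
HB.instance Definition _ (G : groupType) :=
  @isMeasurable.Build default_measure_display (discrete_group G)
    discrete_measurable discrete_measurable0
    discrete_measurableC discrete_measurableU.

Notation GB G B := (discrete_group G * B)%type.

Section CrossedProduct.
Context {R : realType} {G : groupType} {d : measure_display}
  {B : measurableType d}.
Variables (nu : probability B R) (act : G -> B -> B).

(* The crossed product acts on L^2(G x B) = l^2(G) (x) L^2(B, nu). *)
Local Notation GB := (GB G B).

Definition crossed_measure : {measure set GB -> \bar R} :=
  (@counting (discrete_group G) R \x nu)%E.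
Local Notation mu := crossed_measure.
Local Notation opGB := (op R GB).

(* (f xi)(h) = (h^-1 . f) xi(h), where (g . f)(b) = f (g^-1 b). *)
Definition mult_op (f : B -> R[i]) : opGB :=
  fun xi hb => f (act hb.1 hb.2) * xi hb.

Definition lambda (g : G) : opGB :=
  fun xi hb => xi ((g^-1 * hb.1)%g, hb.2).

Definition conj_op (g : G) (S : opGB) : opGB :=
  lambda g \o S \o lambda g^-1%g.

(* The von Neumann algebra generated by a set F of functions on B and by
   lambda(L); for L^oo(B) x| G take F = L^oo(B) and L = G. *)
Definition crossed_product (F : set (B -> R[i])) (L : set G) : set opGB :=
  vN_generated mu (mult_op @` F `|` lambda @` L).

Definition conj_invariant (N : set opGB) : Prop :=
  forall g S, N S -> N (conj_op g S).

Definition delta_one : GB -> R[i] := fun hb => (hb.1 == 1%g :> G)%:R.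

(* The canonical expectation is the compression to the (e, e) block.  For
   S in the crossed product this block is the multiplication by a function in
   L^oo(B), which is recovered by evaluation at the constant function 1. *)
Definition canonical_expectation (S : opGB) : B -> R[i] := fun b => S delta_one (1%g, b).

(* The map theta takes values in the state space of A, with the sigma-algebra
   generated by the evaluations at the elements of A, which is the Borel
   sigma-algebra of the weak* topology as A is norm separable. *)
Definition expectation_singular (N : set opGB) : Prop :=
  exists (A : set opGB) (theta : B -> opGB -> R[i]),
    [/\ [/\ cstar_algebra mu A, A `<=` N, uw_dense mu A N, conj_invariant A
          & norm_separable mu A],
        [/\ forall b, is_state mu A (theta b),
            forall S, A S -> cmeasurable (fun b => theta b S),
            forall g, \forall b \ae nu, forall S, A S ->
              theta (act g b) S = theta b (conj_op g^-1%g S)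
          & forall S, A S -> canonical_expectation S = (fun b => theta b S) %[ae nu] ]
      & \forall b \ae nu, forall s, s != 1%g ->
          singular_states mu A (fun S => theta b (conj_op s^-1%g S)) (theta b)].

Definition SH_property : Prop :=
  forall N : set opGB, vN_algebra mu N -> conj_invariant N ->
    N `<=` crossed_product (Linf nu) setT ->
    expectation_singular N \/
    (forall S, N S -> exists c : R[i], canonical_expectation S = cst c %[ae nu]).

Lemma conj_mult_op g f :
  (forall h k b, act (h * k)%g b = act h (act k b)) ->
  conj_op g (mult_op f) = mult_op (f \o act g^-1%g).
Proof.
move=> actM; apply/funext => xi; apply/funext => -[h b].
by rewrite /conj_op /mult_op /lambda /= actM invgK mulgA mulgV mul1g.
Qed.

Lemma expectation_mult_lambda g f :
  (forall b, act 1%g b = b) ->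
  canonical_expectation (mult_op f \o lambda g) = if g == 1%g then f else cst 0.
Proof.
move=> act1; apply/funext => b.
rewrite /canonical_expectation /mult_op /lambda /delta_one /= act1 mulg1 invg_eq1.
by case: ifP; rewrite ?mulr1 ?mulr0.
Qed.

End CrossedProduct.

Arguments crossed_measure {R} G {d B} nu.

(* L^oo(X) viewed inside L^oo(B) through the factor map p. *)
Definition Linf_factor (R : realType) (dX : measure_display)
    (X : measurableType dX) (xi : probability X R) (B : Type) (p : B -> X) :
    set (B -> R[i]) :=
  [set f \o p | f in Linf xi].

(* Main.v *)
From HB Require Import structures.
Require Import Defs.
From mathcomp Require Import all_boot all_order all_algebra.
From mathcomp Require Import complex.
From mathcomp Require Import all_classical all_reals all_analysis.
From mathcomp Require Import measurable_realfun.
From mathcomp Require Import ring lra.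


(** The proof identifies [M] through its Fourier terms. An element [S] of the
    crossed product is an infinite matrix indexed by the group, whose entries are
    multiplications by functions; it is determined by its coefficients [f_g], and
    is formally the sum of the [f_g lambda_g] ([crossed_symbol]). For elements of
    [L^oo(X) x| G] the coefficients come from [X] ([factor_coef]).

    The singular hereditary property is applied twice. It is applied first to the
    diagonal part of [M], which is a copy of [L^oo(X)]. As [X] is non-trivial the
    expectation is not constant there, so it is singular; and singular states on
    a commutative algebra take different values at some element of a countable
    norm dense set. Hence countably many functions on [X] separate the points [b]
    and [s b] for almost every [b] and every [s] other than 1: the action on [X]
    is essentially free ([separating_exists]). Averaging [S] over its conjugates
    by unitary functions on [X] that separate the orbits isolates a single
    Fourier term, so that all the terms [f_g lambda_g] of [S] lie again in [M]
    ([fourier_component], [component_in]).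

    For every [g] there is then a largest measurable set [Z g] in [X] such that
    [1_(Z g) lambda_g] lies in [M] ([max_support]), and the coefficient [f_g] of
    every element of [M] vanishes outside of it. Since [M] is closed under
    products and adjoints, and is invariant under conjugation by all of [G], the
    elements [g] with [b] in [Z g] form a group for almost every [b], and the
    functions [1_(Z g)] are central in [M] ([support_invariant],
    [support_central]).

    The property is applied a second time, to the diagonal part of the centre of
    [M]. If the expectation is singular there, some central function takes
    different values at [b] and at [g^-1 b], while it commutes with
    [f_g lambda_g]; so [f_g] vanishes for [g] other than 1. If the expectation is
    constant, then each [Z g] is null or conull. In both cases, for each [g],
    either [lambda_g] lies in [M] or the coefficient [f_g] vanishes for all
    elements of [M] ([lambda_dichotomy]).

    The normal subgroup is the set of the [g] such that [lambda_g] lies in [M].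
    It remains to recover an element from its Fourier terms. Their series need
    not converge, but an operator that commutes with all the terms commutes with
    the element, and the bicommutant theorem applies ([fourier_synthesis]). *)

Set Implicit Arguments.
Unset Strict Implicit.
Unset Printing Implicit Defensive.

Import Order.TTheory GRing.Theory Num.Theory.
Import numFieldNormedType.Exports.
Import ComplexField.Normc.

Local Open Scope classical_set_scope.
Local Open Scope complex_scope.
Local Open Scope ring_scope.

(** * Modulus of complex numbers *)

Section ComplexNumbers.
Context {R : realType}.
Implicit Types x y z : R[i].

Lemma sqr_normcE x : normc x ^+ 2 = complex.Re x ^+ 2 + complex.Im x ^+ 2.
Proof. by case: x => a b /=; rewrite sqr_sqrtr ?addr_ge0 ?sqr_ge0. Qed.

Lemma normc_ge0 x : 0 <= normc x.
Proof. by case: x => a b /=; rewrite sqrtr_ge0. Qed.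

Lemma normc_real (r : R) : normc r%:C = `|r|.
Proof. by rewrite /= expr0n /= addr0 sqrtr_sqr. Qed.

Lemma cmulJ x : x * x^* = ((normc x) ^+ 2)%:C.
Proof.
rewrite sqr_normcE; case: x => a b /=; apply/eqP.
by rewrite eq_complex /=; apply/andP; split; apply/eqP; ring.
Qed.

Lemma cReM x y : complex.Re (x * y)
  = complex.Re x * complex.Re y - complex.Im x * complex.Im y.
Proof. by case: x => a b; case: y. Qed.

Lemma cImM x y : complex.Im (x * y)
  = complex.Re x * complex.Im y + complex.Im x * complex.Re y.
Proof. by case: x => a b; case: y. Qed.

Lemma conjcM x y : (x * y)^* = x^* * y^*.
Proof. exact: rmorphM. Qed.

Lemma conjcD x y : (x + y)^* = x^* + y^*.
Proof. exact: rmorphD. Qed.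

Lemma conjcr (r : R) : (r%:C)^* = r%:C.
Proof. exact: conjc_real. Qed.

Lemma cReZ (r : R) x : complex.Re (r%:C * x) = r * complex.Re x.
Proof. by case: x => a b /=; rewrite mul0r subr0. Qed.

Lemma cRe_real (r : R) : complex.Re r%:C = r.
Proof. by []. Qed.

Lemma cReD x y : complex.Re (x + y) = complex.Re x + complex.Re y.
Proof. by case: x => a b; case: y. Qed.

Lemma cImD x y : complex.Im (x + y) = complex.Im x + complex.Im y.
Proof. by case: x => a b; case: y. Qed.

Lemma cReN x : complex.Re (- x) = - complex.Re x.
Proof. by case: x. Qed.

Lemma cImN x : complex.Im (- x) = - complex.Im x.
Proof. by case: x. Qed.

Lemma cReJ x : complex.Re x^* = complex.Re x.
Proof. by case: x. Qed.

Lemma cImJ x : complex.Im x^* = - complex.Im x.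
Proof. by case: x. Qed.

Lemma cnormJ x : normc x^* = normc x.
Proof. by case: x => a b /=; rewrite sqrrN. Qed.

Lemma abs_Re_normc x : `|complex.Re x| <= normc x.
Proof.
rewrite -sqrtr_sqr; case: x => a b /=.
by rewrite ler_sqrt ?lerDl ?addr_ge0 ?sqr_ge0.
Qed.

Lemma abs_Im_normc x : `|complex.Im x| <= normc x.
Proof.
rewrite -sqrtr_sqr; case: x => a b /=.
by rewrite ler_sqrt ?lerDr ?addr_ge0 ?sqr_ge0.
Qed.

Lemma eq_ReIm x y : complex.Re x = complex.Re y ->
  complex.Im x = complex.Im y -> x = y.
Proof. by case: x => a b; case: y => c d /= -> ->. Qed.

End ComplexNumbers.

(** * Projections in complete semi-inner-product spaces *)

(** Square integrable functions are not identified when they agree almost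
    everywhere, so the form is only positive semidefinite and limits and
    projections are unique up to vectors of length zero; [D] is the domain on
    which the form makes sense. *)
Record semi_hilbert (R : realType) (V : lmodType R[i]) (D : set V)
    (dot : V -> V -> R[i]) : Prop := SemiHilbert {
  sh_0 : D 0;
  sh_lin : forall a x y, D x -> D y -> D (a *: x + y);
  sh_linl : forall a x y z, D x -> D y -> D z ->
    dot (a *: x + y) z = a * dot x z + dot y z;
  sh_conj : forall x y, D x -> D y -> dot y x = (dot x y)^*;
  sh_ge0 : forall x, D x -> 0 <= complex.Re (dot x x);
  sh_complete : forall u : nat -> V, (forall n, D (u n)) ->
    (forall e : R, 0 < e -> exists N, forall m n, (N <= m)%N -> (N <= n)%N ->
       complex.Re (dot (u m - u n) (u m - u n)) < e) ->
    exists2 x, D x & forall e : R, 0 < e -> exists N, forall n, (N <= n)%N ->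
       complex.Re (dot (u n - x) (u n - x)) < e }.

Section SemiHilbertTheory.
Context {R : realType} {V : lmodType R[i]} (D : set V) (dot : V -> V -> R[i]).
Hypothesis H : semi_hilbert D dot.
Local Notation q x := (complex.Re (dot x x)).

Lemma shD x y : D x -> D y -> D (x + y).
Proof. by move=> Dx Dy; rewrite -[x]scale1r; apply: (sh_lin H). Qed.

Lemma shZ a x : D x -> D (a *: x).
Proof. by move=> Dx; rewrite -[_ *: _]addr0; apply: (sh_lin H) => //; exact: sh_0 H. Qed.

Lemma shN x : D x -> D (- x).
Proof. by move=> Dx; rewrite -scaleN1r; apply: shZ. Qed.

Lemma shB x y : D x -> D y -> D (x - y).
Proof. by move=> Dx Dy; apply: shD => //; apply: shN. Qed.

Lemma dotDl x y z : D x -> D y -> D z -> dot (x + y) z = dot x z + dot y z.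
Proof. by move=> Dx Dy Dz; rewrite -[x in LHS]scale1r (sh_linl H) ?mul1r. Qed.

Lemma dot0l z : D z -> dot 0 z = 0.
Proof.
move=> Dz; have D0 := sh_0 H.
have := @dotDl 0 0 z D0 D0 Dz; rewrite addr0 => /eqP.
by rewrite -subr_eq0 opprD addNKr oppr_eq0 => /eqP.
Qed.

Lemma dotZl a x z : D x -> D z -> dot (a *: x) z = a * dot x z.
Proof.
move=> Dx Dz; have D0 := sh_0 H.
by rewrite -[_ *: _]addr0 (sh_linl H) // dot0l // addr0.
Qed.

Lemma dotNl x z : D x -> D z -> dot (- x) z = - dot x z.
Proof. by move=> Dx Dz; rewrite -scaleN1r dotZl // mulN1r. Qed.

Lemma dotBl x y z : D x -> D y -> D z -> dot (x - y) z = dot x z - dot y z.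
Proof. by move=> Dx Dy Dz; rewrite dotDl ?dotNl //; apply: shN. Qed.

Lemma dotDr x y z : D x -> D y -> D z -> dot z (x + y) = dot z x + dot z y.
Proof.
move=> Dx Dy Dz; rewrite (sh_conj H (shD Dx Dy) Dz) dotDl // rmorphD /=.
by rewrite -!(sh_conj H).
Qed.

Lemma dotZr a x z : D x -> D z -> dot z (a *: x) = a^* * dot z x.
Proof.
move=> Dx Dz; rewrite (sh_conj H (shZ _ Dx) Dz) dotZl // rmorphM /=.
by rewrite -!(sh_conj H).
Qed.

Lemma dotNr x z : D x -> D z -> dot z (- x) = - dot z x.
Proof.
by move=> Dx Dz; rewrite (sh_conj H (shN Dx) Dz) dotNl // rmorphN /= -(sh_conj H).
Qed.

Lemma dotBr x y z : D x -> D y -> D z -> dot z (x - y) = dot z x - dot z y.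
Proof. by move=> Dx Dy Dz; rewrite dotDr ?dotNr //; apply: shN. Qed.

Lemma qD x y : D x -> D y -> q (x + y) = q x + q y + complex.Re (dot x y) *+ 2.
Proof.
move=> Dx Dy; rewrite dotDl ?dotDr ?(sh_conj H Dx Dy) //; last exact: shD.
by rewrite !cReD cReJ mulr2n; ring.
Qed.

Lemma qZ a x : D x -> q (a *: x) = normc a ^+ 2 * q x.
Proof.
move=> Dx; rewrite dotZl ?dotZr // ?mulrA ?cmulJ ?cReZ //; exact: shZ.
Qed.

Lemma qN x : D x -> q (- x) = q x.
Proof.
by move=> Dx; rewrite -scaleN1r qZ // -[-1](@rmorphN1 R R[i] (real_complex R))
  normc_real normrN1 expr1n mul1r.
Qed.

Lemma qB x y : D x -> D y -> q (x - y) = q x + q y - complex.Re (dot x y) *+ 2.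
Proof.
by move=> Dx Dy; rewrite qD ?qN ?dotNr ?cReN ?mulNrn //; apply: shN.
Qed.

Lemma q0 : q 0 = 0.
Proof. by rewrite dot0l //; exact: sh_0 H. Qed.

Lemma q_sym x y : D x -> D y -> q (x - y) = q (y - x).
Proof. by move=> Dx Dy; rewrite -[x - y]opprB qN //; apply: shB. Qed.

Lemma parallelogram x y : D x -> D y ->
  q (x + y) + q (x - y) = q x *+ 2 + q y *+ 2.
Proof. by move=> Dx Dy; rewrite qD // qB // !mulr2n; ring. Qed.

Lemma qD_le x y : D x -> D y -> q (x + y) <= q x *+ 2 + q y *+ 2.
Proof.
by move=> Dx Dy; rewrite -parallelogram // lerDl (sh_ge0 H) //; apply: shB.
Qed.

(** The multiple of [y] closest to [x] is [a y] with
    [a = <x, y> / <y, y>]. *)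
Lemma q_min x y d : D x -> D y -> (forall a, d <= q (x - a *: y)) ->
  normc (dot x y) ^+ 2 <= (q x - d) * q y.
Proof.
move=> Dx Dy dmin.
have expand a : q (x - a *: y)
    = q x + normc a ^+ 2 * q y - complex.Re (a^* * dot x y) *+ 2.
  by rewrite qB ?qZ ?dotZr //; apply: shZ.
have q0y := sh_ge0 H Dy.
case: (ltrP 0 (q y)) => [qy|qy].
  have := dmin (((q y)^-1)%:C * dot x y); rewrite expand normcM normc_real.
  rewrite conjcM conjcr -mulrA (mulrC (dot x y)^*) cmulJ cReZ.
  rewrite cRe_real ger0_norm ?invr_ge0 // exprMn.
  move: (normc (dot x y) ^+ 2 : R) => n h.
  have : d <= q x - n / q y.
    by apply: le_trans h _; rewrite le_eqVlt; apply/orP; left; apply/eqP;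
      rewrite mulr2n; field; rewrite gt_eqF.
  by rewrite lerBrDl addrC -lerBrDl ler_pdivrMr.
have qy0 : q y = 0 by apply/le_anti; rewrite qy q0y.
rewrite qy0 mulr0.
have {}expand (t : R) : d <= q x - t * normc (dot x y) ^+ 2 *+ 2.
  have := dmin (t%:C * dot x y); rewrite expand qy0 mulr0 addr0.
  by rewrite conjcM conjcr -mulrA (mulrC (dot x y)^*) cmulJ cReZ cRe_real.
case: (ltrP 0 (normc (dot x y) ^+ 2)) => // n0.
(* A nonzero slope makes the affine lower bound fail for large [t]. *)
have := expand ((q x - d + 1) / normc (dot x y) ^+ 2).
rewrite divfK ?gt_eqF // => h.
have := expand 0; rewrite mul0r mul0rn subr0 => h2.
by exfalso; move: h; rewrite mulr2n; lra.
Qed.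

Lemma cauchy_schwarz x y : D x -> D y -> normc (dot x y) ^+ 2 <= q x * q y.
Proof.
move=> Dx Dy; rewrite -[q x]subr0; apply: q_min => // a.
by apply: (sh_ge0 H); apply: shB => //; apply: shZ.
Qed.

Definition limit_point (K : set V) (y : V) : Prop :=
  forall e : R, 0 < e -> exists2 k, K k & q (k - y) < e.

Lemma limit_point_sub (K : set V) y : K `<=` D -> K y -> limit_point K y.
Proof.
move=> KD Ky e e0; exists y => //; rewrite subrr q0 //.
Qed.

(** Orthogonality to [K] passes to its closure by the Cauchy-Schwarz inequality. *)
Lemma limit_point_orth (K : set V) x y : K `<=` D -> D x -> D y ->
  limit_point K y -> (forall k, K k -> dot x k = 0) -> dot x y = 0.
Proof.
move=> KD Dx Dy Ky orth; apply: eq0_normc; apply/eqP; rewrite -sqrf_eq0.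
rewrite eq_le sqr_ge0 andbT; apply/ler_addgt0Pr => e e0; rewrite add0r.
have qx1 : 0 < q x + 1 by apply: ltr_wpDl => //; exact: (sh_ge0 H).
have [k Kk ke] := Ky (e / (q x + 1)) (divr_gt0 e0 qx1).
have Dk := KD _ Kk.
have -> : dot x y = dot x (y - k) by rewrite dotBr // (orth _ Kk) subr0.
apply: le_trans (cauchy_schwarz Dx (shB Dy Dk)) _.
rewrite q_sym //; apply: (@le_trans _ _ ((q x + 1) * (e / (q x + 1)))).
  apply: ler_pM; rewrite ?(sh_ge0 H) ?(ltW ke) ?lerDl //.
  by apply: shB.
by rewrite mulrC divfK ?gt_eqF.
Qed.

(** A minimizing sequence for the distance from [x] to [K] is Cauchy by the
    parallelogram law, and its limit differs from [x] by a vector orthogonal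
    to [K]. *)
Lemma projection_exists (K : set V) x : K `<=` D -> K 0 ->
  (forall a k l, K k -> K l -> K (a *: k + l)) -> D x ->
  exists y, [/\ D y, limit_point K y & forall k, K k -> dot (x - y) k = 0].
Proof.
move=> KD K0 Klin Dx.
pose E := [set q (x - k) | k in K].
have lbE : has_lbound E.
  by exists 0 => _ [k Kk <-]; apply: (sh_ge0 H); apply: shB => //; apply: KD.
have nE : E !=set0 by exists (q (x - 0)); exists 0.
have hE : has_inf E by split.
have step n : {k | K k & q (x - k) < inf E + n.+1%:R^-1}.
  apply/cid2; have n0 : (0 : R) < n.+1%:R^-1 by rewrite invr_gt0.
  by have [_ [k Kk <-] lt] := inf_adherent n0 hE; exists k.
pose u n := s2val (step n).
have Ku n : K (u n) by rewrite /u; case: (step n).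
have Du n := KD _ (Ku n).
have ltu n : q (x - u n) < inf E + n.+1%:R^-1 by rewrite /u; case: (step n).
have infE k : K k -> inf E <= q (x - k) by move=> Kk; apply: ge_inf => //; exists k.
have half m n : q (u m - u n) <= (m.+1%:R^-1 + n.+1%:R^-1) *+ 2.
  have K2 : K (2^-1 *: u m + 2^-1 *: u n).
    by apply: (Klin) => //; rewrite -[_ *: _]addr0; apply: Klin.
  have := @parallelogram (x - u m) (x - u n) (shB Dx (Du m)) (shB Dx (Du n)).
  have -> : x - u m - (x - u n) = u n - u m.
    by rewrite opprB addrC addrA subrK addrC.
  have -> : x - u m + (x - u n) = 2 *: (x - (2^-1 *: u m + 2^-1 *: u n)).
    rewrite scalerBr scalerDr !scalerA divff ?scale1r //.
    rewrite scaler_nat mulr2n opprD; rewrite -!addrA; congr (_ + _).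
    by rewrite addrCA.
  have DD : D (x - (2^-1 *: u m + 2^-1 *: u n)) by apply: shB => //; apply: KD.
  rewrite qZ // (q_sym (Du n) (Du m)).
  have -> : normc (2 : R[i]) ^+ 2 = 4.
    rewrite (_ : 2 = (2 : R)%:C) ?normc_real ?ger0_norm ?rmorph_nat //.
    by rewrite expr2 -natrM.
  have := infE _ K2; have := ltu m; have := ltu n.
  move: (q (x - (_ + _))) (q (x - u m)) (q (x - u n)) (q (u m - u n)) (inf E).
  move: (m.+1%:R^-1 : R) (n.+1%:R^-1 : R) => i j *; lra.
have /(sh_complete H Du) [y Dy uy] : forall e : R, 0 < e -> exists N,
    forall m n, (N <= m)%N -> (N <= n)%N -> q (u m - u n) < e.
  move=> e e0; have e4 : 0 < e / 4 by rewrite divr_gt0.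
  exists (Num.truncn (e / 4)^-1) => m n Nm Nn.
  apply: le_lt_trans (half m n) _.
  have lt k : (Num.truncn (e / 4)^-1 <= k)%N -> k.+1%:R^-1 < e / 4.
    move=> Nk; rewrite invf_plt ?posrE //.
    by apply: lt_le_trans (truncnS_gt _) _; rewrite ler_nat.
  move: (lt _ Nm) (lt _ Nn); move: (m.+1%:R^-1 : R) (n.+1%:R^-1 : R) => i j.
  by rewrite mulr2n; lra.
exists y; split => //.
  by move=> e /uy [N uN]; exists (u N) => //; apply: uN.
move=> k Kk; have Dk := KD _ Kk.
apply: eq0_normc; apply/eqP; rewrite -sqrf_eq0 eq_le sqr_ge0 andbT.
apply/ler_addgt0Pr => e e0; rewrite add0r.
have qk1 : 0 < q k + 1 by apply: ltr_wpDl => //; exact: (sh_ge0 H).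
have e4 : 0 < e / 4 / (q k + 1) by rewrite !divr_gt0.
have [N uN] := uy _ e4.
pose n := maxn N (Num.truncn (e / 4 / (q k + 1))^-1).
have un : q (u n - y) < e / 4 / (q k + 1) by apply: uN; rewrite leq_maxl.
have n1 : n.+1%:R^-1 < e / 4 / (q k + 1).
  rewrite invf_plt ?posrE //; apply: lt_le_trans (truncnS_gt _) _.
  by rewrite ler_nat ltnS leq_maxr.
have h1 : normc (dot (x - u n) k) ^+ 2 <= e / 4.
  apply: le_trans (@q_min _ _ (inf E) (shB Dx (Du n)) Dk _) _.
    by move=> a; rewrite -addrA -opprD [u n + _]addrC; apply/infE/Klin.
  apply: (@le_trans _ _ (e / 4 / (q k + 1) * (q k + 1))); last first.
    by rewrite divfK ?gt_eqF.
  apply: ler_pM; rewrite ?(sh_ge0 H) ?lerDl // ?subr_ge0 ?infE //.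
  by move: (ltu n) n1; move: (n.+1%:R^-1 : R) => i *; lra.
have h2 : normc (dot (u n - y) k) ^+ 2 <= e / 4.
  apply: le_trans (cauchy_schwarz (shB (Du n) Dy) Dk) _.
  apply: (@le_trans _ _ (e / 4 / (q k + 1) * (q k + 1))); last first.
    by rewrite divfK ?gt_eqF.
  by apply: ler_pM; rewrite ?(sh_ge0 H) ?lerDl // ?(ltW un) //; apply: shB.
have -> : x - y = (x - u n) + (u n - y) by rewrite addrA subrK.
rewrite dotDl //; [|exact: shB..].
have := le_normcD (dot (x - u n) k) (dot (u n - y) k).
set a := normc (dot (x - u n) k) in h1 *; set b := normc (dot (u n - y) k) in h2 *.
move=> ab; apply: (@le_trans _ _ ((a + b) ^+ 2)).
  by rewrite ler_pXn2r ?nnegrE ?addr_ge0 ?normc_ge0.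
have : 0 <= (a - b) ^+ 2 by exact: sqr_ge0.
by rewrite sqrrB sqrrD !mulr2n; lra.
Qed.

End SemiHilbertTheory.

(** * Complex measurable and square integrable functions *)

Section ComplexMeasurable.
Context {R : realType} {d : measure_display} {T : measurableType d}.
Implicit Types f g : T -> R[i].

Lemma cmeas_cst (c : R[i]) : cmeasurable (fun _ : T => c).
Proof. by split; exact: measurable_cst. Qed.

Lemma cmeasD f g : cmeasurable f -> cmeasurable g ->
  cmeasurable (fun t => f t + g t).
Proof.
move=> [fr fi] [gr gi]; split.
  by under eq_fun do rewrite cReD; exact: measurable_funD.
by under eq_fun do rewrite cImD; exact: measurable_funD.
Qed.

Lemma cmeasM f g : cmeasurable f -> cmeasurable g ->
  cmeasurable (fun t => f t * g t).
Proof.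
move=> [fr fi] [gr gi]; split.
  under eq_fun do rewrite cReM.
  by apply: measurable_funB; exact: measurable_funM.
under eq_fun do rewrite cImM.
by apply: measurable_funD; exact: measurable_funM.
Qed.

Lemma cmeasN f : cmeasurable f -> cmeasurable (fun t => - f t).
Proof.
move=> [fr fi]; split.
  by under eq_fun do rewrite cReN; exact: measurable_funN.
by under eq_fun do rewrite cImN; exact: measurable_funN.
Qed.

Lemma cmeasJ f : cmeasurable f -> cmeasurable (fun t => (f t)^*).
Proof.
move=> [fr fi]; split; first by under eq_fun do rewrite cReJ.
by under eq_fun do rewrite cImJ; exact: measurable_funN.
Qed.

Lemma cmeas_real (f : T -> R) : measurable_fun setT f ->
  cmeasurable (fun t => (f t)%:C).
Proof. by move=> mf; split => //=; exact: measurable_cst. Qed.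

Lemma cmeas_if (b : T -> bool) f g : measurable_fun setT b ->
  cmeasurable f -> cmeasurable g -> cmeasurable (fun t => if b t then f t else g t).
Proof.
move=> mb [fr fi] [gr gi]; split.
  under eq_fun do rewrite (fun_if (@complex.Re R)).
  exact: measurable_fun_ifT.
under eq_fun do rewrite (fun_if (@complex.Im R)).
exact: measurable_fun_ifT.
Qed.

Lemma cmeas_bool (b : T -> bool) : measurable_fun setT b ->
  cmeasurable (fun t => (b t)%:R : R[i]).
Proof.
move=> mb; have -> : (fun t => (b t)%:R : R[i]) = (fun t => if b t then 1 else 0).
  by apply/funext => t; case: (b t).
by apply: cmeas_if => //; exact: cmeas_cst.
Qed.

Lemma meas_normc2 f : cmeasurable f ->
  measurable_fun setT (fun t => normc (f t) ^+ 2).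
Proof.
move=> [fr fi]; under eq_fun do rewrite sqr_normcE.
by apply: measurable_funD; exact: measurable_funX.
Qed.

Lemma meas_normc f : cmeasurable f -> measurable_fun setT (fun t => normc (f t)).
Proof.
move=> mf; have -> : (fun t => normc (f t))
    = Num.sqrt \o (fun t => normc (f t) ^+ 2).
  by apply/funext => t /=; rewrite sqrtr_sqr ger0_norm ?normc_ge0.
apply: measurableT_comp (meas_normc2 mf).
by apply: continuous_measurable_fun; exact: sqrt_continuous.
Qed.

Lemma cmeas_comp {d'} {T' : measurableType d'} (h : T' -> T) f :
  measurable_fun setT h -> cmeasurable f -> cmeasurable (f \o h).
Proof.
by move=> mh [fr fi]; split;
  [exact: (measurableT_comp fr mh)|exact: (measurableT_comp fi mh)].
Qed.

Lemma cmeas_lim (u : nat -> T -> R[i]) f : (forall n, cmeasurable (u n)) ->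
  (forall t, (fun n => complex.Re (u n t)) @ \oo --> complex.Re (f t)) ->
  (forall t, (fun n => complex.Im (u n t)) @ \oo --> complex.Im (f t)) ->
  cmeasurable f.
Proof.
move=> mu ur ui; split.
  by apply: (measurable_fun_cvg (fun n => (mu n).1)) => t _; exact: ur.
by apply: (measurable_fun_cvg (fun n => (mu n).2)) => t _; exact: ui.
Qed.

End ComplexMeasurable.

Section ComplexIntegral.
Context {R : realType} {d : measure_display} {T : measurableType d}.
Variable mu : {measure set T -> \bar R}.
Implicit Types f g : T -> R[i].
Local Notation L2 := (L2 mu).
Local Notation dot := (L2dot mu).
Local Notation q x := (complex.Re (dot x x)).

Lemma ae_andP (P Q : T -> Prop) : (\forall t \ae mu, P t) ->
  (\forall t \ae mu, Q t) -> \forall t \ae mu, P t /\ Q t.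
Proof. by move=> aP aQ; near=> t; split; near: t. Unshelve. all: by end_near. Qed.

Lemma ae_imp (P Q : T -> Prop) : (forall t, P t -> Q t) ->
  (\forall t \ae mu, P t) -> \forall t \ae mu, Q t.
Proof. by move=> PQ; apply: filterS. Qed.

Lemma ae_imp2 (P Q S : T -> Prop) : (forall t, P t -> Q t -> S t) ->
  (\forall t \ae mu, P t) -> (\forall t \ae mu, Q t) -> \forall t \ae mu, S t.
Proof. by move=> PQ; apply: filterS2. Qed.

Lemma ae_eqP f g : (f = g %[ae mu]) <-> \forall t \ae mu, f t = g t.
Proof. by split; apply: ae_imp => t; [apply|]. Qed.

Definition cintegrable f : Prop :=
  cmeasurable f /\ (\int[mu]_t (normc (f t))%:E < +oo)%E.

Lemma cintegrable_Re f : cintegrable f ->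
  mu.-integrable setT (EFin \o (fun t => complex.Re (f t))).
Proof.
move=> [mf fi]; apply: (@le_integrable _ _ _ _ _ measurableT _
    (fun t => (normc (f t))%:E)).
- exact/measurable_EFinP/mf.1.
- by move=> t _ /=; rewrite lee_fin (ger0_norm (normc_ge0 _)) abs_Re_normc.
- apply/integrableP; split; first exact/measurable_EFinP/meas_normc.
  by under eq_integral do rewrite gee0_abs ?lee_fin ?normc_ge0 //.
Qed.

Lemma cintegrable_Im f : cintegrable f ->
  mu.-integrable setT (EFin \o (fun t => complex.Im (f t))).
Proof.
move=> [mf fi]; apply: (@le_integrable _ _ _ _ _ measurableT _
    (fun t => (normc (f t))%:E)).
- exact/measurable_EFinP/mf.2.
- by move=> t _ /=; rewrite lee_fin (ger0_norm (normc_ge0 _)) abs_Im_normc.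
- apply/integrableP; split; first exact/measurable_EFinP/meas_normc.
  by under eq_integral do rewrite gee0_abs ?lee_fin ?normc_ge0 //.
Qed.

Lemma cintegrable_le f (g : T -> R) : cmeasurable f -> measurable_fun setT g ->
  (forall t, normc (f t) <= g t) -> (\int[mu]_t (g t)%:E < +oo)%E ->
  cintegrable f.
Proof.
move=> mf mg fg gi; split => //; apply: le_lt_trans gi.
apply: ge0_le_integral => //.
- by move=> t _; rewrite lee_fin normc_ge0.
- exact/measurable_EFinP/meas_normc.
- exact/measurable_EFinP.
- by move=> t _; rewrite lee_fin.
Qed.

Lemma cintegrableZ a f : cintegrable f -> cintegrable (fun t => a * f t).
Proof.
move=> [mf fi]; split; first by apply: cmeasM => //; exact: cmeas_cst.
under eq_integral do rewrite normcM EFinM.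
rewrite ge0_integralZl_EFin ?normc_ge0 //.
- by apply: lte_mul_pinfty; rewrite ?lee_fin ?normc_ge0.
- by move=> t _; rewrite lee_fin normc_ge0.
- exact/measurable_EFinP/meas_normc.
Qed.

Lemma cintegralD f g : cintegrable f -> cintegrable g ->
  cintegral mu (fun t => f t + g t) = cintegral mu f + cintegral mu g.
Proof.
move=> fi gi; apply: eq_ReIm => /=.
  under eq_Rintegral do rewrite cReD.
  by rewrite RintegralD //; exact: cintegrable_Re.
under eq_Rintegral do rewrite cImD.
by rewrite RintegralD //; exact: cintegrable_Im.
Qed.

Lemma cintegralZ a f : cintegrable f ->
  cintegral mu (fun t => a * f t) = a * cintegral mu f.
Proof.
move=> fi; have fr := cintegrable_Re fi; have fim := cintegrable_Im fi.
have ir (r : R) (g : T -> R) : mu.-integrable setT (EFin \o g) ->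
    mu.-integrable setT (EFin \o (fun t => r * g t)).
  by move=> gi; exact: (integrableZl measurableT r gi).
apply: eq_ReIm => /=.
  under eq_Rintegral do rewrite cReM.
  by rewrite RintegralB ?RintegralZl ?cReM //=; exact: ir.
under eq_Rintegral do rewrite cImM.
by rewrite RintegralD ?RintegralZl ?cImM //=; exact: ir.
Qed.

Lemma cintegralJ f : cintegrable f ->
  cintegral mu (fun t => (f t)^*) = (cintegral mu f)^*.
Proof.
move=> fi; apply: eq_ReIm; first by rewrite cReJ /=; under eq_Rintegral do rewrite cReJ.
rewrite cImJ /=; under eq_Rintegral do rewrite cImJ -mulN1r.
by rewrite RintegralZl ?mulN1r //; exact: cintegrable_Im.
Qed.

Lemma cintegral_ae f g : cmeasurable f -> cmeasurable g ->
  (\forall t \ae mu, f t = g t) -> cintegral mu f = cintegral mu g.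
Proof.
move=> mf mg fg; rewrite /cintegral; congr (_ +i* _); congr fine.
  apply: ae_eq_integral => //; [exact/measurable_EFinP/mf.1|
    exact/measurable_EFinP/mg.1|].
  by apply: ae_imp fg => t -> .
apply: ae_eq_integral => //; [exact/measurable_EFinP/mf.2|
  exact/measurable_EFinP/mg.2|].
by apply: ae_imp fg => t -> .
Qed.

Lemma L2_meas f : L2 f -> cmeasurable f. Proof. by case. Qed.

Lemma L2_0 : L2 (fun=> 0).
Proof.
split; first exact: cmeas_cst.
by under eq_integral do rewrite normc0 expr0n /=; rewrite integral0.
Qed.

Lemma L2_le (c : R) f g : cmeasurable f -> L2 g ->
  (\forall t \ae mu, normc (f t) <= c * normc (g t)) -> L2 f.
Proof.
move=> mf [mg gi] fg; split => //.
apply: (@le_lt_trans _ _ ((c ^+ 2)%:E * \int[mu]_t ((normc (g t)) ^+ 2)%:E)%E).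
  rewrite -ge0_integralZl_EFin ?sqr_ge0 //.
  - apply: ae_ge0_le_integral => //.
    + by move=> t _; rewrite lee_fin sqr_ge0.
    + exact/measurable_EFinP/meas_normc2.
    + by move=> t _; rewrite -EFinM lee_fin mulr_ge0 ?sqr_ge0.
    + apply/measurable_EFinP; apply: measurable_funM => //.
      exact: meas_normc2.
    + apply: ae_imp fg => t fg _; rewrite -EFinM lee_fin -exprMn.
      by rewrite ler_pXn2r ?nnegrE ?normc_ge0 // (le_trans _ fg) ?normc_ge0.
  - by move=> t _; rewrite lee_fin sqr_ge0.
  - exact/measurable_EFinP/meas_normc2.
by apply: lte_mul_pinfty; rewrite ?lee_fin ?sqr_ge0.
Qed.

Lemma L2_ae f g : cmeasurable f -> L2 g -> (\forall t \ae mu, f t = g t) -> L2 f.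
Proof.
move=> mf gi fg; apply: (L2_le (c := 1) mf gi).
by apply: ae_imp fg => t ->; rewrite mul1r.
Qed.

Lemma L2D f g : L2 f -> L2 g -> L2 (fun t => f t + g t).
Proof.
move=> [mf fi] [mg gi]; split; first exact: cmeasD.
apply: (@le_lt_trans _ _ (\int[mu]_t (2%:E * (((normc (f t)) ^+ 2)%:E
    + ((normc (g t)) ^+ 2)%:E)))%E).
  apply: ge0_le_integral => //.
  - by move=> t _; rewrite lee_fin sqr_ge0.
  - by apply/measurable_EFinP/meas_normc2; exact: cmeasD.
  - apply/measurable_EFinP; apply: measurable_funM => //.
    by apply: measurable_funD; exact: meas_normc2.
  - move=> t _; rewrite -EFinD -EFinM lee_fin.
    apply: (@le_trans _ _ ((normc (f t) + normc (g t)) ^+ 2)).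
      by rewrite ler_pXn2r ?nnegrE ?addr_ge0 ?normc_ge0 ?le_normcD.
    have : 0 <= (normc (f t) - normc (g t)) ^+ 2 by exact: sqr_ge0.
    by rewrite sqrrB sqrrD !mulr2n; lra.
have m2 (h : T -> R[i]) : cmeasurable h ->
    measurable_fun setT (fun t => ((normc (h t)) ^+ 2)%:E).
  by move=> mh; exact/measurable_EFinP/meas_normc2.
have p2 (h : T -> R[i]) t : (0 <= ((normc (h t)) ^+ 2)%:E)%E.
  by rewrite lee_fin sqr_ge0.
rewrite ge0_integralZl_EFin //; last 2 first.
- by move=> t _; rewrite adde_ge0.
- by apply: emeasurable_funD; exact: m2.
rewrite ge0_integralD //; [|exact: m2..].
by apply: lte_mul_pinfty => //; rewrite lte_add_pinfty.
Qed.

Lemma L2Z a f : L2 f -> L2 (fun t => a * f t).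
Proof.
move=> fi; apply: (L2_le (c := normc a) _ fi).
  by apply: cmeasM; [exact: cmeas_cst|exact: L2_meas].
by apply: aeW => t; rewrite normcM.
Qed.

Lemma L2_lin a f g : L2 f -> L2 g -> L2 (fun t => a * f t + g t).
Proof. by move=> fi gi; apply: L2D => //; exact: L2Z. Qed.

Lemma L2_mulJ f g : L2 f -> L2 g -> cintegrable (fun t => f t * (g t)^*).
Proof.
move=> [mf fi] [mg gi].
apply: (@cintegrable_le _ (fun t => normc (f t) ^+ 2 + normc (g t) ^+ 2)).
- by apply: cmeasM => //; exact: cmeasJ.
- by apply: measurable_funD; exact: meas_normc2.
- move=> t; rewrite normcM cnormJ.
  have : 0 <= (normc (f t) - normc (g t)) ^+ 2 by exact: sqr_ge0.
  rewrite sqrrB mulr2n; have := normc_ge0 (f t); have := normc_ge0 (g t).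
  by nra.
under eq_integral do rewrite EFinD.
rewrite ge0_integralD //; first by rewrite lte_add_pinfty.
- by move=> t _; rewrite lee_fin sqr_ge0.
- exact/measurable_EFinP/meas_normc2.
- by move=> t _; rewrite lee_fin sqr_ge0.
- exact/measurable_EFinP/meas_normc2.
Qed.

Lemma dot_linl a f g h : L2 f -> L2 g -> L2 h ->
  dot (fun t => a * f t + g t) h = a * dot f h + dot g h.
Proof.
move=> fi gi hi; rewrite /L2dot.
under eq_fun do rewrite mulrDl -mulrA.
rewrite cintegralD ?cintegralZ //; first exact: L2_mulJ.
  by apply: cintegrableZ; exact: L2_mulJ.
exact: L2_mulJ.
Qed.

Lemma dot_conj f g : L2 f -> L2 g -> dot g f = (dot f g)^*.
Proof.
move=> fi gi; rewrite /L2dot -cintegralJ; last exact: L2_mulJ.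
by congr cintegral; apply/funext => t; rewrite conjcM conjCK mulrC.
Qed.

Lemma dot_self f : dot f f = (\int[mu]_t (normc (f t)) ^+ 2)%:C.
Proof.
apply: eq_ReIm => /=.
  by apply: eq_Rintegral => t _; rewrite cmulJ.
under eq_Rintegral do rewrite cmulJ /=.
by rewrite /Rintegral integral0.
Qed.

Lemma qE f : q f = \int[mu]_t (normc (f t)) ^+ 2.
Proof. by rewrite dot_self. Qed.

Lemma q_ge0 f : 0 <= q f.
Proof. by rewrite qE; apply: Rintegral_ge0 => t _; exact: sqr_ge0. Qed.

Lemma q_EFin f : L2 f -> (q f)%:E = (\int[mu]_t ((normc (f t)) ^+ 2)%:E)%E.
Proof.
move=> [_ fi]; rewrite qE /Rintegral fineK // ge0_fin_numE //.
by apply: integral_ge0 => t _; rewrite lee_fin sqr_ge0.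
Qed.

Lemma q_norm f : q f = L2norm mu f ^+ 2.
Proof. by rewrite /L2norm -qE sqr_sqrtr // q_ge0. Qed.

Lemma L2norm_ge0 f : 0 <= L2norm mu f.
Proof. exact: sqrtr_ge0. Qed.

Lemma q_eq0_ae f : L2 f -> q f = 0 -> \forall t \ae mu, f t = 0.
Proof.
move=> fi q0; have := q_EFin fi; rewrite q0 => /esym h.
have : (\int[mu]_t `|((normc (f t)) ^+ 2)%:E| = 0)%E.
  by under eq_integral do rewrite gee0_abs ?lee_fin ?sqr_ge0 //.
move/ae_eq_integral_abs => /(_ measurableT).
have mf : measurable_fun setT (fun t => ((normc (f t)) ^+ 2)%:E).
  by apply/measurable_EFinP/meas_normc2; exact: fi.1.
move=> /(_ mf); apply: ae_imp => t /(_ I) /= [] /eqP.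
by rewrite sqrf_eq0 => /eqP /eq0_normc.
Qed.

Lemma dot_ae f f' g g' : L2 f -> L2 f' -> L2 g -> L2 g' ->
  (\forall t \ae mu, f t = f' t) -> (\forall t \ae mu, g t = g' t) ->
  dot f g = dot f' g'.
Proof.
move=> fi fi' gi gi' ff gg; apply: cintegral_ae.
- by apply: cmeasM; [|apply: cmeasJ]; exact: L2_meas.
- by apply: cmeasM; [|apply: cmeasJ]; exact: L2_meas.
- by apply: ae_imp2 ff gg => t -> ->.
Qed.

Lemma q_ae0 f : L2 f -> (\forall t \ae mu, f t = 0) -> q f = 0.
Proof.
move=> fi f0; rewrite (dot_ae fi L2_0 fi L2_0 f0 f0) qE.
by under eq_Rintegral do rewrite normc0 expr0n /=; rewrite /Rintegral integral0.
Qed.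

End ComplexIntegral.

(** * Completeness of the space of square integrable functions *)

Section Completeness.
Context {R : realType} {d : measure_display} {T : measurableType d}.
Variable mu : {measure set T -> \bar R}.
Implicit Types f g : T -> R[i].
Local Notation L2 := (L2 mu).
Local Notation dot := (L2dot mu).
Local Notation q x := (complex.Re (dot x x)).
Local Notation C := (R[i]).

Lemma limn_einf_le (u : (\bar R)^nat) (c : \bar R) :
  (forall n, (u n <= c)%E) -> (limn_einf u <= c)%E.
Proof.
move=> uc; rewrite limn_einf_lim; apply: lime_le; first exact: is_cvg_einfs.
apply: nearW => n; apply: le_trans (uc n); apply: ereal_inf_lbound.
by exists n => //=.
Qed.

Lemma fatou_L2 (v : nat -> T -> C) f (c : \bar R) :
  (forall k, cmeasurable (v k)) -> cmeasurable f ->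
  (forall t, (fun k => normc (v k t) ^+ 2) @ \oo --> normc (f t) ^+ 2) ->
  (forall k, (\int[mu]_t ((normc (v k t)) ^+ 2)%:E <= c)%E) ->
  (\int[mu]_t ((normc (f t)) ^+ 2)%:E <= c)%E.
Proof.
move=> mv mf vf vc.
apply: le_trans (limn_einf_le vc).
apply: le_trans (fatou _ _ _ _) => //.
- rewrite le_eqVlt; apply/orP; left; apply/eqP; apply: eq_integral => t _.
  have cv : (fun k => ((normc (v k t)) ^+ 2)%:E) @ \oo --> ((normc (f t)) ^+ 2)%:E.
    exact/cvg_EFin/vf/nearW.
  by have [-> _] := cvg_limn_einf_sup cv.
- by move=> n; exact/measurable_EFinP/meas_normc2.
- by move=> n t _; rewrite lee_fin sqr_ge0.
Qed.

Lemma cauchy_geometric (a : nat -> R) (c : R) :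
  (forall k, `|a k.+1 - a k| <= c * 2^-1 ^+ k) -> cvgn a.
Proof.
move=> ac.
have c0 : 0 <= c by have := ac 0%N; rewrite expr0 mulr1; apply: le_trans.
suff : cvgn (series (telescope a)).
  rewrite telescopeK => cv.
  have -> : a = (fun n => (a n - a 0%N) + a 0%N) by apply/funext => n; rewrite subrK.
  by apply: is_cvgD => //; exact: is_cvg_cst.
apply: normed_cvg; apply: (@series_le_cvg _ _ (geometric c 2^-1)).
- by move=> n; exact: normr_ge0.
- by move=> n; apply: geometric_ge0; rewrite ?invr_ge0.
- by move=> n; exact: ac.
by apply: is_cvg_geometric_series; rewrite ger0_norm ?invr_ge0 // invf_lt1 ?ltr1n.
Qed.

(** Along a subsequence with rapidly decreasing increments [w k], the sum of
    the [4 ^ k |w k| ^ 2] has a finite integral, so it is finite almost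
    everywhere, which forces pointwise geometric convergence. *)
Lemma L2_complete (u : nat -> T -> C) : (forall n, L2 (u n)) ->
  (forall e : R, 0 < e -> exists N, forall m n, (N <= m)%N -> (N <= n)%N ->
    q (u m - u n) < e) ->
  exists2 x, L2 x & forall e : R, 0 < e -> exists N, forall n, (N <= n)%N ->
    q (u n - x) < e.
Proof.
move=> Lu cauchy.
have LB f g : L2 f -> L2 g -> L2 (f - g).
  move=> Lf Lg; have := L2D Lf (L2Z (-1) Lg).
  by congr (Defs.L2 mu); apply/funext => t; rewrite mulN1r.
have e8 k : 0 < (8^-1 ^+ k : R) by rewrite exprn_gt0 // invr_gt0.
pose N k := sval (cid (cauchy _ (e8 k))).
have NP k m n : (N k <= m)%N -> (N k <= n)%N -> q (u m - u n) < 8^-1 ^+ k.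
  by move: m n; rewrite /N; case: cid.
pose phi k := (\sum_(i < k.+1) N i)%N.
have Nphi k : (N k <= phi k)%N by rewrite /phi big_ord_recr leq_addl.
have phiS k : (phi k <= phi k.+1)%N by rewrite /phi [leqRHS]big_ord_recr leq_addr.
have phi_mono k l : (k <= l)%N -> (phi k <= phi l)%N.
  elim: l => [|l IH]; first by rewrite leqn0 => /eqP ->.
  rewrite leq_eqVlt => /predU1P[-> //|]; rewrite ltnS => /IH h.
  exact: leq_trans h (phiS l).
pose w k : T -> C := u (phi k.+1) - u (phi k).
have Lw k : L2 (w k) by exact: LB.
have qw k : q (w k) < 8^-1 ^+ k.
  by apply: NP => //; exact: leq_trans (Nphi k) (phiS k).
pose F t : \bar R := (\sum_(k <oo) (4 ^+ k * normc (w k t) ^+ 2)%:E)%E.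
have F0 k t : (0 <= (4 ^+ k * normc (w k t) ^+ 2)%:E)%E.
  by rewrite lee_fin mulr_ge0 ?sqr_ge0 ?exprn_ge0.
have mFk k : measurable_fun setT (fun t => (4 ^+ k * normc (w k t) ^+ 2)%:E).
  apply/measurable_EFinP; apply: measurable_funM => //.
  apply: meas_normc2; exact: (Lw k).1.
have mF : measurable_fun setT F.
  exact: (@ge0_emeasurable_sum _ _ _ _
    (fun k t => (4 ^+ k * normc (w k t) ^+ 2)%:E) xpredT).
have intF : (\int[mu]_t F t < +oo)%E.
  rewrite integral_nneseries //.
  apply: (@le_lt_trans _ _ (\sum_(k <oo) ((2^-1 : R) ^+ k)%:E)%E).
    apply: lee_nneseries => [k _ _|k _]; first by apply: integral_ge0.
    under eq_integral do rewrite EFinM.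
    rewrite ge0_integralZl_EFin ?exprn_ge0 //.
    - rewrite -q_EFin // -EFinM lee_fin.
      have -> : (2^-1 ^+ k : R) = 4 ^+ k * 8^-1 ^+ k.
        by rewrite -exprMn; congr (_ ^+ _); field.
      by rewrite ler_pM2l ?exprn_gt0 // ltW.
    - by move=> t _; rewrite lee_fin sqr_ge0.
    - by apply/measurable_EFinP/meas_normc2; exact: (Lw k).1.
  have cv : series (geometric 1 (2^-1 : R)) @ \oo --> (1 * (1 - 2^-1)^-1 : R).
    by apply: cvg_geometric_series; rewrite ger0_norm ?invr_ge0 // invf_lt1 ?ltr1n.
  have -> : (\sum_(k <oo) ((2^-1 : R) ^+ k)%:E)%E = (1 * (1 - 2^-1)^-1 : R)%:E.
    have E n : (\sum_(0 <= k < n) ((2^-1 : R) ^+ k)%:E)%E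
        = (series (geometric 1 (2^-1 : R)) n)%:E.
      by rewrite /series /= -sumEFin; apply: eq_bigr => i _; rewrite mul1r.
    apply/cvg_lim => //; apply: cvg_EFin.
      by apply: nearW => n; rewrite E.
    by under eq_fun do rewrite /= E /=.
  exact: ltry.
pose good t := (F t < +oo)%E.
have mgood : measurable_fun setT good.
  apply: (measurable_fun_bool true); rewrite setTI.
  have -> : good @^-1` [set true] = F @^-1` [set x | (x < +oo)%E].
    by apply/seteqP; split => t.
  by rewrite -[X in measurable X]setTI; exact: emeasurable_fun_infty_o.
have aegood : \forall t \ae mu, good t.
  have Fi : mu.-integrable setT F.
    apply/integrableP; split => //.
    by under eq_integral do rewrite gee0_abs ?nneseries_ge0 //.
  have := integrable_ae measurableT Fi; apply: ae_imp => t /(_ I).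
  by rewrite /good ltey_eq => ->.
pose v k t : C := if good t then u (phi k) t else 0.
have mv k : cmeasurable (v k).
  by apply: cmeas_if mgood (Lu _).1 (cmeas_cst 0).
have bound t : exists c : R, forall k, normc (v k.+1 t - v k t) <= c * 2^-1 ^+ k.
  case gt : (good t); last first.
    by exists 0 => k; rewrite /v gt subrr normc0 mul0r.
  exists (Num.sqrt (fine (F t))) => k; rewrite /v gt.
  have Fge0 : (0 <= F t)%E by apply: nneseries_ge0.
  have Ffin : F t \is a fin_num by rewrite ge0_fin_numE.
  rewrite -(@ler_pXn2r _ 2%N) ?nnegrE ?normc_ge0 ?mulr_ge0 ?sqrtr_ge0 ?exprn_ge0 ?invr_ge0 //.
  rewrite exprMn sqr_sqrtr ?fine_ge0 // -exprM mulnC exprM.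
  have -> : (2^-1 ^+ 2 : R) = 4^-1 by field.
  rewrite exprVn ler_pdivlMr ?exprn_gt0 // mulrC -lee_fin fineK //.
  rewrite /F (nneseriesD1 (n:=k)) ?addn1 //.
  by rewrite leeDl // nneseries_ge0.
have cvgRe t : cvgn (fun k => complex.Re (v k t)).
  have [c ct] := bound t; apply: (@cauchy_geometric _ c) => k.
  by rewrite -cReN -cReD; exact: le_trans (abs_Re_normc _) (ct k).
have cvgIm t : cvgn (fun k => complex.Im (v k t)).
  have [c ct] := bound t; apply: (@cauchy_geometric _ c) => k.
  by rewrite -cImN -cImD; exact: le_trans (abs_Im_normc _) (ct k).
pose x t : C := (limn (fun k => complex.Re (v k t)))
                +i* (limn (fun k => complex.Im (v k t))).
have mx : cmeasurable x by apply: (cmeas_lim mv) => t /=.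
have tail n k : (N k <= n)%N ->
    (\int[mu]_t ((normc (u n t - x t)) ^+ 2)%:E <= (8^-1 ^+ k)%:E)%E.
  move=> kn.
  apply: (@fatou_L2 (fun l t => u n t - v (k + l)%N t)).
  - by move=> l; apply: cmeasD; [exact: (Lu n).1|exact: cmeasN].
  - by apply: cmeasD; [exact: (Lu n).1|exact: cmeasN].
  - move=> t; under eq_fun do rewrite sqr_normcE !cReD !cImD !cReN !cImN.
    rewrite sqr_normcE !cReD !cImD !cReN !cImN.
    have shift (a : nat -> R) l : a @ \oo --> l -> (fun i => a (k + i)%N) @ \oo --> l.
      by move=> al; under eq_fun do rewrite addnC; rewrite -(cvg_shiftn k) in al.
    have e2 (a : nat -> R) l c : a @ \oo --> l ->
        (fun i => (c - a (k + i)%N) ^+ 2) @ \oo --> (c - l) ^+ 2.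
      move=> al; rewrite expr2; under eq_fun do rewrite expr2.
      have h : (fun i => c - a (k + i)%N) @ \oo --> c - l.
        by apply: cvgB; [exact: cvg_cst|exact: shift].
      exact: cvgM.
    exact: (cvgD (e2 _ _ _ (cvgRe t)) (e2 _ _ _ (cvgIm t))).
  - move=> l; have knl : (N k <= phi (k + l))%N.
      by apply: leq_trans (Nphi k) _; apply: phi_mono; rewrite leq_addr.
    apply: (@le_trans _ _ (\int[mu]_t ((normc ((u n - u (phi (k + l)%N)) t)) ^+ 2)%:E)%E).
      apply: ae_ge0_le_integral => //.
      + by move=> t _; rewrite lee_fin sqr_ge0.
      + apply/measurable_EFinP/meas_normc2.
        by apply: cmeasD; [exact: (Lu n).1|exact: cmeasN].
      + by move=> t _; rewrite lee_fin sqr_ge0.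
      + by apply/measurable_EFinP/meas_normc2; exact: (LB _ _ (Lu n) (Lu _)).1.
      + by apply: ae_imp aegood => t gt _; rewrite /v gt.
    by rewrite -q_EFin ?lee_fin ?(ltW (NP _ _ _ kn knl)) //; exact: LB.
have Lx : L2 x.
  have Lux : L2 (fun t => u (N 0%N) t - x t).
    split; first by apply: cmeasD; [exact: (Lu _).1|exact: cmeasN].
    by apply: le_lt_trans (tail _ 0%N (leqnn _)) _; exact: ltry.
  have := L2D (Lu (N 0%N)) (L2Z (-1) Lux); congr (Defs.L2 mu).
  by apply/funext => t; rewrite mulN1r opprB addrC subrK.
exists x => // e e0.
have [k ke] : exists k, (8^-1 ^+ k : R) < e.
  have := @cvg_geometric R 1 8^-1.
  rewrite ger0_norm ?invr_ge0 // invf_lt1 ?ltr1n // => /(_ isT) /cvgr_lt /(_ _ e0).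
  by case=> k _ h; exists k; have := h k (leqnn k); rewrite /= mul1r.
exists (N k) => n kn; apply: le_lt_trans ke.
by have := tail _ _ kn; rewrite -lee_fin q_EFin //; exact: LB.
Qed.

Lemma L2_semi_hilbert : semi_hilbert (V := T -> R[i]) L2 dot.
Proof.
split.
- exact: L2_0.
- by move=> a x y Lx Ly; exact: L2_lin.
- by move=> a x y z Lx Ly Lz; exact: dot_linl.
- by move=> x y Lx Ly; exact: dot_conj.
- by move=> x _; exact: q_ge0.
- exact: L2_complete.
Qed.

End Completeness.

(** * Bounded operators, commutants and von Neumann algebras *)

Section BoundedOperators.
Context {R : realType} {d : measure_display} {T : measurableType d}.
Variable mu : {measure set T -> \bar R}.
Local Notation C := (R[i]).
Local Notation L2 := (L2 mu).
Local Notation dot := (L2dot mu).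
Local Notation q x := (complex.Re (dot x x)).
Local Notation bounded_op := (bounded_op mu).
Local Notation op_eq := (op_eq mu).
Local Notation adjoint := (adjoint mu).
Local Notation H := (L2_semi_hilbert mu).
Implicit Types (f g x y : T -> C) (S U V : op R T) (A E : set (op R T)).

Lemma bounded_L2 S x : bounded_op S -> L2 x -> L2 (S x).
Proof. by case=> h _ _; exact: h. Qed.

Lemma bounded_lin S a x y : bounded_op S -> L2 x -> L2 y ->
  \forall t \ae mu, S (fun t => a * x t + y t) t = a * S x t + S y t.
Proof. by case=> _ h _ Lx Ly; apply/ae_eqP; exact: h. Qed.

Lemma op_norm_leP S (c : R) : 0 <= c -> (forall x, L2 x -> L2 (S x)) ->
  op_norm_le mu S c <-> forall x, L2 x -> q (S x) <= c ^+ 2 * q x.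
Proof.
move=> c0 SL; split => h x Lx; have := h x Lx; rewrite ?q_norm -?exprMn.
  by move=> le; rewrite ler_pXn2r ?nnegrE ?mulr_ge0 ?L2norm_ge0.
by rewrite ler_pXn2r ?nnegrE ?mulr_ge0 ?L2norm_ge0.
Qed.

Lemma bounded_q S : bounded_op S ->
  exists2 c : R, 0 <= c & forall x, L2 x -> q (S x) <= c ^+ 2 * q x.
Proof.
move=> bS; have [SL _ [c Sc]] := bS; exists `|c| => //.
apply/op_norm_leP => // x Lx; apply: le_trans (Sc x Lx) _.
by rewrite ler_wpM2r ?L2norm_ge0 ?ler_norm.
Qed.

Lemma bounded_0 S x : bounded_op S -> L2 x -> (\forall t \ae mu, x t = 0) ->
  \forall t \ae mu, S x t = 0.
Proof.
move=> bS Lx x0; have [c c0 Sc] := bounded_q bS.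
apply: (q_eq0_ae (bounded_L2 bS Lx)); apply/le_anti; rewrite q_ge0 andbT.
by apply: le_trans (Sc _ Lx) _; rewrite (q_ae0 Lx x0) mulr0.
Qed.

Lemma L2B x y : L2 x -> L2 y -> L2 (fun t => x t - y t).
Proof.
move=> Lx Ly; have := L2D Lx (L2Z (-1) Ly).
by congr (Defs.L2 mu); apply/funext => t; rewrite mulN1r.
Qed.

Lemma bounded_B S x y : bounded_op S -> L2 x -> L2 y ->
  \forall t \ae mu, S (fun t => x t - y t) t = S x t - S y t.
Proof.
move=> bS Lx Ly; have := bounded_lin (-1) bS Ly Lx.
have -> : (fun t => -1 * y t + x t) = (fun t => x t - y t).
  by apply/funext => t; rewrite mulN1r addrC.
by apply: ae_imp => t ->; rewrite mulN1r addrC.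
Qed.

Lemma bounded_D S x y : bounded_op S -> L2 x -> L2 y ->
  \forall t \ae mu, S (fun t => x t + y t) t = S x t + S y t.
Proof.
move=> bS Lx Ly; have := bounded_lin 1 bS Lx Ly.
have -> : (fun t => 1 * x t + y t) = (fun t => x t + y t).
  by apply/funext => t; rewrite mul1r.
by apply: ae_imp => t ->; rewrite mul1r.
Qed.

Lemma bounded_ae S x y : bounded_op S -> L2 x -> L2 y ->
  (\forall t \ae mu, x t = y t) -> \forall t \ae mu, S x t = S y t.
Proof.
move=> bS Lx Ly xy.
have xy0 : \forall t \ae mu, x t - y t = 0.
  by apply: ae_imp xy => t ->; rewrite subrr.
apply: ae_imp2 (bounded_0 bS (L2B Lx Ly) xy0) (bounded_B bS Lx Ly) => t -> /eqP.
by rewrite eq_sym subr_eq0 => /eqP.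
Qed.

Lemma dot_sep x y : L2 x -> L2 y -> (forall z, L2 z -> dot x z = dot y z) ->
  \forall t \ae mu, x t = y t.
Proof.
move=> Lx Ly xy; have Lxy := L2B Lx Ly.
have : q (fun t => x t - y t) = 0.
  by rewrite (dotBl H Lx Ly Lxy) xy // subrr.
by move/(q_eq0_ae Lxy); apply: ae_imp => t /eqP; rewrite subr_eq0 => /eqP.
Qed.

Lemma dot_sepr x y : L2 x -> L2 y -> (forall z, L2 z -> dot z x = dot z y) ->
  \forall t \ae mu, x t = y t.
Proof.
move=> Lx Ly xy; apply: dot_sep => // z Lz.
by rewrite (dot_conj Lz Lx) (dot_conj Lz Ly) xy.
Qed.

Lemma op_eqP S U : op_eq S U <-> forall x, L2 x -> \forall t \ae mu, S x t = U x t.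
Proof. by split=> h x /h /ae_eqP. Qed.

Lemma op_eq_refl S : op_eq S S.
Proof. by apply/op_eqP => x _; exact: aeW. Qed.

Lemma op_eq_sym S U : op_eq S U -> op_eq U S.
Proof. by move=> /op_eqP h; apply/op_eqP => x /h; apply: ae_imp => t. Qed.

Lemma op_eq_trans S U V : op_eq S U -> op_eq U V -> op_eq S V.
Proof.
move=> /op_eqP h /op_eqP k; apply/op_eqP => x Lx.
by apply: ae_imp2 (h x Lx) (k x Lx) => t ->.
Qed.

Lemma op_eq_comp S S' U U' : bounded_op S -> bounded_op U -> bounded_op U' ->
  op_eq S S' -> op_eq U U' -> op_eq (S \o U) (S' \o U').
Proof.
move=> bS bU bU' /op_eqP SS /op_eqP UU; apply/op_eqP => x Lx /=.
have LU := bounded_L2 bU Lx; have LU' := bounded_L2 bU' Lx.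
by apply: ae_imp2 (bounded_ae bS LU LU' (UU x Lx)) (SS _ LU') => t ->.
Qed.

Lemma bounded_id : bounded_op idfun.
Proof.
split=> //; first by move=> a x y _ _; apply/ae_eqP; exact: aeW.
by exists 1 => x _; rewrite mul1r /= lexx.
Qed.

Lemma bounded_op_lin a S U : bounded_op S -> bounded_op U ->
  bounded_op (op_lin a S U).
Proof.
move=> bS bU; have [c c0 Sc] := bounded_q bS; have [e e0 Ue] := bounded_q bU.
have Lin x : L2 x -> L2 (op_lin a S U x).
  by move=> Lx; apply: L2_lin; exact: bounded_L2.
split=> //.
  move=> b x y Lx Ly; apply/ae_eqP; rewrite /op_lin.
  apply: ae_imp2 (bounded_lin b bS Lx Ly) (bounded_lin b bU Lx Ly) => t -> ->.
  by ring.
exists (Num.sqrt ((normc a ^+ 2 * c ^+ 2) *+ 2 + e ^+ 2 *+ 2)).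
have k0 : 0 <= (normc a ^+ 2 * c ^+ 2) *+ 2 + e ^+ 2 *+ 2.
  by apply: addr_ge0; apply: mulrn_wge0; [apply: mulr_ge0|]; exact: sqr_ge0.
apply/op_norm_leP => [|//|x Lx]; first exact: sqrtr_ge0.
rewrite sqr_sqrtr //; apply: le_trans (qD_le H (L2Z a (bounded_L2 bS Lx)) (bounded_L2 bU Lx)) _.
rewrite (qZ H a (bounded_L2 bS Lx)) mulrDl !mulrnAl.
apply: lerD; rewrite ler_pMn2r ?Ue // -[X in _ <= X]mulrA.
by apply: ler_wpM2l; [exact: sqr_ge0|exact: Sc].
Qed.

Lemma bounded_comp S U : bounded_op S -> bounded_op U -> bounded_op (S \o U).
Proof.
move=> bS bU; have [c c0 Sc] := bounded_q bS; have [e e0 Ue] := bounded_q bU.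
have L x : L2 x -> L2 (S (U x)) by move=> Lx; exact: bounded_L2 bS (bounded_L2 bU Lx).
split=> //.
  move=> a x y Lx Ly; apply/ae_eqP => /=.
  have LUx := bounded_L2 bU Lx; have LUy := bounded_L2 bU Ly.
  have h := bounded_ae bS (bounded_L2 bU (L2_lin a Lx Ly)) (L2_lin a LUx LUy)
    (bounded_lin a bU Lx Ly).
  by apply: ae_imp2 h (bounded_lin a bS LUx LUy) => t ->.
exists (c * e); apply/op_norm_leP => [|//|x Lx]; first exact: mulr_ge0.
apply: le_trans (Sc _ (bounded_L2 bU Lx)) _.
by rewrite exprMn -[X in _ <= X]mulrA; apply: ler_wpM2l; [exact: sqr_ge0|exact: Ue].
Qed.

Lemma adjoint_sym S U : bounded_op S -> bounded_op U -> adjoint S U -> adjoint U S.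
Proof.
move=> bS bU SU x y Lx Ly.
by rewrite (dot_conj Ly (bounded_L2 bU Lx)) -SU // (dot_conj (bounded_L2 bS Ly) Lx).
Qed.

Lemma adjoint_comp S S' U U' : bounded_op S' -> bounded_op U ->
  adjoint S S' -> adjoint U U' -> adjoint (S \o U) (U' \o S').
Proof.
move=> bS bU SS UU x y Lx Ly /=.
by rewrite SS ?UU //; apply: bounded_L2.
Qed.

Lemma adjoint_lin a S S' U U' : bounded_op S -> bounded_op S' ->
  bounded_op U -> bounded_op U' -> adjoint S S' -> adjoint U U' ->
  adjoint (op_lin a S U) (op_lin a^* S' U').
Proof.
move=> bS bS' bU bU' SS UU x y Lx Ly; rewrite /op_lin.
rewrite (dot_linl a (bounded_L2 bS Lx) (bounded_L2 bU Lx) Ly).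
have LS := bounded_L2 bS' Ly; have LU := bounded_L2 bU' Ly.
rewrite (dot_conj (L2_lin a^* LS LU) Lx) (dot_linl a^* LS LU Lx).
by rewrite conjcD conjcM conjCK -(dot_conj LS Lx) -(dot_conj LU Lx) SS // UU.
Qed.

Definition commute S U := op_eq (S \o U) (U \o S).

Definition commutant E : set (op R T) :=
  [set S | bounded_op S /\ forall U, E U -> commute S U].

Definition adj_closed E : Prop :=
  forall U, E U -> bounded_op U /\ exists2 U', E U' & adjoint U U'.

Lemma commute_lin a S S' U : bounded_op S -> bounded_op S' -> bounded_op U ->
  commute S U -> commute S' U -> commute (op_lin a S S') U.
Proof.
move=> bS bS' bU /op_eqP SU /op_eqP SU'; apply/op_eqP => x Lx /=; rewrite /op_lin.
have h := bounded_lin a bU (bounded_L2 bS Lx) (bounded_L2 bS' Lx).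
have := ae_andP (SU x Lx) (SU' x Lx).
by apply: ae_imp2 h => t -> [] /= -> ->.
Qed.

Lemma commute_comp S S' U : bounded_op S -> bounded_op S' -> bounded_op U ->
  commute S U -> commute S' U -> commute (S \o S') U.
Proof.
move=> bS bS' bU SU SU'.
apply: (@op_eq_trans _ (S \o (U \o S'))).
  by apply: (op_eq_comp bS (bounded_comp bS' bU) (bounded_comp bU bS') (op_eq_refl _) SU').
exact: (op_eq_comp (bounded_comp bS bU) bS' bS' SU (op_eq_refl _)).
Qed.

Lemma commute_sym S U : commute S U -> commute U S.
Proof. exact: op_eq_sym. Qed.

Lemma commute_adj S S' U U' : bounded_op S -> bounded_op S' ->
  bounded_op U -> bounded_op U' -> adjoint S S' -> adjoint U U' ->
  commute S U' -> commute S' U.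
Proof.
move=> bS bS' bU bU' SS UU /op_eqP SU; apply/op_eqP => x Lx /=.
have LUx := bounded_L2 bU Lx; have LSx := bounded_L2 bS' Lx.
apply: dot_sepr; [exact: bounded_L2|exact: bounded_L2|] => y Ly.
have LSy := bounded_L2 bS Ly; have LUy := bounded_L2 bU' Ly.
have UU' := adjoint_sym bU bU' UU.
rewrite -SS // -UU' // -(UU' y) // -SS //.
apply: dot_ae => //; [exact: bounded_L2|exact: bounded_L2| |exact: aeW].
by apply: ae_imp (SU y Ly) => t /= ->.
Qed.

(** The matrix coefficients of a commutator [S U - U S] are differences of two
    matrix coefficients of [S] alone, because [U] has an adjoint; hence they
    depend weakly continuously on [S]. *)
Lemma commutant_vN E : adj_closed E -> vN_algebra mu (commutant E).
Proof.
move=> Eadj; split; first split.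
- by move=> S [].
- by split; [exact: bounded_id|move=> U _; exact: op_eq_refl].
- move=> a S S' [bS SE] [bS' SE']; split; first exact: bounded_op_lin.
  move=> U EU; have [bU _] := Eadj U EU.
  by apply: commute_lin => //; [exact: SE|exact: SE'].
- move=> S S' [bS SE] [bS' SE']; split; first exact: bounded_comp.
  move=> U EU; have [bU _] := Eadj U EU.
  by apply: commute_comp => //; [exact: SE|exact: SE'].
- move=> S S' [bS SE] bS' SS; split=> // U EU.
  have [bU [U' EU' UU]] := Eadj U EU; have [bU' _] := Eadj U' EU'.
  by apply: (commute_adj bS bS' bU bU' SS UU); exact: SE.
move=> S bS Sapprox; split=> // U EU.
have [bU [U' EU' UU]] := Eadj U EU; have [bU' _] := Eadj U' EU'.
apply/op_eqP => x Lx /=.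
have LUx := bounded_L2 bU Lx; have LSx := bounded_L2 bS Lx.
apply: dot_sep; [exact: bounded_L2|exact: bounded_L2|] => y Ly.
have LUy := bounded_L2 bU' Ly.
rewrite UU //; apply/eqP; rewrite -subr_eq0; apply/eqP/eq0_normc/le_anti.
rewrite normc_ge0 andbT; apply/ler_addgt0Pr => e e0; rewrite add0r.
have [|||S' [bS' S'E] close] := Sapprox 2%N (fun i => if i == ord0 then U x else x)
  (fun i => if i == ord0 then y else U' y) (e / 2).
- by move=> i; case: ifP.
- by move=> i; case: ifP.
- exact: divr_gt0.
have c0 := close ord0; have c1 := close ord_max; rewrite /= in c0 c1.
have eqS' : dot (S' (U x)) y = dot (S' x) (U' y).
  rewrite -UU //; last exact: bounded_L2.
  apply: dot_ae => //; [exact: bounded_L2| |by move/op_eqP: (S'E U EU); apply|exact: aeW].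
  exact: bounded_L2 bU (bounded_L2 bS' Lx).
have -> : dot (S (U x)) y - dot (S x) (U' y)
    = (dot (S (U x)) y - dot (S' (U x)) y) - (dot (S x) (U' y) - dot (S' x) (U' y)).
  by rewrite eqS'; ring.
apply: le_trans (le_normcD _ _) _; rewrite normcN.
by rewrite [e]splitr; apply: lerD; exact: ltW.
Qed.

Lemma vN_bounded A S : vN_algebra mu A -> A S -> bounded_op S.
Proof. by move=> [sA _]; exact: star_bounded. Qed.

Lemma vN_setI A E : vN_algebra mu A -> vN_algebra mu E -> vN_algebra mu (A `&` E).
Proof.
move=> [sA wA] [sE wE]; split; first split.
- by move=> S [/(star_bounded sA)].
- by split; [exact: star_one sA|exact: star_one sE].
- by move=> a S S' [? ?] [? ?]; split; [exact: star_lin sA _ _ _ _ _|exact: star_lin sE _ _ _ _ _].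
- by move=> S S' [? ?] [? ?]; split; [exact: star_comp sA _ _ _ _|exact: star_comp sE _ _ _ _].
- by move=> S S' [? ?] ? ?; split; [exact: (@star_adj _ _ _ _ _ sA S)|exact: (@star_adj _ _ _ _ _ sE S)].
move=> S bS approx; split; [apply: wA|apply: wE] => // n x y e Lx Ly e0.
  by have [S' [AS' _] h] := approx n x y e Lx Ly e0; exists S'.
by have [S' [_ ES'] h] := approx n x y e Lx Ly e0; exists S'.
Qed.

(** The weak neighbourhoods only see the classes modulo almost everywhere
    equality, so a weakly closed set is saturated. *)
Lemma vN_op_eq A S U : vN_algebra mu A -> A S -> bounded_op U -> op_eq S U -> A U.
Proof.
move=> vA AS bU /op_eqP SU; apply: vA.2 => // n x y e Lx Ly e0.
exists S => // i; have bS := vN_bounded vA AS.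
rewrite (@dot_ae _ _ _ mu _ (U (x i)) _ (y i)) ?subrr ?normc0 //.
- exact: bounded_L2.
- exact: bounded_L2.
- exact: SU.
- exact: aeW.
Qed.

Lemma vN_seq_limit A (S : nat -> op R T) U : vN_algebra mu A ->
  (forall m, A (S m)) -> bounded_op U ->
  (forall x y, L2 x -> L2 y -> forall e : R, 0 < e -> exists N, forall m,
     (N <= m)%N -> normc (dot (U x) y - dot (S m x) y) < e) -> A U.
Proof.
move=> vA AS bU lim; apply: vA.2 => // n x y e Lx Ly e0.
pose N i := sval (cid (lim (x i) (y i) (Lx i) (Ly i) e e0)).
exists (S (\max_i N i)%N) => // i.
have := svalP (cid (lim (x i) (y i) (Lx i) (Ly i) e e0)); apply.
exact: (leq_bigmax (F := N)).
Qed.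

Lemma vN_generated_sub A E : vN_algebra mu A -> E `<=` A -> vN_generated mu E `<=` A.
Proof. by move=> vA EA S; exact. Qed.

Lemma vN_lin A a S U : vN_algebra mu A -> A S -> A U -> A (op_lin a S U).
Proof. by move=> [sA _] AS AU; exact: (star_lin sA). Qed.

Lemma vN_comp A S U : vN_algebra mu A -> A S -> A U -> A (S \o U).
Proof. by move=> [sA _] AS AU; exact: (star_comp sA). Qed.

Lemma vN_adj A S U : vN_algebra mu A -> A S -> bounded_op U -> adjoint S U -> A U.
Proof. by move=> [sA _]; exact: (star_adj sA). Qed.

End BoundedOperators.

(** * Orthogonal projections and the density theorem *)

Section Projection.
Context {R : realType} {V : lmodType R[i]} (D : set V) (dot : V -> V -> R[i]).
Hypothesis H : semi_hilbert D dot.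
Local Notation q x := (complex.Re (dot x x)).
Variable K : set V.
Hypotheses (KD : K `<=` D) (K0 : K 0)
  (Klin : forall a k l, K k -> K l -> K (a *: k + l)).

Definition proj (x : V) : V :=
  if pselect (D x) is left Dx then sval (cid (projection_exists H KD K0 Klin Dx))
  else 0.

Lemma projP x : D x -> [/\ D (proj x), limit_point dot K (proj x) &
  forall k, K k -> dot (x - proj x) k = 0].
Proof. by move=> Dx; rewrite /proj; case: pselect => // Dx'; case: cid. Qed.

Lemma proj_D x : D x -> D (proj x).
Proof. by move=> /projP[]. Qed.

Lemma limit_point_lin a x y : D x -> D y -> limit_point dot K x ->
  limit_point dot K y -> limit_point dot K (a *: x + y).
Proof.
move=> Dx Dy Kx Ky e e0.
have a1 : 0 < normc a ^+ 2 + 1 by apply: ltr_wpDl => //; exact: sqr_ge0.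
have e4 : 0 < e / 4 by exact: divr_gt0.
have [k Kk ke] := Kx _ (divr_gt0 e4 a1); have [l Kl le] := Ky _ e4.
exists (a *: k + l); first exact: Klin.
have -> : a *: k + l - (a *: x + y) = a *: (k - x) + (l - y).
  by rewrite scalerBr opprD addrACA.
have [Dk Dl] := (KD Kk, KD Kl).
have Dkx := shB H Dk Dx; have Dly := shB H Dl Dy.
apply: le_lt_trans (qD_le H (shZ H a Dkx) Dly) _.
rewrite (qZ H a Dkx).
have : normc a ^+ 2 * q (k - x) <= e / 4.
  apply: (@le_trans _ _ ((normc a ^+ 2 + 1) * (e / 4 / (normc a ^+ 2 + 1)))).
    apply: ler_pM; [exact: sqr_ge0|exact: (sh_ge0 H)| |exact: ltW].
    by rewrite lerDl.
  by rewrite mulrC divfK ?gt_eqF.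
by move: le; rewrite !mulr2n; lra.
Qed.

(** Both candidates differ by a vector that is a limit of vectors of [K] and is
    orthogonal to [K], hence to itself. *)
Lemma proj_unique x y : D x -> D y -> limit_point dot K y ->
  (forall k, K k -> dot (x - y) k = 0) -> q (proj x - y) = 0.
Proof.
move=> Dx Dy Ky xy; have [Dp Kp xp] := projP Dx.
have Dpy := shB H Dp Dy.
have Kpy : limit_point dot K (proj x - y).
  by rewrite addrC -scaleN1r; apply: limit_point_lin.
rewrite (limit_point_orth H KD Dpy Dpy Kpy) // => k Kk.
have Dk := KD Kk.
have -> : proj x - y = (x - y) - (x - proj x).
  by rewrite opprB [RHS]addrC addrA subrK.
by rewrite (dotBl H (shB H Dx Dy) (shB H Dx Dp) Dk) xy // xp // subrr.
Qed.

Lemma proj_q x : D x -> q (proj x) <= q x.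
Proof.
move=> Dx; have [Dp Kp xp] := projP Dx; have Dxp := shB H Dx Dp.
have -> : q x = q ((x - proj x) + proj x) by rewrite subrK.
rewrite (qD H Dxp Dp) (limit_point_orth H KD Dxp Dp Kp xp) mul0rn addr0.
by rewrite lerDr (sh_ge0 H).
Qed.

Lemma proj_sym x y : D x -> D y -> dot (proj x) y = dot x (proj y).
Proof.
move=> Dx Dy; have [Dp Kp xp] := projP Dx; have [Dr Kr yr] := projP Dy.
have e1 := limit_point_orth H KD (shB H Dx Dp) Dr Kr xp.
have e2 := limit_point_orth H KD (shB H Dy Dr) Dp Kp yr.
move: e1; rewrite (dotBl H Dx Dp Dr) => /eqP; rewrite subr_eq0 => /eqP ->.
move: e2; rewrite (dotBl H Dy Dr Dp) => /eqP; rewrite subr_eq0 => /eqP e2.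
by rewrite (sh_conj H Dy Dp) e2 -(sh_conj H Dr Dp).
Qed.

Lemma proj_lin a x y : D x -> D y ->
  q (proj (a *: x + y) - (a *: proj x + proj y)) = 0.
Proof.
move=> Dx Dy; have [Dp Kp xp] := projP Dx; have [Dr Kr yr] := projP Dy.
apply: proj_unique.
- exact: (sh_lin H).
- exact: (sh_lin H).
- exact: limit_point_lin.
move=> k Kk; have Dk := KD Kk.
have -> : a *: x + y - (a *: proj x + proj y) = a *: (x - proj x) + (y - proj y).
  by rewrite scalerBr opprD addrACA.
rewrite (dotDl H _ (shB H Dy Dr) Dk); last exact: (shZ H a (shB H Dx Dp)).
by rewrite (dotZl H a (shB H Dx Dp) Dk) xp // yr // mulr0 addr0.
Qed.

Lemma proj_fix x : K x -> q (proj x - x) = 0.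
Proof.
move=> Kx; have Dx := KD Kx; apply: proj_unique => //.
  exact: (limit_point_sub H).
by move=> k Kk; rewrite subrr (dot0l H) //; exact: KD.
Qed.

(** [K] and its orthogonal complement are both invariant under an operator
    that maps [K] to itself together with its adjoint. *)
Lemma proj_intertwine (U U' : V -> V) (c : R) : 0 <= c ->
  (forall x, D x -> D (U x)) -> (forall x, D x -> D (U' x)) ->
  (forall x y, D x -> D y -> q (U x - U y) <= c * q (x - y)) ->
  (forall x y z, D x -> D y -> D z -> dot (U x - U y) z = dot (x - y) (U' z)) ->
  (forall k, K k -> K (U k)) -> (forall k, K k -> K (U' k)) ->
  forall x, D x -> q (proj (U x) - U (proj x)) = 0.
Proof.
move=> c0 UD UD' Uc UU KU KU' x Dx; have [Dp Kp xp] := projP Dx.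
apply: proj_unique; [exact: UD|exact: UD| |].
  move=> e e0; have c1 : 0 < c + 1 by exact: ltr_wpDl.
  have [k Kk ke] := Kp _ (divr_gt0 e0 c1).
  exists (U k); first exact: KU.
  have Dk := KD Kk; apply: le_lt_trans (Uc _ _ Dk Dp) _.
  apply: (@le_lt_trans _ _ ((c + 1) * q (k - proj x))).
    by apply: ler_wpM2r; rewrite ?lerDl //; apply: (sh_ge0 H); exact: (shB H Dk Dp).
  by rewrite mulrC -ltr_pdivlMr.
by move=> k Kk; rewrite UU ?xp //; [exact: KU'|exact: KD].
Qed.

End Projection.

(** ** Finite direct sums *)

Section DirectSum.
Context {R : realType} {V : lmodType R[i]} (D : set V) (dot : V -> V -> R[i]).
Hypothesis H : semi_hilbert D dot.
Variable n : nat.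
Local Notation Vn := {ffun 'I_n -> V}.

Definition sum_dom : set Vn := [set v | forall i, D (v i)].
Definition sum_dot (v w : Vn) : R[i] := \sum_i dot (v i) (w i).
Local Notation q x := (complex.Re (dot x x)).

Lemma Re_sum (I : finType) (f : I -> R[i]) :
  complex.Re (\sum_i f i) = \sum_i complex.Re (f i).
Proof. by apply: (big_morph (@complex.Re R)) => [x y|//]; exact: cReD. Qed.

Lemma sum_q (v : Vn) : complex.Re (sum_dot v v) = \sum_i q (v i).
Proof. exact: Re_sum. Qed.

Lemma sum_q_le (v : Vn) i : sum_dom v -> q (v i) <= complex.Re (sum_dot v v).
Proof.
move=> Dv; rewrite sum_q (bigD1 i) //= lerDl; apply: sumr_ge0 => j _.
exact: (sh_ge0 H (Dv j)).
Qed.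

Lemma sum_semi_hilbert : semi_hilbert sum_dom sum_dot.
Proof.
split.
- by move=> i; rewrite ffunE; exact: (sh_0 H).
- by move=> a x y Dx Dy i; rewrite !ffunE; exact: (sh_lin H a (Dx i) (Dy i)).
- move=> a x y z Dx Dy Dz; rewrite /sum_dot mulr_sumr -big_split /=.
  by apply: eq_bigr => i _; rewrite !ffunE (sh_linl H a (Dx i) (Dy i) (Dz i)).
- move=> x y Dx Dy; rewrite /sum_dot.
  rewrite (big_morph _ (@conjcD R) (id1 := 0)); last exact: rmorph0.
  by apply: eq_bigr => i _; exact: (sh_conj H (Dx i) (Dy i)).
- by move=> x Dx; rewrite sum_q; apply: sumr_ge0 => i _; exact: (sh_ge0 H (Dx i)).
move=> u Du uc.
have DB m k : sum_dom (u m - u k).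
  by move=> i; rewrite !ffunE; exact: (shB H (Du m i) (Du k i)).
have lim i : {x | D x & forall e : R, 0 < e -> exists N, forall k, (N <= k)%N ->
    q (u k i - x) < e}.
  apply/cid2/(sh_complete H) => [m|e e0]; first exact: Du.
  have [N uN] := uc e e0; exists N => m k Nm Nk.
  have := sum_q_le i (DB m k); rewrite !ffunE => /le_lt_trans; apply.
  exact: uN.
pose x := [ffun i => s2val (lim i)].
have Dx : sum_dom x by move=> i; rewrite ffunE; case: (lim i).
exists x => // e e0.
have en : 0 < e / n.+1%:R by exact: divr_gt0.
have lim' i : {N | forall k, (N <= k)%N -> q (u k i - x i) < e / n.+1%:R}.
  by apply/cid; rewrite ffunE; case: (lim i) => /= y Dy; apply.
exists (\max_i sval (lim' i))%N => k Nk; rewrite sum_q.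
apply: (@le_lt_trans _ _ (\sum_(i < n) e / n.+1%:R)).
  apply: ler_sum => i _; rewrite !ffunE -[s2val (lim i)](ffunE (fun i => s2val (lim i))).
  apply: ltW; apply: (svalP (lim' i)); apply: leq_trans Nk.
  exact: (leq_bigmax (F := fun i => sval (lim' i))).
rewrite sumr_const card_ord -[X in X < _]mulr_natr -mulrA gtr_pMr // mulrC.
by rewrite ltr_pdivrMr // mul1r ltr_nat.
Qed.

End DirectSum.

Section ProjectionOperators.
Context {R : realType} {d : measure_display} {T : measurableType d}.
Variable mu : {measure set T -> \bar R}.
Local Notation C := (R[i]).
Local Notation L2 := (L2 mu : set (T -> C)).
Local Notation dot := (L2dot mu).
Local Notation q x := (complex.Re (dot x x)).
Local Notation bounded_op := (bounded_op mu).
Local Notation adjoint := (adjoint mu).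
Local Notation H := (L2_semi_hilbert mu).

Lemma bounded_qB (U : op R T) : bounded_op U -> exists2 c : R, 0 <= c &
  forall x y, L2 x -> L2 y -> q (U x - U y) <= c * q (x - y).
Proof.
move=> bU; have [c c0 Uc] := bounded_q bU; exists (c ^+ 2); first exact: sqr_ge0.
move=> x y Lx Ly; have LUx := bounded_L2 bU Lx; have LUy := bounded_L2 bU Ly.
have Lxy := L2B Lx Ly; have LB := bounded_L2 bU Lxy; have LUB := L2B LUx LUy.
rewrite -(@dot_ae _ _ _ mu _ _ _ _ LB LUB LB LUB (bounded_B bU Lx Ly) (bounded_B bU Lx Ly)).
exact: Uc.
Qed.

Lemma adjointB (U U' : op R T) x y z : bounded_op U -> adjoint U U' ->
  L2 x -> L2 y -> L2 z -> dot (U x - U y) z = dot (x - y) (U' z).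
Proof.
move=> bU UU Lx Ly Lz; have LUx := bounded_L2 bU Lx; have LUy := bounded_L2 bU Ly.
have Lxy := L2B Lx Ly; have LB := bounded_L2 bU Lxy; have LUB := L2B LUx LUy.
rewrite -UU //; apply: dot_ae => //; last exact: aeW.
by apply: ae_imp (bounded_B bU Lx Ly) => t ->.
Qed.

Lemma q_sub0_ae x y : L2 x -> L2 y -> q (x - y) = 0 -> \forall t \ae mu, x t = y t.
Proof.
move=> Lx Ly /(q_eq0_ae (L2B Lx Ly)); apply: ae_imp => t /eqP.
by rewrite subr_eq0 => /eqP.
Qed.

Section One.
Variable K : set (T -> C).
Hypotheses (KD : K `<=` L2) (K0 : K 0)
  (Klin : forall a k l, K k -> K l -> K (a *: k + l)).
Local Notation P := (proj H KD K0 Klin).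

Lemma proj_bounded : bounded_op P.
Proof.
have PL x : L2 x -> L2 (P x) by exact: proj_D.
split=> //.
  move=> a x y Lx Ly; apply/ae_eqP.
  apply: (q_sub0_ae _ _ (proj_lin H KD K0 Klin a Lx Ly)).
    exact: PL (L2_lin a Lx Ly).
  exact: L2_lin (PL x Lx) (PL y Ly).
exists 1; apply/op_norm_leP => // x Lx.
by rewrite expr1n mul1r; exact: proj_q.
Qed.

Lemma proj_adjoint : adjoint P P.
Proof. by move=> x y Lx Ly; exact: proj_sym. Qed.

Lemma proj_commute (U U' : op R T) : bounded_op U -> bounded_op U' ->
  adjoint U U' -> (forall k, K k -> K (U k)) -> (forall k, K k -> K (U' k)) ->
  commute mu U P.
Proof.
move=> bU bU' UU KU KU'; apply: op_eq_sym; apply/op_eqP => x Lx /=.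
have [c c0 Uc] := bounded_qB bU.
apply: q_sub0_ae.
- exact: proj_D (bounded_L2 bU Lx).
- exact: bounded_L2 bU (proj_D H KD K0 Klin Lx).
apply: (@proj_intertwine _ _ _ _ H K KD K0 Klin U U' c) => //.
- by move=> z; exact: bounded_L2.
- by move=> z; exact: bounded_L2.
- by move=> u v w; exact: adjointB.
Qed.

End One.

(** The vectors [(A xi_0, ..., A xi_(n-1))] with [A] in the algebra form a
    subspace of the n-fold direct sum; the matrix entries of the projection
    onto its closure commute with the algebra, so [S] commutes with that
    projection and [(S xi_i)] lies in the closure of that subspace. *)
Theorem bicommutant_density (A : set (op R T)) (S : op R T) :
  A idfun -> (forall a U V, A U -> A V -> A (op_lin a U V)) ->
  (forall U V, A U -> A V -> A (U \o V)) -> adj_closed mu A ->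
  bounded_op S -> (forall U, commutant mu A U -> commute mu S U) ->
  forall (n : nat) (xi : 'I_n -> T -> C) (e : R), (forall i, L2 (xi i)) ->
    0 < e -> exists2 U, A U & forall i, q (U (xi i) - S (xi i)) < e.
Proof.
move=> A1 Alin Acomp Aadj bS SA n xi e Lxi e0.
have bA U : A U -> bounded_op U by move=> /Aadj[].
pose Vn := {ffun 'I_n -> (T -> C)}.
pose D : set Vn := @sum_dom _ _ L2 n.
pose ddot : Vn -> Vn -> C := @sum_dot _ _ dot n.
have HH : semi_hilbert D ddot := sum_semi_hilbert H n.
pose K : set Vn := [set [ffun i => U (xi i)] | U in A].
have KD : K `<=` D.
  by move=> _ [U AU <-] i; rewrite ffunE; exact: bounded_L2 (bA _ AU) (Lxi i).
have K0 : K 0.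
  exists (op_lin (-1) idfun idfun); first exact: Alin.
  apply/ffunP => i; rewrite !ffunE; apply/funext => t.
  by rewrite /op_lin mulN1r addNr.
have Klin a k l : K k -> K l -> K (a *: k + l).
  move=> [U AU <-] [V AV <-]; exists (op_lin a U V); first exact: Alin.
  by apply/ffunP => i; rewrite !ffunE.
pose P := proj HH KD K0 Klin.
have PD v : D v -> D (P v) by exact: proj_D.
have ext (v w : Vn) : D v -> D w -> (forall i, \forall t \ae mu, v i t = w i t) ->
    complex.Re (ddot (v - w) (v - w)) = 0.
  move=> Dv Dw vw; rewrite sum_q big1 // => i _; rewrite !ffunE.
  apply: q_ae0; first exact: (L2B (Dv i) (Dw i)).
  apply: ae_imp (vw i) => t e1.
  by change (v i t - w i t = 0); rewrite e1 subrr.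
have ext' (v w : Vn) : D v -> D w -> complex.Re (ddot (v - w) (v - w)) = 0 ->
    forall i, \forall t \ae mu, v i t = w i t.
  move=> Dv Dw vw i; apply: (q_sub0_ae (Dv i) (Dw i)); apply/le_anti.
  rewrite q_ge0 andbT -vw.
  have := @sum_q_le _ _ _ _ H n (v - w) i (shB HH Dv Dw).
  by rewrite !ffunE.
have P0 v : D v -> (forall i, \forall t \ae mu, v i t = 0) ->
    forall i, \forall t \ae mu, P v i t = 0.
  move=> Dv v0 i.
  have D0 : D 0 := sh_0 HH.
  have v00 : complex.Re (ddot v v) = 0.
    rewrite -[v]subr0; apply: ext => // j.
    by apply: ae_imp (v0 j) => t ->; rewrite ffunE.
  have := @ext' (P v) 0 (PD v Dv) D0 _ i; rewrite ffunE; apply.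
  rewrite subr0; apply/le_anti; rewrite (sh_ge0 HH (PD v Dv)) andbT -[leRHS]v00.
  exact: proj_q.
have Plin a v w : D v -> D w ->
    forall i, \forall t \ae mu, P (a *: v + w) i t = a * P v i t + P w i t.
  move=> Dv Dw i; have := @ext' (P (a *: v + w)) (a *: P v + P w).
  have Dvw : D (a *: v + w) := sh_lin HH a Dv Dw.
  move=> /(_ (PD _ Dvw) (sh_lin HH a (PD _ Dv) (PD _ Dw)) (proj_lin HH KD K0 Klin a Dv Dw) i).
  by rewrite !ffunE.
have Pae v w : D v -> D w -> (forall i, \forall t \ae mu, v i t = w i t) ->
    forall i, \forall t \ae mu, P v i t = P w i t.
  move=> Dv Dw vw i; have Dwv := sh_lin HH (-1) Dw Dv.
  have h1 := Plin (-1) w v Dw Dv i.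
  have h2 : \forall t \ae mu, P (-1 *: w + v) i t = 0.
    apply: P0 => // j; rewrite !ffunE; apply: ae_imp (vw j) => t e1.
    by change (-1 * w j t + v j t = 0); rewrite e1 mulN1r addNr.
  apply: ae_imp2 h1 h2 => t -> /eqP; rewrite mulN1r addrC subr_eq0.
  by move=> /eqP.
pose inj (j : 'I_n) (x : T -> C) : Vn := [ffun k => if k == j then x else 0].
have Dinj j x : L2 x -> D (inj j x).
  by move=> Lx i; rewrite ffunE; case: ifP => // _; exact: L2_0.
pose p i j : op R T := fun x => P (inj j x) i.
have bp i j : bounded_op (p i j).
  have pL x : L2 x -> L2 (p i j x) by move=> Lx; exact: PD (Dinj j x Lx) i.
  split=> //.
    move=> a x y Lx Ly; apply/ae_eqP.
    have := Plin a _ _ (Dinj j x Lx) (Dinj j y Ly) i.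
    have -> : a *: inj j x + inj j y = inj j (fun t => a * x t + y t).
      apply/ffunP => k; rewrite !ffunE; case: ifP => // _.
      by rewrite scaler0 addr0.
    by [].
  exists 1; apply/op_norm_leP => // x Lx; rewrite expr1n mul1r.
  apply: le_trans (@sum_q_le _ _ _ _ H n _ i (PD _ (Dinj j x Lx))) _.
  apply: le_trans (proj_q HH KD K0 Klin (Dinj j x Lx)) _.
  rewrite sum_q (bigD1 j) //= big1 ?addr0 ?ffunE ?eqxx // => k kj.
  by rewrite ffunE (negbTE kj); exact: (q0 H).
pose amp (U : op R T) (v : Vn) : Vn := [ffun i => U (v i)].
have Pamp U v : A U -> D v -> forall i, \forall t \ae mu, P (amp U v) i t = U (P v i) t.
  move=> AU Dv i; have [bU [U' AU' UU]] := Aadj U AU; have bU' := bA _ AU'.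
  have [c c0 Uc] := bounded_qB bU.
  have ampD W w : A W -> D w -> D (amp W w).
    by move=> AW Dw k; rewrite ffunE; exact: bounded_L2 (bA _ AW) (Dw k).
  have := @ext' (P (amp U v)) (amp U (P v)).
  move=> /(_ (PD _ (ampD _ _ AU Dv)) (ampD _ _ AU (PD _ Dv))).
  have ampK W w : A W -> K w -> K (amp W w).
    move=> AW [V AV <-]; exists (W \o V); first exact: Acomp.
    by apply/ffunP => k; rewrite !ffunE.
  move=> /(_ _ i); rewrite [amp U (P v) i]ffunE; apply.
  apply: (@proj_intertwine _ _ _ _ HH K KD K0 Klin (amp U) (amp U') c) => //.
  - by move=> w; exact: ampD.
  - by move=> w; exact: ampD.
  - move=> w z Dw Dz; rewrite !sum_q mulr_sumr; apply: ler_sum => k _.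
    by rewrite !ffunE; exact: Uc.
  - move=> w z u Dw Dz Du; apply: eq_bigr => k _; rewrite !ffunE.
    by apply: adjointB; [exact: bU|exact: UU|exact: Dw|exact: Dz|exact: Du].
  - by move=> w; exact: ampK.
  - by move=> w; exact: ampK.
have pA i j : commutant mu A (p i j).
  split=> // U AU; apply/op_eqP => x Lx /=; have bU := bA _ AU.
  have LUx := bounded_L2 bU Lx.
  have h1 := Pamp U _ AU (Dinj j x Lx) i.
  apply: ae_imp2 h1 (Pae (amp U (inj j x)) (inj j (U x)) _ (Dinj j _ LUx) _ i).
  - by move=> t /= <-.
  - by move=> k; rewrite ffunE; exact: bounded_L2 bU (Dinj j x Lx k).
  - move=> k; rewrite !ffunE; case: ifP => // _; first exact: aeW.
    apply: (bounded_0 bU); first exact: L2_0.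
    exact: aeW.
have decomp v : D v -> forall i, \forall t \ae mu, P v i t = \sum_j p i j (v j) t.
  move=> Dv i.
  have vE : v = \sum_j inj j (v j).
    apply/ffunP => k; rewrite sum_ffunE (bigD1 k) //= ffunE eqxx big1 ?addr0 // => j jk.
    by rewrite ffunE eq_sym (negbTE jk).
  have gen (s : seq 'I_n) : D (\sum_(j <- s) inj j (v j)) /\
      \forall t \ae mu, P (\sum_(j <- s) inj j (v j)) i t = \sum_(j <- s) p i j (v j) t.
    elim: s => [|j s [Ds IH]].
      rewrite big_nil; split; first exact: (sh_0 HH).
      have : \forall t \ae mu, P 0 i t = 0.
        by apply: P0; [exact: (sh_0 HH)|move=> k; rewrite ffunE; exact: aeW].
      by apply: ae_imp => t ->; rewrite big_nil.
    have Dj := Dinj j _ (Dv j).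
    rewrite big_cons; split; first exact: (shD HH Dj Ds).
    apply: ae_imp2 IH (Plin 1 _ _ Dj Ds i) => t.
    by rewrite scale1r mul1r big_cons => -> ->.
  have [_ h] := gen (index_enum 'I_n).
  by apply: ae_imp h => t; rewrite -vE.
pose xiv : Vn := [ffun i => xi i].
have Kxi : K xiv by exists idfun => //; apply/ffunP => i; rewrite !ffunE.
have Dxi := KD _ Kxi.
have Pxi i : \forall t \ae mu, P xiv i t = xi i t.
  have := @ext' (P xiv) xiv (PD _ Dxi) Dxi (proj_fix HH KD K0 Klin Kxi) i.
  by rewrite ffunE.
pose Sxi : Vn := [ffun i => S (xi i)].
have DS : D Sxi by move=> i; rewrite ffunE; exact: bounded_L2 bS (Lxi i).
have Lp i j : L2 (p i j (xi j)) by exact: bounded_L2 (bp i j) (Lxi j).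
have Ssum i (s : seq 'I_n) : L2 (fun t => \sum_(j <- s) p i j (xi j) t) /\
    \forall t \ae mu, S (fun t => \sum_(j <- s) p i j (xi j) t) t
      = \sum_(j <- s) p i j (S (xi j)) t.
  elim: s => [|j s [Ls IH]].
    under eq_fun do rewrite big_nil; split; first exact: L2_0.
    have := bounded_0 bS (L2_0 mu) (aeW mu (fun=> erefl)).
    by apply: ae_imp => t ->; rewrite big_nil.
  under eq_fun do rewrite big_cons; split; first exact: L2D.
  have cj := op_eqP mu (S \o p i j) (p i j \o S); have := cj.1 (SA _ (pA i j)) _ (Lxi j).
  move=> /= {}cj; apply: ae_imp2 (ae_andP IH cj) (bounded_D bS (Lp i j) Ls) => t.
  by move=> [IHt ct] ->; rewrite big_cons IHt ct.
have PS i : \forall t \ae mu, P Sxi i t = S (xi i) t.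
  have h1 := decomp Sxi DS i; have [Ls h2] := Ssum i (index_enum 'I_n).
  have h3 : \forall t \ae mu, xi i t = \sum_j p i j (xi j) t.
    have h := decomp xiv Dxi i; apply: ae_imp2 (Pxi i) h => t <- ->.
    by apply: eq_bigr => j _; rewrite ffunE.
  have h4 := bounded_ae bS (Lxi i) Ls h3.
  apply: ae_imp2 (ae_andP h1 h2) h4 => t [e1 e2] e3; rewrite e1 e3 e2.
  by apply: eq_bigr => j _; rewrite ffunE.
have [_ lim _] := projP HH KD K0 Klin DS.
have e4 : 0 < e by [].
have [_ [U AU <-] Ue] := lim e e4.
exists U => // i; have bU := bA _ AU.
apply: le_lt_trans Ue.
have DU : D [ffun i => U (xi i)] by apply: (KD); exists U.
apply: le_trans (@sum_q_le _ _ _ _ H n _ i (shB HH DU (PD _ DS))).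
rewrite !ffunE; have LU := bounded_L2 bU (Lxi i); have LS := bounded_L2 bS (Lxi i).
have LPS := PD _ DS i.
rewrite (@dot_ae _ _ _ mu (U (xi i) - S (xi i)) (U (xi i) - P Sxi i)
  (U (xi i) - S (xi i)) (U (xi i) - P Sxi i)) //; [exact: L2B..| |];
  apply: ae_imp (PS i) => t e1;
  by change (U (xi i) t - S (xi i) t = U (xi i) t - P Sxi i t); rewrite e1.
Qed.

(** The density theorem approximates [S] on finitely many vectors, which is more
    than weak closedness requires. *)
Lemma bicommutant_vN (A M : set (op R T)) (S : op R T) : vN_algebra mu M ->
  A `<=` M -> A idfun -> (forall a U V, A U -> A V -> A (op_lin a U V)) ->
  (forall U V, A U -> A V -> A (U \o V)) -> adj_closed mu A ->
  bounded_op S -> (forall U, commutant mu A U -> commute mu S U) -> M S.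
Proof.
move=> vM AM A1 Alin Acomp Aadj bS SA; apply: vM.2 => // n xi eta e Lxi Leta e0.
pose m := \sum_i q (eta i) + 1.
have m0 : 0 < m by apply: ltr_wpDl => //; apply: sumr_ge0 => i _; exact: q_ge0.
have [U AU Ue] := bicommutant_density A1 Alin Acomp Aadj bS SA Lxi
  (divr_gt0 (exprn_gt0 2 e0) m0).
exists U; first exact: AM.
have bU := (Aadj U AU).1; move=> i.
have LU := bounded_L2 bU (Lxi i); have LS := bounded_L2 bS (Lxi i).
rewrite -(dotBl H LS LU (Leta i)) -(@ltr_pXn2r _ 2) ?nnegrE ?normc_ge0 ?ltW //.
apply: le_lt_trans (cauchy_schwarz H (shB H LS LU) (Leta i)) _.
rewrite (q_sym H LS LU) -[ltRHS](divfK (lt0r_neq0 m0)).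
apply: (@le_lt_trans _ _ (q (U (xi i) - S (xi i)) * m)).
  apply: ler_wpM2l; first exact: q_ge0.
  rewrite /m (bigD1 i) //= -addrA lerDl addr_ge0 //.
  by apply: sumr_ge0 => j _; exact: q_ge0.
by rewrite ltr_pM2r.
Qed.

End ProjectionOperators.

(** * Weighted composition operators *)

Section WeightedComposition.
Context {R : realType} {d : measure_display} {T : measurableType d}.
Variable mu : {measure set T -> \bar R}.
Local Notation C := (R[i]).
Local Notation L2 := (L2 mu).
Local Notation dot := (L2dot mu).
Local Notation q x := (complex.Re (dot x x)).

Definition wcomp (tau : T -> T) (w : T -> C) : op R T :=
  fun xi t => w t * xi (tau t).

(** The inequality between integrals says that the image of the measure
    [|w|^2 mu] under [tau] is at most [c mu]. *)
Lemma wcomp_L2 tau w (c : R) xi : measurable_fun setT tau -> cmeasurable w ->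
  (forall phi : T -> R, measurable_fun setT phi -> (forall t, 0 <= phi t) ->
     (\int[mu]_t (normc (w t) ^+ 2 * phi (tau t))%:E
      <= c%:E * \int[mu]_t (phi t)%:E)%E) ->
  0 <= c -> L2 xi -> L2 (wcomp tau w xi) /\ q (wcomp tau w xi) <= c * q xi.
Proof.
move=> mtau mw le c0 Lxi; have [mxi xifin] := Lxi.
have mx : cmeasurable (wcomp tau w xi).
  by apply: cmeasM => //; exact: (cmeas_comp mtau mxi).
have h := le _ (meas_normc2 mxi) (fun t => sqr_ge0 _).
have h' : (\int[mu]_t ((normc (wcomp tau w xi t)) ^+ 2)%:E
    <= c%:E * \int[mu]_t ((normc (xi t)) ^+ 2)%:E)%E.
  by under eq_integral do rewrite /wcomp normcM exprMn.
have Lw : L2 (wcomp tau w xi).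
  by split => //; apply: le_lt_trans h' _; apply: lte_mul_pinfty.
by split => //; rewrite -lee_fin EFinM !q_EFin.
Qed.

Lemma wcomp_bounded tau w (c : R) : measurable_fun setT tau -> cmeasurable w ->
  (forall phi : T -> R, measurable_fun setT phi -> (forall t, 0 <= phi t) ->
     (\int[mu]_t (normc (w t) ^+ 2 * phi (tau t))%:E
      <= c%:E * \int[mu]_t (phi t)%:E)%E) ->
  0 <= c -> bounded_op mu (wcomp tau w).
Proof.
move=> mtau mw le c0.
have wL xi : L2 xi -> L2 (wcomp tau w xi) by move=> /(wcomp_L2 mtau mw le c0)[].
split=> //.
  move=> a x y Lx Ly; apply/ae_eqP; apply: aeW => t; rewrite /wcomp.
  by ring.
exists (Num.sqrt c); apply/op_norm_leP => // x Lx.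
by rewrite sqr_sqrtr //; have [] := wcomp_L2 mtau mw le c0 Lx.
Qed.

(** The image under [tau] of the measure [J mu] is [mu]. *)
Definition jacobian (tau : T -> T) (J : T -> R) : Prop :=
  forall phi : T -> R, measurable_fun setT phi -> (forall t, 0 <= phi t) ->
    (\int[mu]_t (J t * phi (tau t))%:E = \int[mu]_t (phi t)%:E)%E.

Lemma jacobian_cintegral tau J f : jacobian tau J -> (forall t, 0 <= J t) ->
  measurable_fun setT J -> measurable_fun setT tau -> cmeasurable f ->
  cintegral mu (fun t => (J t)%:C * f (tau t)) = cintegral mu f.
Proof.
move=> jac J0 mJ mtau mf.
have real (u : T -> R) : measurable_fun setT u ->
    \int[mu]_t (J t * u (tau t)) = \int[mu]_t u t.
  move=> mu'; rewrite /Rintegral; congr fine; rewrite integralE [RHS]integralE.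
  have mm : measurable_fun setT (fun t => Num.max (u t) 0) by exact: measurable_maxr.
  have mn : measurable_fun setT (fun t => Num.max (- u t) 0).
    by apply: measurable_maxr => //; exact: measurable_funN.
  have pos (v : T -> R) t : ((EFin \o v)^\+ t = (Num.max (v t) 0)%:E)%E.
    by rewrite funeposE /= -EFin_max.
  have neg (v : T -> R) t : ((EFin \o v)^\- t = (Num.max (- v t) 0)%:E)%E.
    by rewrite funenegE (EFin_max (- v t) 0).
  congr (_ - _)%E.
    rewrite (eq_integral _ _ (fun t _ => pos _ t)) [RHS](eq_integral _ _ (fun t _ => pos _ t)).
    rewrite -[RHS]jac //; last by move=> t; rewrite le_max lexx orbT.
    by apply: eq_integral => t _; rewrite maxr_pMr // mulr0.
  rewrite (eq_integral _ _ (fun t _ => neg _ t)) [RHS](eq_integral _ _ (fun t _ => neg _ t)).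
  rewrite -[RHS]jac //; last by move=> t; rewrite le_max lexx orbT.
  by apply: eq_integral => t _; rewrite maxr_pMr // mulr0 mulrN.
apply: eq_ReIm => /=.
  by rewrite -[RHS]real; [apply: eq_Rintegral => t _; rewrite cReZ|exact: mf.1].
rewrite -[RHS]real; [apply: eq_Rintegral => t _|exact: mf.2].
by rewrite cImM /= mul0r addr0.
Qed.

(** The substitution of [tau], which is inverted by [tau'], turns one inner
    product into the other. *)
Lemma wcomp_adjoint tau tau' w w' (J : T -> R) : jacobian tau J ->
  (forall t, 0 <= J t) -> measurable_fun setT J ->
  measurable_fun setT tau -> measurable_fun setT tau' ->
  cmeasurable w' ->
  (forall t, tau' (tau t) = t) -> (forall t, w t = (J t)%:C * (w' (tau t))^*) ->
  adjoint mu (wcomp tau w) (wcomp tau' w').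
Proof.
move=> jac J0 mJ mtau mtau' mw' tauK wE x y Lx Ly; rewrite /L2dot /wcomp.
rewrite -(jacobian_cintegral (f := fun t => x t * (w' t * y (tau' t))^*) jac) //.
  by congr cintegral; apply/funext => t; rewrite wE tauK conjcM; ring.
apply: cmeasM; first exact: Lx.1.
by apply: cmeasJ; apply: cmeasM => //; exact: (cmeas_comp mtau' Ly.1).
Qed.

End WeightedComposition.

(** * The measure on the product of a countable group with a space *)

Section GroupTimesSpace.
Context {R : realType} {G : groupType} {d : measure_display} {B : measurableType d}.
Variable nu : probability B R.
Local Notation GB := (discrete_group G * B)%type.
Local Notation mu := (crossed_measure G nu).
Hypothesis countG : countable [set: G].

Lemma group_enum : exists e : G -> nat, injective e.
Proof. by have /countable_injP[e einj] := countG; exists e => x y; apply: einj; rewrite inE. Qed.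

Definition fiber (h : G) : set GB := [set x | x.1 = h].

Lemma fiberE h : fiber h = [set (h : discrete_group G)] `*` setT.
Proof. by apply/seteqP; split => -[h' b]; rewrite /fiber /=; [move=> ->|case=> ->]. Qed.

Lemma measurable_fiber h : measurable (fiber h).
Proof. by rewrite fiberE; exact: measurableX. Qed.

Lemma fiber_cover (e : G -> nat) (A : set GB) :
  A = \bigcup_n [set x | e x.1 = n /\ A x].
Proof. by apply/seteqP; split => [x Ax|x [n _ []//]]; exists (e x.1). Qed.

(** A countable union of fibres; the same argument reduces null sets and
    integrals to the fibres below. *)
Lemma measurable_fibrewise (A : set GB) :
  (forall h, measurable [set b | A (h, b)]) -> measurable A.
Proof.
move=> mA; have [e einj] := group_enum; rewrite (fiber_cover e A).
apply: bigcupT_measurable => n.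
have [[h eh]|noh] := pselect (exists h, e h = n); last first.
  rewrite (_ : [set _ | _] = set0) //; apply/seteqP; split => // -[h b] /= [eh _].
  by apply: noh; exists h.
rewrite (_ : [set _ | _] = [set (h : discrete_group G)] `*` [set b | A (h, b)]).
  exact: measurableX.
apply/seteqP; split => [[h' b] [/= eh' Ah']|[h' b] [/= -> Ah]] //.
have <- : h' = h by apply: einj; rewrite eh.
by [].
Qed.

Lemma measurable_fun_fibrewise {d'} {Y : measurableType d'} (F : GB -> Y) :
  (forall h, measurable_fun setT (fun b => F (h, b))) -> measurable_fun setT F.
Proof.
move=> mF _ U mU; rewrite setTI; apply: measurable_fibrewise => h.
by rewrite -[X in measurable X]setTI; exact: (mF h).
Qed.

Lemma cmeas_fibrewise (F : GB -> R[i]) :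
  (forall h, cmeasurable (fun b => F (h, b))) -> cmeasurable F.
Proof.
by move=> mF; split; apply: measurable_fun_fibrewise => h; [exact: (mF h).1|exact: (mF h).2].
Qed.

Lemma measurable_fiber_incl h : measurable_fun setT (fun b : B => ((h, b) : GB)).
Proof. exact: measurable_fun_pair. Qed.

Lemma cmeas_fiber (F : GB -> R[i]) h : cmeasurable F -> cmeasurable (fun b => F (h, b)).
Proof. exact: (cmeas_comp (measurable_fiber_incl h)). Qed.

Lemma counting1 (h : G) : counting [set (h : discrete_group G)] = 1%E :> \bar R.
Proof.
rewrite /counting asboolT; last exact: finite_set1.
by rewrite (fset_set1 (h : discrete_group G)) finmap.cardfs1.
Qed.

Lemma mu_fiber h (A : set B) : measurable A ->
  mu ([set (h : discrete_group G)] `*` A) = nu A.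
Proof.
move=> mA; have mh : measurable [set (h : discrete_group G)] by [].
have := @product_measure1E _ _ (discrete_group G) B R counting nu _ _ mh mA.
move=> e; apply: etrans e _; rewrite -[RHS]mul1e; congr (_ * _)%E.
exact: counting1.
Qed.

Lemma mu_fiber_sub h (A : set GB) : measurable A -> A `<=` fiber h ->
  mu A = nu [set b | A (h, b)].
Proof.
move=> mA Ah; have mAh : measurable [set b | A (h, b)].
  by rewrite -[X in measurable X]setTI; exact: (measurable_fiber_incl h).
rewrite -(mu_fiber h mAh); congr (crossed_measure G nu _).
apply/seteqP; split => [[h' b] Ab|[h' b] [/= ->]] //.
by have /= <- := Ah _ Ab.
Qed.

Lemma ae_fibers (P : GB -> Prop) :
  (forall h, \forall b \ae nu, P (h, b)) -> \forall x \ae mu, P x.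
Proof.
move=> aeP.
have N h : {N : set B | [/\ measurable N, nu N = 0%E & ~` (fun b => P (h, b)) `<=` N]}.
  by apply/cid; have [N [mN N0 PN]] := aeP h; exists N.
pose M : set GB := [set x | sval (N x.1) x.2].
exists M; split.
- by apply: measurable_fibrewise => h; rewrite /M /=; case: (N h) => ? [].
- rewrite /crossed_measure /= /product_measure1 integral0_eq // => h _ /=.
  rewrite (_ : xsection M h = sval (N h)); first by case: (N h) => ? [].
  by rewrite /xsection; apply/seteqP; split => b /=; rewrite in_setE.
- by move=> [h b] /= nP; rewrite /M /=; case: (N h) => S [_ _] /=; apply.
Qed.

Lemma ae_fiber (P : GB -> Prop) h :
  (\forall x \ae mu, P x) -> \forall b \ae nu, P (h, b).
Proof.
move=> [N [mN N0 PN]].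
have mNh : measurable (N `&` fiber h) by apply: measurableI => //; exact: measurable_fiber.
exists [set b | (N `&` fiber h) (h, b)]; split.
- by rewrite -[X in measurable X]setTI; exact: (measurable_fiber_incl h).
- have Nh : N `&` fiber h `<=` fiber h by move=> x [].
  rewrite -(mu_fiber_sub mNh Nh).
  apply/eqP; rewrite -measure_le0 -N0.
  by apply: le_measure; rewrite ?inE // => x [].
- by move=> b nP; split => //; exact: PN.
Qed.

Lemma integral_fiber (F : GB -> \bar R) h : measurable_fun setT F ->
  (forall x, 0 <= F x)%E ->
  (\int[mu]_(x in fiber h) F x = \int[nu]_b F (h, b))%E.
Proof.
move=> mF F0; have mi := measurable_fiber_incl h.
transitivity (\int[pushforward nu (fun b : B => ((h, b) : GB))]_(x in fiber h) F x)%E.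
  apply: eq_measure_integral => A mA Ah.
  by rewrite (mu_fiber_sub mA Ah).
rewrite ge0_integral_pushforward //; last 2 first.
- exact: measurable_fiber.
- exact: measurable_funTS.
by rewrite (_ : _ @^-1` fiber h = setT) //; apply/seteqP; split.
Qed.

Lemma integral_fibers (e : G -> nat) (F : GB -> \bar R) : injective e ->
  measurable_fun setT F -> (forall x, 0 <= F x)%E ->
  (\int[mu]_x F x = \sum_(n <oo) \int[mu]_(x in [set x | e x.1 = n]) F x)%E.
Proof.
move=> einj mF F0.
have me n : measurable [set x : GB | e x.1 = n].
  apply: measurable_fibrewise => h /=.
  by have [->|ne] := pselect (e h = n); [rewrite (_ : [set _ | _] = setT)|
    rewrite (_ : [set _ | _] = set0)] => //; apply/seteqP; split.
have cover : [set: GB] = \bigcup_n [set x : GB | e x.1 = n].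
  by apply/seteqP; split => // x _; exists (e x.1).
rewrite cover ge0_integral_bigcup //.
- by rewrite -cover.
- by apply/trivIsetP => i j _ _ ij; apply/seteqP; split => // x [/= -> /eqP]; rewrite (negbTE ij).
Qed.

(** Both integrals are sums over the fibres, for two enumerations of the
    group that correspond to each other under [s]. *)
Lemma eq_integral_fibers (s s' : G -> G) (F F' : GB -> \bar R) :
  cancel s s' -> cancel s' s ->
  measurable_fun setT F -> (forall x, 0 <= F x)%E ->
  measurable_fun setT F' -> (forall x, 0 <= F' x)%E ->
  (forall h, \int[nu]_b F (h, b) = \int[nu]_b F' (s h, b))%E ->
  (\int[mu]_x F x = \int[mu]_x F' x)%E.
Proof.
move=> sK s'K mF F0 mF' F0' FF; have [e einj] := group_enum.
have einj' : injective (e \o s') by apply: inj_comp => //; exact: can_inj s'K.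
rewrite (integral_fibers einj mF F0) (integral_fibers einj' mF' F0').
apply: eq_eseriesr => n _.
have [[h eh]|noh] := pselect (exists h, e h = n).
  rewrite (_ : [set _ | e _ = n] = fiber h); last first.
    by apply/seteqP; split => x /=; [rewrite -eh => /einj|move=> ->].
  rewrite (_ : [set _ | (e \o s') _ = n] = fiber (s h)); last first.
    apply/seteqP; split => x /=; first by rewrite -eh => /einj <-; rewrite s'K.
    by move=> ->; rewrite sK.
  by rewrite !integral_fiber.
rewrite (_ : [set _ | e _ = n] = set0); last first.
  by apply/seteqP; split => // x /= ex; apply: noh; exists x.1.
rewrite (_ : [set _ | (e \o s') _ = n] = set0); last first.
  by apply/seteqP; split => // x /= ex; apply: noh; exists (s' x.1).
by rewrite !integral_set0.
Qed.

Lemma integral_one_fiber (F : GB -> \bar R) h : measurable_fun setT F ->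
  (forall x, 0 <= F x)%E -> (forall x, x.1 <> h -> F x = 0%E) ->
  (\int[mu]_x F x = \int[nu]_b F (h, b))%E.
Proof.
move=> mF F0 Fh; rewrite -integral_fiber // [RHS]integral_mkcond.
apply: eq_integral => x _; rewrite patchE; case: ifPn => // /negP.
by rewrite inE => nh; rewrite Fh // => xh; apply: nh; rewrite -xh.
Qed.

End GroupTimesSpace.

(** * Radon-Nikodym densities of nonsingular maps *)

Section NonsingularDensity.
Context {R : realType} {d : measure_display} {B : measurableType d}.
Variables (nu : probability B R) (s : B -> B).
Hypotheses (ms : measurable_fun setT s)
  (nulls : forall A, measurable A -> (nu (s @^-1` A) = 0%E <-> nu A = 0%E)).

(** The Radon-Nikodym derivative of the image of [nu] under [s] is positive
    almost everywhere because the preimage of its zero set is null; it is replaced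
    by 1 on that set, so that square roots and inverses make sense everywhere. *)
Lemma density_exists : exists w : B -> R, [/\ measurable_fun setT w,
  forall b, 0 < w b & forall phi : B -> R, measurable_fun setT phi ->
    (forall b, 0 <= phi b) ->
    (\int[nu]_b (phi b * w b)%:E = \int[nu]_b (phi (s b))%:E)%E].
Proof.
pose m0 := (pushforward nu s : {measure set B -> \bar R}).
pose m := m0 ms.
have mfin : fin_num_fun m.
  move=> A mA; rewrite ge0_fin_numE // /m /m0 /= /pushforward.
  apply: le_lt_trans (probability_le1 _ _) _; last exact: ltry.
  by rewrite -[X in measurable X]setTI; exact: ms.
pose fm : {finite_measure set B -> \bar R} :=
  HB.pack (m : set B -> \bar R) (Measure.class m) (Measure_isFinite.Build _ _ _ m mfin).
have dom : fm `<< nu.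
  by apply/null_content_dominatesP => A mA nA; exact/nulls.
pose f := Radon_Nikodym_SigmaFinite.f fm nu.
have f0 b : (0 <= f b)%E by exact: Radon_Nikodym_SigmaFinite.f_ge0.
have ffin b : f b \is a fin_num by exact: Radon_Nikodym_SigmaFinite.f_fin_num.
have mf : measurable_fun setT f.
  exact: measurable_int (Radon_Nikodym_SigmaFinite.f_integrable dom).
pose w0 b := fine (f b).
have w00 b : 0 <= w0 b by exact: fine_ge0.
have mw0 : measurable_fun setT w0.
  by apply: (measurableT_comp _ mf); exact: fine_measurable.
have change (phi : B -> R) : measurable_fun setT phi -> (forall b, 0 <= phi b) ->
    (\int[nu]_b (phi b * w0 b)%:E = \int[nu]_b (phi (s b))%:E)%E.
  move=> mphi phi0.
  transitivity (\int[m]_b (phi b)%:E)%E; last first.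
    rewrite ge0_integral_pushforward // => [|y _]; first exact/measurable_EFinP.
    by rewrite lee_fin.
  rewrite -(@Radon_Nikodym_SigmaFinite.change_of_variables _ _ _ fm nu dom) //.
  - by apply: eq_integral => b _; rewrite EFinM /w0 fineK.
  - exact/measurable_EFinP.
have mpos : measurable_fun setT (fun b => 0 < w0 b) by exact: measurable_fun_ltr.
have aepos : \forall b \ae nu, 0 < w0 b.
  have mZ : measurable [set b | ~~ (0 < w0 b)].
    have -> : [set b | ~~ (0 < w0 b)] = (fun b => 0 < w0 b) @^-1` [set false].
      by apply/seteqP; split => b /=; [move=> /negbTE|move=> ->].
    by rewrite -[X in measurable X]setTI; exact: mpos.
  have mi : measurable_fun setT (\1_[set b | ~~ (0 < w0 b)] : B -> R).
    exact: measurable_indic.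
  have := change _ mi (fun b => ler0n _ _).
  rewrite integral0_eq; last first.
    move=> b _; rewrite indicE; case: (boolP (b \in _)); last by rewrite mul0r.
    rewrite inE /= -leNgt => w0b; rewrite mul1r; congr _%:E.
    by apply/le_anti; rewrite w0b w00.
  rewrite (_ : (fun b => (\1_[set b | ~~ (0 < w0 b)] (s b))%:E)
    = (fun b => (\1_(s @^-1` [set b | ~~ (0 < w0 b)]) b)%:E)); last first.
    by apply/funext => b; rewrite !indicE; congr (_%:R%:E); apply/idP/idP; rewrite !inE.
  rewrite integral_indic // ?setIT; last first.
    by rewrite -[X in measurable X]setTI; exact: ms.
  move=> /esym /nulls Z0; exists [set b | ~~ (0 < w0 b)]; split => //; first exact: Z0.
  by move=> b /= /negP.
pose w b := if 0 < w0 b then w0 b else 1.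
have mw : measurable_fun setT w by apply: measurable_fun_ifT.
have w_gt0 b : 0 < w b by rewrite /w; case: ifP.
exists w; split => // phi mphi phi0; rewrite -change //.
apply: ge0_ae_eq_integral => //.
- by apply/measurable_EFinP; exact: measurable_funM.
- by apply/measurable_EFinP; exact: measurable_funM.
- by move=> b _; rewrite lee_fin mulr_ge0 // ltW.
- by move=> b _; rewrite lee_fin mulr_ge0.
- by apply: ae_imp aepos => b wb _; rewrite /w wb.
Qed.

End NonsingularDensity.

(** * Multiplication operators *)

Section MultiplicationOperators.
Context {R : realType} {d : measure_display} {T : measurableType d}.
Variable mu : {measure set T -> \bar R}.
Local Notation C := (R[i]).
Local Notation L2 := (L2 mu).
Local Notation dot := (L2dot mu).
Local Notation q x := (complex.Re (dot x x)).

Definition mulop (w : T -> C) : op R T := fun xi t => w t * xi t.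

Lemma mulop_intle w (c : R) : cmeasurable w -> (\forall t \ae mu, normc (w t) <= c) ->
  forall phi : T -> R, measurable_fun setT phi -> (forall t, 0 <= phi t) ->
     (\int[mu]_t (normc (w t) ^+ 2 * phi t)%:E
      <= (c ^+ 2)%:E * \int[mu]_t (phi t)%:E)%E.
Proof.
move=> mw wc phi mphi phi0.
rewrite -ge0_integralZl_EFin ?sqr_ge0 //;
  [|by move=> t _; rewrite lee_fin|exact/measurable_EFinP].
apply: ae_ge0_le_integral => //.
- by move=> t _; rewrite lee_fin mulr_ge0 ?sqr_ge0.
- by apply/measurable_EFinP; apply: measurable_funM => //; exact: meas_normc2.
- by move=> t _; rewrite -EFinM lee_fin mulr_ge0 ?sqr_ge0.
- by apply/measurable_EFinP; exact: measurable_funM.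
apply: ae_imp wc => t wt _; rewrite -EFinM lee_fin ler_wpM2r //.
by rewrite ler_pXn2r ?nnegrE ?normc_ge0 // (le_trans (normc_ge0 _) wt).
Qed.

Lemma mulop_q w (c : R) x : cmeasurable w -> (\forall t \ae mu, normc (w t) <= c) ->
  L2 x -> L2 (mulop w x) /\ q (mulop w x) <= c ^+ 2 * q x.
Proof.
move=> mw wc; apply: (@wcomp_L2 _ _ _ mu idfun w (c ^+ 2)) => //.
- exact: measurable_id.
- exact: mulop_intle.
- exact: sqr_ge0.
Qed.

Lemma mulop_bounded w : Linf mu w -> bounded_op mu (mulop w).
Proof.
move=> [mw [c wc]]; apply: (wcomp_bounded (tau := idfun) (c := c ^+ 2)) => //.
- exact: measurable_id.
- exact: mulop_intle.
- exact: sqr_ge0.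
Qed.

Lemma LinfJ w : Linf mu w -> Linf mu (fun t => (w t)^*).
Proof.
move=> [mw [c wc]]; split; first exact: cmeasJ.
by exists c; apply: ae_imp wc => t; rewrite cnormJ.
Qed.

Lemma Linf_cst (a : C) : Linf mu (fun=> a).
Proof. by split; [exact: cmeas_cst|exists (normc a); exact: aeW]. Qed.

Lemma Linf_bool (b : T -> bool) : measurable_fun setT b -> Linf mu (fun t => (b t)%:R).
Proof.
move=> mb; split; first exact: cmeas_bool.
by exists 1; apply: aeW => t; case: (b t); rewrite ?normc0 ?normc1.
Qed.

Lemma jacobian_id : jacobian mu idfun (fun=> 1).
Proof. by move=> phi mphi phi0; apply: eq_integral => t _; rewrite mul1r. Qed.

Lemma mulop_adjoint w : Linf mu w ->
  adjoint mu (mulop w) (mulop (fun t => (w t)^*)).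
Proof.
move=> Lw; apply: (wcomp_adjoint (tau := idfun) (tau' := idfun) jacobian_id) => //.
- exact: measurable_id.
- exact: measurable_id.
- exact: (LinfJ Lw).1.
by move=> t; rewrite conjCK mul1r.
Qed.

(** The squared distance is the integral of [(c m - c0)^2 |x|^2], which is
    dominated by [|x|^2]. *)
Lemma dominated_L2 (c : nat -> T -> R) (c0 : T -> R) x : L2 x ->
  (forall m, measurable_fun setT (c m)) -> measurable_fun setT c0 ->
  (forall m t, 0 <= c m t <= 1) -> (forall t, 0 <= c0 t <= 1) ->
  (\forall t \ae mu, c ^~ t @ \oo --> c0 t) ->
  forall e : R, 0 < e -> exists N, forall m, (N <= m)%N ->
    q (fun t => (c m t)%:C * x t - (c0 t)%:C * x t) < e.
Proof.
move=> Lx mc mc0 c01 c001 cc0 e e0; have [mx xfin] := Lx.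
pose f m t : \bar R := (((c m t - c0 t) ^+ 2 * normc (x t) ^+ 2))%:E.
pose g t : \bar R := (normc (x t) ^+ 2)%:E.
have fE m : q (fun t => (c m t)%:C * x t - (c0 t)%:C * x t) = fine (\int[mu]_t f m t)%E.
  rewrite qE /Rintegral; congr fine; apply: eq_integral => t _.
  by rewrite -mulrBl normcM exprMn -rmorphB normc_real real_normK ?num_real.
have mg : measurable_fun setT g by exact/measurable_EFinP/meas_normc2.
have mf m : measurable_fun setT (f m).
  apply/measurable_EFinP; apply: measurable_funM; last exact: meas_normc2.
  by apply: measurable_funX; apply: measurable_funB.
have gi : mu.-integrable setT g.
  apply/integrableP; split => //.
  by under eq_integral do rewrite gee0_abs ?lee_fin ?sqr_ge0 //.
have [||||_ _] := @dominated_convergence _ T R mu setT measurableT f (cst 0%E) g mf.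
- exact: measurable_cst.
- apply: ae_imp cc0 => t ct _.
  apply: cvg_EFin; first exact: nearW.
  have h : (fun m => (c m t - c0 t) ^+ 2 * normc (x t) ^+ 2) @ \oo
      --> (c0 t - c0 t) ^+ 2 * normc (x t) ^+ 2.
    apply: cvgM; last exact: cvg_cst.
    rewrite expr2; under eq_fun do rewrite expr2.
    by apply: cvgM; apply: cvgB => //; exact: cvg_cst.
  by rewrite subrr expr0n mul0r in h.
- exact: gi.
- apply: aeW => t m _; rewrite gee0_abs; last first.
    by rewrite lee_fin; apply: mulr_ge0; exact: sqr_ge0.
  rewrite lee_fin ler_piMl ?sqr_ge0 // -real_normK ?num_real // expr_le1 ?normr_ge0 //.
  by have := c01 m t; have := c001 t; rewrite ler_norml; lra.
rewrite integral0_eq // => cv.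
have fin_cv : (fun m => fine (\int[mu]_t f m t)%E) @ \oo --> (0 : R).
  by have /fine_cvgP[] := cv.
have /cvgr_lt /(_ _ e0) [N _ Nh] := fin_cv.
by exists N => m Nm; rewrite fE; exact: Nh.
Qed.

End MultiplicationOperators.

(** * Operators on the product of the group with the space *)

Section CrossedOperators.
Context {R : realType} {G : groupType} {d : measure_display} {B : measurableType d}.
Variables (nu : probability B R) (act : G -> B -> B).
Hypotheses (countG : countable [set: G]) (ns : nonsingular_space nu act).
Local Notation C := (R[i]).
Local Notation GB := (discrete_group G * B)%type.
Local Notation mu := (crossed_measure G nu).
Local Notation L2 := (L2 mu).
Local Notation dot := (L2dot mu).
Local Notation q x := (complex.Re (dot x x)).
Local Notation opGB := (op R GB).
Local Notation mact := (act_measurable ns).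

Lemma ns_ae g (P : B -> Prop) : (\forall b \ae nu, P b) -> \forall b \ae nu, P (act g b).
Proof.
move=> [N [mN N0 PN]]; exists (act g @^-1` N); split.
- by rewrite -[X in measurable X]setTI; exact: mact.
- exact/(act_null ns g mN).
- by move=> b /= nP; exact: PN.
Qed.

Lemma actK g b : act g^-1%g (act g b) = b.
Proof. by rewrite -(act_mul ns) mulVg (act_one ns). Qed.

Lemma actVK g b : act g (act g^-1%g b) = b.
Proof. by rewrite -(act_mul ns) mulgV (act_one ns). Qed.

Lemma Linf_act g (f : B -> C) : Linf nu f -> Linf nu (f \o act g).
Proof.
move=> [mf [c fc]]; split; first exact: (cmeas_comp (mact g)).
by exists c; exact: (ns_ae g fc).
Qed.

Lemma Linf_fibers (w : GB -> C) (c : R) : (forall h, cmeasurable (fun b => w (h, b))) ->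
  (forall h, \forall b \ae nu, normc (w (h, b)) <= c) -> Linf mu w.
Proof.
by move=> mw wc; split; [exact: cmeas_fibrewise|exists c; exact: (ae_fibers countG)].
Qed.

Lemma Linf_mult f : Linf nu f -> Linf mu (fun x : GB => f (act x.1 x.2)).
Proof.
move=> [mf [c fc]]; apply: (@Linf_fibers _ c) => h.
  exact: (cmeas_comp (mact h) mf).
exact: (ns_ae h fc).
Qed.

Lemma Linf_chi (z : B -> C) : Linf nu z -> Linf mu (fun x : GB => z x.2).
Proof. by move=> [mz [c zc]]; apply: (@Linf_fibers _ c) => h. Qed.

Lemma Linf_pred (P : G -> bool) : Linf mu (fun x : GB => (P x.1)%:R).
Proof.
apply: (@Linf_fibers _ 1) => h; first exact: (cmeas_cst (P h)%:R).
by apply: aeW => b /=; case: (P h); rewrite ?normc0 ?normc1.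
Qed.

Definition dproj (k : G) : opGB := mulop (fun x : GB => (x.1 == k)%:R).
Definition chimul (z : B -> C) : opGB := mulop (fun x : GB => z x.2).
Definition trunc (e : G -> nat) (n : nat) : opGB :=
  mulop (fun x : GB => (e x.1 < n)%N%:R).
Definition delta (k : G) : GB -> C := fun x => (x.1 == k)%:R.

Lemma mult_bounded f : Linf nu f -> bounded_op mu (mult_op act f).
Proof. by move=> Lf; apply: mulop_bounded; exact: Linf_mult. Qed.

Lemma mult_adjoint f : Linf nu f ->
  adjoint mu (mult_op act f) (mult_op act (fun b => (f b)^*)).
Proof. by move=> Lf; exact: (mulop_adjoint (Linf_mult Lf)). Qed.

Lemma dproj_bounded k : bounded_op mu (dproj k).
Proof. by apply: mulop_bounded; exact: (Linf_pred (fun h => h == k)). Qed.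

Lemma dproj_adjoint k : adjoint mu (dproj k) (dproj k).
Proof.
have := mulop_adjoint (Linf_pred (fun h => h == k)).
rewrite [X in adjoint _ _ (mulop X)](_ : _ = fun x : GB => (x.1 == k)%:R) //.
by apply/funext => x; exact: conjC_nat.
Qed.

Lemma trunc_bounded e n : bounded_op mu (trunc e n).
Proof. by apply: mulop_bounded; exact: (Linf_pred (fun h => (e h < n)%N)). Qed.

Lemma chimul_bounded z : Linf nu z -> bounded_op mu (chimul z).
Proof. by move=> Lz; apply: mulop_bounded; exact: Linf_chi. Qed.

Lemma chimul_adjoint z : Linf nu z ->
  adjoint mu (chimul z) (chimul (fun b => (z b)^*)).
Proof. by move=> Lz; exact: (mulop_adjoint (Linf_chi Lz)). Qed.

Lemma op_eqW (S U : opGB) : (forall x t, S x t = U x t) -> op_eq mu S U.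
Proof. by move=> SU; apply/op_eqP => x _; exact: aeW. Qed.

Lemma mulop_commute v w : commute mu (mulop v : opGB) (mulop w).
Proof. by apply: op_eqW => x t; rewrite /mulop /= mulrCA. Qed.

(** ** Left translations *)

Lemma lambda_wcomp g : @lambda R G d B g = wcomp (fun x : GB => ((g^-1 * x.1)%g, x.2)) (fun=> 1).
Proof. by apply/funext => x; apply/funext => t; rewrite /lambda /wcomp mul1r. Qed.

Lemma measurable_ltrans g : measurable_fun setT (fun x : GB => ((g^-1 * x.1)%g, x.2) : GB).
Proof. by apply: (measurable_fun_fibrewise countG) => h; exact: (measurable_fiber_incl (g^-1 * h)%g). Qed.

(** Counting measure on the group is invariant under translations. *)
Lemma lambda_jacobian g :
  jacobian mu (fun x : GB => ((g^-1 * x.1)%g, x.2)) (fun=> 1).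
Proof.
move=> phi mphi phi0.
have mE : measurable_fun setT (fun x : GB => (phi x)%:E) by exact/measurable_EFinP.
apply: (eq_integral_fibers (s := fun h => (g^-1 * h)%g) (s' := fun h => (g * h)%g) countG).
- exact: mulVKg.
- exact: mulKg.
- under eq_fun do rewrite mul1r.
  exact: (measurableT_comp mE (measurable_ltrans g)).
- by move=> x; rewrite lee_fin mul1r.
- exact: mE.
- by move=> x; rewrite lee_fin.
- by move=> h; under eq_integral do rewrite mul1r.
Qed.

Lemma lambda_intle g (phi : GB -> R) : measurable_fun setT phi ->
  (forall x, 0 <= phi x) ->
  (\int[mu]_x (normc (1 : C) ^+ 2 * phi ((g^-1 * x.1)%g, x.2))%:E
    <= 1%:E * \int[mu]_x (phi x)%:E)%E.
Proof.
move=> mphi phi0; rewrite mul1e -[X in (_ <= X)%E](lambda_jacobian g) //.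
by rewrite normc1 expr1n.
Qed.

Lemma lambda_L2 g x : L2 x -> L2 (lambda g x) /\ q (lambda g x) <= 1 * q x.
Proof.
rewrite lambda_wcomp; exact: (wcomp_L2 (measurable_ltrans g) (cmeas_cst 1)
  (@lambda_intle g) ler01).
Qed.

Lemma lambda_bounded g : bounded_op mu (@lambda R G d B g).
Proof.
rewrite lambda_wcomp; exact: (wcomp_bounded (measurable_ltrans g) (cmeas_cst 1)
  (@lambda_intle g) ler01).
Qed.

Lemma lambda_adjoint g : adjoint mu (@lambda R G d B g) (@lambda R G d B g^-1%g).
Proof.
rewrite !lambda_wcomp; have mJ : measurable_fun setT (fun _ : GB => 1 : R).
  exact: measurable_cst.
refine (wcomp_adjoint (lambda_jacobian g) _ mJ (measurable_ltrans g)
  (measurable_ltrans g^-1%g) (cmeas_cst 1) _ _).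
- by move=> x; exact: ler01.
- by move=> [h b]; rewrite /= invgK mulVKg.
- by move=> t; rewrite mul1r; exact/esym/conjC1.
Qed.

Lemma lambda1 : @lambda R G d B 1%g = idfun.
Proof.
by apply/funext => x; apply/funext => -[h b]; rewrite /lambda /= invg1 mul1g.
Qed.

Lemma lambdaM g h : @lambda R G d B (g * h)%g = @lambda R G d B g \o @lambda R G d B h.
Proof.
by apply/funext => x; apply/funext => -[k b]; rewrite /lambda /= invgM mulgA.
Qed.

Lemma lambda_dproj g k (x : GB -> C) : lambda g (dproj k x) = dproj (g * k)%g (lambda g x).
Proof.
apply/funext => -[h b]; rewrite /lambda /dproj /mulop /=.
by rewrite -(inj_eq (mulgI g)) mulVKg.
Qed.

Lemma lambda_mult g (f : B -> C) (x : GB -> C) : lambda g (mult_op act f x)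
  = mult_op act (f \o act g^-1%g) (lambda g x).
Proof.
by apply/funext => -[h b]; rewrite /lambda /mult_op /= (act_mul ns).
Qed.

Lemma mult_lambda_adjoint g f : Linf nu f ->
  adjoint mu (mult_op act f \o @lambda R G d B g)
    (mult_op act (fun b => (f (act g b))^*) \o @lambda R G d B g^-1%g).
Proof.
move=> Lf; have := adjoint_comp (mult_bounded (LinfJ Lf)) (lambda_bounded g)
  (mult_adjoint Lf) (lambda_adjoint g).
congr (adjoint _ _ _); apply/funext => x.
by rewrite /= lambda_mult invgK.
Qed.

(** ** Weighted right translations *)

Definition rtrans (k : G) (w : B -> R) : opGB :=
  wcomp (fun x : GB => ((x.1 * k)%g, act k^-1%g x.2)) (fun x => (w x.2)%:C).

Lemma measurable_rt k : measurable_fun setT (fun x : GB => ((x.1 * k)%g, act k^-1%g x.2) : GB).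
Proof.
by apply: (measurable_fun_fibrewise countG) => h; exact: (measurableT_comp (measurable_fiber_incl (h * k)%g) (mact k^-1%g)).
Qed.

Lemma rt_jacobian k (w : B -> R) : measurable_fun setT w -> (forall b, 0 < w b) ->
  (forall phi : B -> R, measurable_fun setT phi -> (forall b, 0 <= phi b) ->
    (\int[nu]_b (phi b * w b)%:E = \int[nu]_b (phi (act k b))%:E)%E) ->
  jacobian mu (fun x : GB => ((x.1 * k)%g, act k^-1%g x.2)) (fun x => w x.2).
Proof.
move=> mw w0 wE phi mphi phi0.
have mE : measurable_fun setT (fun x : GB => (phi x)%:E) by exact/measurable_EFinP.
apply: (eq_integral_fibers (s := fun h => (h * k)%g) (s' := fun h => (h * k^-1)%g) countG).
- exact: mulgK.
- exact: mulgVK.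
- apply/measurable_EFinP; apply: measurable_funM.
    exact: (measurableT_comp mw).
  exact: (measurableT_comp mphi (measurable_rt k)).
- by move=> x; rewrite lee_fin mulr_ge0 // ltW.
- exact: mE.
- by move=> x; rewrite lee_fin.
- move=> h /=; under eq_integral do rewrite mulrC.
  rewrite (wE (fun b => phi ((h * k)%g, act k^-1%g b))) //.
    by under eq_integral do rewrite actK.
  apply: (measurableT_comp mphi).
  exact: (measurableT_comp (measurable_fiber_incl (h * k)%g) (mact k^-1%g)).
Qed.

(** Together these operators generate the commutant of the crossed product; to
    compute the symbol of an element it is enough to commute with them. *)
Definition right_ops : set opGB :=
  [set U | (exists2 z, Linf nu z & U = chimul z) \/
    exists k w k' w', [/\ U = rtrans k w, bounded_op mu U,
      bounded_op mu (rtrans k' w') & adjoint mu U (rtrans k' w')]].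

Lemma right_ops_adj : adj_closed mu right_ops.
Proof.
move=> U [[z Lz ->]|[k [w [k' [w' [-> bU bU' UU]]]]]].
  split; first exact: chimul_bounded.
  exists (chimul (fun b => (z b)^*)); last exact: chimul_adjoint.
  by left; exists (fun b => (z b)^*) => //; exact: LinfJ.
split=> //; exists (rtrans k' w') => //; right.
by exists k', w', k, w; split => //; exact: adjoint_sym.
Qed.

(** The weight is the square root of the Radon-Nikodym derivative, which makes
    the right translation unitary. *)
Lemma rtrans_exists k : exists2 w : B -> R, (forall b, 0 < w b) & right_ops (rtrans k w).
Proof.
have [J [mJ J0 JE]] := density_exists (mact k) (act_null ns k).
pose w b := Num.sqrt (J b).
have w0 b : 0 < w b by rewrite sqrtr_gt0.
have mw : measurable_fun setT w.
  apply: measurableT_comp mJ.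
  by apply: continuous_measurable_fun; exact: sqrt_continuous.
have jac := rt_jacobian mJ J0 JE.
pose w' b := (w (act k b))^-1.
have mw' : measurable_fun setT w'.
  have -> : w' = (fun r : R => r^-1) \o w \o act k by [].
  apply: measurableT_comp (mact k).
  apply: (@eq_measurable_fun _ _ _ _ _ (fun b => expR (- ln (w b)))).
    by move=> b _; rewrite /= expRN lnK // posrE.
  apply: measurableT_comp; first exact: measurable_expR.
  by apply: measurable_funN; apply: measurableT_comp mw; exact: measurable_ln.
have sq b : normc (w b)%:C ^+ 2 = J b.
  by rewrite normc_real real_normK ?num_real // sqr_sqrtr // ltW.
have bU : bounded_op mu (rtrans k w).
  apply: (wcomp_bounded (c := 1)) => //.
  - exact: measurable_rt.
  - by apply: cmeas_real; exact: (measurableT_comp mw).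
  - move=> phi mphi phi0; rewrite mul1e -[X in (_ <= X)%E](jac phi) //.
    by under eq_integral do rewrite sq.
have mc' : cmeasurable (fun x : GB => (w' x.2)%:C).
  by apply: cmeas_real; exact: (measurableT_comp mw').
have sq' b : normc (w' b)%:C ^+ 2 = (J (act k b))^-1.
  by rewrite normc_real real_normK ?num_real // exprVn sqr_sqrtr // ltW.
have bU' : bounded_op mu (rtrans k^-1%g w').
  apply: (wcomp_bounded (c := 1)) => //; first exact: measurable_rt.
  move=> phi mphi phi0; rewrite mul1e.
  rewrite -[X in (X <= _)%E](jac (fun x => normc (w' x.2)%:C ^+ 2
      * phi ((x.1 * k^-1)%g, act k^-1^-1%g x.2))).
  - rewrite le_eqVlt; apply/orP; left; apply/eqP; apply: eq_integral => -[h b] _.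
    by rewrite sq' /= mulgK invgK actVK mulrA mulfV ?mul1r // gt_eqF.
  - apply: measurable_funM; first exact: meas_normc2.
    exact: (measurableT_comp mphi (measurable_rt k^-1%g)).
  - by move=> x; rewrite mulr_ge0 ?sqr_ge0.
exists w => //; right; exists k, w, k^-1%g, w'; split => //.
apply: (wcomp_adjoint jac) => //.
- by move=> x; exact: ltW.
- exact: (measurableT_comp mJ).
- exact: measurable_rt.
- exact: measurable_rt.
- by move=> [h b] /=; rewrite mulgK invgK actVK.
- move=> [h b] /=; rewrite /w' actVK conjcr -rmorphM /=; congr _%:C.
  rewrite -[X in X / _](@sqr_sqrtr _ (J b)) ?ltW // expr2 -mulrA mulfV ?mulr1 //.
  by rewrite gt_eqF // sqrtr_gt0.
Qed.

End CrossedOperators.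

(** * Fourier coefficients in the crossed product *)

Section Symbol.
Context {R : realType} {G : groupType} {d : measure_display} {B : measurableType d}.
Variables (nu : probability B R) (act : G -> B -> B).
Hypotheses (countG : countable [set: G]) (ns : nonsingular_space nu act).
Local Notation C := (R[i]).
Local Notation GB := (discrete_group G * B)%type.
Local Notation mu := (crossed_measure G nu).
Local Notation L2 := (L2 mu).
Local Notation dot := (L2dot mu).
Local Notation q x := (complex.Re (dot x x)).
Local Notation opGB := (op R GB).
Local Notation crossed := (crossed_product nu act (Linf nu) setT).

Lemma crossed_right S : crossed S ->
  bounded_op mu S /\ forall U, right_ops nu act U -> commute mu S U.
Proof.
suff : crossed `<=` commutant mu (right_ops nu act) by apply.
rewrite /crossed_product.
apply: (vN_generated_sub (commutant_vN (@right_ops_adj _ _ _ _ nu act countG))) => {}S [].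
  move=> [f Lf <-]; split; first exact: mult_bounded.
  move=> U [[z Lz ->]|[k [w [k' [w' [-> _ _ _]]]]]]; first exact: mulop_commute.
  apply: op_eqW => x [h b]; rewrite /rtrans /wcomp /mult_op /=.
  by rewrite (act_mul ns) (actVK ns) mulrCA.
move=> [g _ <-]; split; first exact: lambda_bounded.
move=> U [[z Lz ->]|[k [w [k' [w' [-> _ _ _]]]]]]; first exact: op_eqW.
by apply: op_eqW => x [h b]; rewrite /rtrans /wcomp /lambda /= mulgA.
Qed.

Lemma crossed_bounded S : crossed S -> bounded_op mu S.
Proof. by case/crossed_right. Qed.

Definition column (k : G) (z : B -> C) : GB -> C := fun x => (x.1 == k)%:R * z x.2.

Lemma cmeas_column k z : cmeasurable z -> cmeasurable (column k z).
Proof.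
move=> mz; apply: (cmeas_fibrewise countG) => h; rewrite /column /=.
by apply: cmeasM => //; exact: cmeas_cst.
Qed.

Lemma column_int k z : cmeasurable z ->
  (\int[mu]_x ((normc (column k z x)) ^+ 2)%:E = \int[nu]_b ((normc (z b)) ^+ 2)%:E)%E.
Proof.
move=> mz; rewrite (integral_one_fiber nu (h := k)).
- by apply: eq_integral => b _; rewrite /column /= eqxx mul1r.
- by apply/measurable_EFinP/meas_normc2; exact: cmeas_column.
- by move=> x; rewrite lee_fin sqr_ge0.
- by move=> x /eqP/negbTE xk; rewrite /column xk mul0r normc0 expr0n.
Qed.

Lemma column_L2 k z : cmeasurable z -> (\int[nu]_b ((normc (z b)) ^+ 2)%:E < +oo)%E ->
  L2 (column k z).
Proof. by move=> mz zfin; split; [exact: cmeas_column|rewrite column_int]. Qed.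

Lemma Linf_L2 z : Linf nu z -> Defs.L2 nu z.
Proof.
move=> [mz [c zc]]; apply: (@L2_le _ _ _ nu c z (fun=> 1)) => //.
  split; first exact: cmeas_cst.
  rewrite normc1 integral_cst // expr1n mul1e.
  by apply: le_lt_trans (probability_le1 _ _) _; rewrite ?ltry.
by apply: ae_imp zc => b; rewrite normc1 mulr1.
Qed.

Lemma column_Linf k z : Linf nu z -> L2 (column k z).
Proof. by move=> /Linf_L2[]; exact: column_L2. Qed.

Lemma deltaE k : delta k = column k (fun=> 1).
Proof. by apply/funext => x; rewrite /column mulr1. Qed.

Lemma delta_L2 k : L2 (delta k).
Proof. by rewrite deltaE; apply: column_Linf; exact: Linf_cst. Qed.

Lemma dproj_column k x : dproj k x = column k (fun b => x (k, b)).
Proof.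
apply/funext => -[h b]; rewrite /dproj /mulop /column /=.
by case: eqP => [->|]; rewrite ?mul0r.
Qed.

Lemma dproj_L2 k x : L2 x -> L2 (dproj k x).
Proof. exact: (bounded_L2 (dproj_bounded nu countG k)). Qed.

(** The function [f_g] in the Fourier series of [S], with terms [f_g lambda_g]. *)
Definition coef (S : opGB) (g : G) : B -> C :=
  canonical_expectation (S \o lambda g^-1%g).

Lemma coefE S g b : coef S g b = S (delta g^-1%g) (1%g, b).
Proof.
rewrite /coef /canonical_expectation /=; congr (S _ _); apply/funext => -[h c].
rewrite /lambda /delta_one /delta /= invgK; congr (_%:R).
by rewrite -(inj_eq (mulgI g^-1%g)) mulKg mulg1.
Qed.

(** [S] commutes with the bounded functions of the second variable; an
    unbounded fibre is first made bounded by a nowhere vanishing factor. *)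
Lemma crossed_column S k x : crossed S -> L2 x ->
  \forall t \ae mu, S (dproj k x) t = S (delta k) t * x (k, t.2).
Proof.
move=> /crossed_right[bS SU] Lx.
(* Both [z] and [z x(k, .)] are bounded, so that [S] commutes with them. *)
pose z b : C := ((1 + normc (x (k, b)))^-1)%:C.
have mxk : cmeasurable (fun b => x (k, b)) by exact: cmeas_fiber Lx.1.
have den b : 0 < 1 + normc (x (k, b)) by rewrite ltr_pwDl ?normc_ge0.
have mz : cmeasurable z.
  apply: cmeas_real.
  apply: (@eq_measurable_fun _ _ _ _ _ (fun b => expR (- ln (1 + normc (x (k, b)))))).
    by move=> b _; rewrite /= expRN lnK // posrE.
  apply: measurableT_comp; first exact: measurable_expR.
  apply: measurable_funN; apply: measurableT_comp; first exact: measurable_ln.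
  by apply: measurable_funD => //; exact: meas_normc.
have nz b : normc (z b) = (1 + normc (x (k, b)))^-1.
  by rewrite normc_real ger0_norm // invr_ge0 ltW.
have Lz : Linf nu z.
  split=> //; exists 1; apply: aeW => b; rewrite nz invf_le1 // lerDl.
  exact: normc_ge0.
have Lzx : Linf nu (fun b => z b * x (k, b)).
  split; first exact: cmeasM.
  exists 1; apply: aeW => b; rewrite normcM nz mulrC ler_pdivrMr // mul1r lerDr.
  exact: ler01.
have cz w : Linf nu w -> commute mu S (chimul w) by move=> Lw; apply: SU; left; exists w.
have Ldx := dproj_L2 k Lx; have Ld := delta_L2 k.
have e : chimul z (dproj k x) = chimul (fun b => z b * x (k, b)) (delta k).
  rewrite dproj_column deltaE; apply/funext => t.
  by rewrite /chimul /mulop /column; ring.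
have /op_eqP /(_ _ Ldx) c1 := cz _ Lz; have /op_eqP /(_ _ Ld) c2 := cz _ Lzx.
apply: ae_imp2 c1 c2 => t; rewrite /= e => ->.
rewrite /chimul /mulop => h; apply: (@mulfI _ (z t.2)).
  by apply/eqP => z0; have := nz t.2; rewrite z0 normc0 => /esym /eqP;
    rewrite invr_eq0 gt_eqF.
by rewrite h; ring.
Qed.

(** Covariance under the weighted right translations moves the column [k] to
    the column [k h^-1]. *)
Lemma crossed_delta S k : crossed S ->
  \forall t \ae mu, S (delta k) t = coef S (t.1 * k^-1)%g (act t.1 t.2).
Proof.
move=> cS; have [bS SU] := crossed_right cS.
apply: (ae_fibers countG) => h /=.
have [w w0 Rw] := rtrans_exists countG ns h.
have [bU _] := right_ops_adj countG Rw.
have Ld := delta_L2 k; have LU := bounded_L2 bU Ld.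
have /op_eqP /(_ _ Ld) /= c1 := SU _ Rw.
have e : dproj (k * h^-1)%g (rtrans act h w (delta k)) = rtrans act h w (delta k).
  apply/funext => -[m b]; rewrite /dproj /mulop /rtrans /wcomp /delta /=.
  case: (m =P _) => [->|ne]; first by rewrite mul1r.
  rewrite mul0r; case: eqP => [mh|]; last by rewrite mulr0.
  by exfalso; apply: ne; rewrite -mh mulgK.
have c2 := crossed_column (k * h^-1)%g cS LU; rewrite e in c2.
have c : \forall t \ae mu, rtrans act h w (S (delta k)) t
    = S (delta (k * h^-1)%g) t * rtrans act h w (delta k) ((k * h^-1)%g, t.2).
  by apply: ae_imp2 c1 c2 => t <- ->.
have {}c := @ae_fiber _ _ _ _ nu _ 1%g c.
have {}c := ns_ae ns h c.
apply: ae_imp c => b; rewrite coefE /rtrans /wcomp /= mul1g (actK ns).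
rewrite invgM invgK /delta mulgVK eqxx mulr1 mulrC => h1.
apply: (@mulIf _ (w (act h b))%:C) => //.
by apply/eqP => -[] /eqP; rewrite gt_eqF.
Qed.

(** In matrix form, the entry of [S] in row [h] and column [k] is the
    multiplication by a function that depends only on [h k^-1], up to the action
    of [h]. *)
Lemma crossed_symbol S k x : crossed S -> L2 x ->
  \forall t \ae mu, S (dproj k x) t
    = coef S (t.1 * k^-1)%g (act t.1 t.2) * x (k, t.2).
Proof.
by move=> cS Lx; apply: ae_imp2 (crossed_column k cS Lx) (crossed_delta k cS) => t -> ->.
Qed.

Lemma cmeas_coef S g : crossed S -> cmeasurable (coef S g).
Proof.
move=> cS; have -> : coef S g = (fun b => S (delta g^-1%g) (1%g, b)).
  by apply/funext => b; rewrite coefE.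
by apply: cmeas_fiber; exact: (bounded_L2 (crossed_bounded cS) (delta_L2 _)).1.
Qed.

(** The coefficient is tested on the indicator function [z] of the set where it
    exceeds [c]: the norm of [S] bounds the integral of [|f_g|^2] over that set by
    [c^2] times its measure. *)
Lemma coef_bound S g (c : R) : crossed S -> 0 <= c ->
  (forall x, L2 x -> q (S x) <= c ^+ 2 * q x) ->
  \forall b \ae nu, normc (coef S g b) <= c.
Proof.
move=> cS c0 Sc; have mf := cmeas_coef g cS; have bS := crossed_bounded cS.
pose big b := c < normc (coef S g b).
have mbig : measurable_fun setT big.
  by apply: measurable_fun_ltr => //; exact: meas_normc.
pose z b : C := (big b)%:R.
have Lz : Linf nu z by exact: Linf_bool.
pose x := column g^-1%g z.
have Lx : L2 x by exact: column_Linf.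
have LSx := bounded_L2 bS Lx.
have xE : dproj g^-1%g x = x.
  by rewrite dproj_column; apply/funext => t; rewrite /x /column /= eqxx mul1r.
have sym : \forall t \ae mu, dproj 1%g (S x) t = column 1%g (fun b => coef S g b * z b) t.
  have := crossed_symbol g^-1%g cS Lx; rewrite xE; apply: ae_imp => -[h b] /= e.
  rewrite /dproj /mulop /column /= e; case: eqP => [->|_]; last by rewrite !mul0r.
  by rewrite invgK mul1g (act_one ns) /x /column /= eqxx !mul1r.
have Ld : L2 (dproj 1%g (S x)) by exact: dproj_L2.
have mcz : cmeasurable (fun b => coef S g b * z b).
  by apply: cmeasM => //; exact: Lz.1.
have Lc : L2 (column 1%g (fun b => coef S g b * z b)).
  by apply: L2_ae Ld _; [exact: cmeas_column|apply: ae_imp sym => t].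
have q1 : q (column 1%g (fun b => coef S g b * z b)) <= c ^+ 2 * q x.
  rewrite -(dot_ae Ld Lc Ld Lc sym sym); apply: le_trans (Sc x Lx).
  have [] := @mulop_q _ _ _ mu (fun t : GB => (t.1 == 1%g)%:R) 1 (S x) _ _ LSx.
  - exact: (Linf_pred nu countG (fun h => h == 1%g)).1.
  - by apply: aeW => t; case: (_ == _); rewrite ?normc0 ?normc1.
  - by rewrite expr1n mul1r.
move: q1; rewrite -lee_fin EFinM !q_EFin // !column_int //; last exact: Lz.1.
have mz2 : measurable_fun setT (fun b => ((normc (z b)) ^+ 2)%:E).
  by apply/measurable_EFinP/meas_normc2; exact: Lz.1.
rewrite -ge0_integralZl_EFin ?sqr_ge0 //; last by move=> b _; rewrite lee_fin sqr_ge0.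
pose D b := (normc (coef S g b) ^+ 2 - c ^+ 2) * normc (z b) ^+ 2.
have D0 b : 0 <= D b.
  rewrite /D /z; case: (boolP (big b)) => [bb|_]; last first.
    by rewrite normc0 expr0n mulr0.
  by rewrite mulr_ge0 ?sqr_ge0 // subr_ge0 ler_pXn2r ?nnegrE ?normc_ge0 // ltW.
have mD : measurable_fun setT D.
  apply: measurable_funM; last by apply: meas_normc2; exact: Lz.1.
  by apply: measurable_funB; [exact: meas_normc2|exact: measurable_cst].
have split_int : (\int[nu]_b ((normc (coef S g b * z b)) ^+ 2)%:E
    = \int[nu]_b (D b)%:E + \int[nu]_b ((c ^+ 2)%:E * ((normc (z b)) ^+ 2)%:E))%E.
  rewrite -ge0_integralD //.
  - apply: eq_integral => b _; rewrite -EFinM -EFinD; congr _%:E.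
    by rewrite normcM exprMn /D; ring.
  - by move=> b _; rewrite lee_fin.
  - exact/measurable_EFinP.
  - by move=> b _; rewrite -EFinM lee_fin mulr_ge0 ?sqr_ge0.
  - apply/measurable_EFinP; apply: measurable_funM => //.
    by apply: meas_normc2; exact: Lz.1.
have fin2 : (\int[nu]_b ((c ^+ 2)%:E * ((normc (z b)) ^+ 2)%:E))%E \is a fin_num.
  rewrite ge0_fin_numE; last first.
    by apply: integral_ge0 => b _; rewrite -EFinM lee_fin mulr_ge0 ?sqr_ge0.
  rewrite ge0_integralZl_EFin ?sqr_ge0 //; last by move=> b _; rewrite lee_fin sqr_ge0.
  by apply: lte_mul_pinfty; rewrite ?lee_fin ?sqr_ge0 //; exact: (Linf_L2 Lz).2.
rewrite split_int -[leRHS]add0e leeD2rE // => le0.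
have : (\int[nu]_b `|(D b)%:E| = 0)%E.
  under eq_integral do rewrite gee0_abs ?lee_fin //.
  by apply/le_anti; rewrite le0 integral_ge0 // => b _; rewrite lee_fin.
move/ae_eq_integral_abs => /(_ measurableT) h.
have := h ((measurable_EFinP _ _).2 mD); apply: ae_imp => b /(_ I) /= [] Db.
rewrite leNgt; apply/negP => bb; move: Db; rewrite /D /z /big bb.
rewrite normc1 expr1n mulr1 => /eqP; rewrite subr_eq0 eqrXn2 ?normc_ge0 // => /eqP e.
by move: bb; rewrite e ltxx.
Qed.

Lemma coef_Linf S g : crossed S -> Linf nu (coef S g).
Proof.
move=> cS; split; first exact: cmeas_coef.
have [c c0 Sc] := bounded_q (crossed_bounded cS).
by exists c; exact: coef_bound.
Qed.

Lemma coef1 S : coef S 1%g = canonical_expectation S.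
Proof. by rewrite /coef invg1 lambda1. Qed.

End Symbol.

(** * Truncation to finitely many columns *)

(** Two applications of [q (x + y) <= 2 q x + 2 q y]. *)
Lemma double_triangle (R : realType) (e a b c d r : R) : a < e / 4 ->
  b <= c *+ 2 + d *+ 2 -> c <= r -> d <= r -> r *+ 16 < e -> a *+ 2 + b *+ 2 < e.
Proof. by rewrite -[r *+ 16]mulr_natl !mulr2n; lra. Qed.

Section Truncation.
Context {R : realType} {G : groupType} {d : measure_display} {B : measurableType d}.
Variables (nu : probability B R).
Hypotheses (countG : countable [set: G]).
Local Notation C := (R[i]).
Local Notation GB := (discrete_group G * B)%type.
Local Notation mu := (crossed_measure G nu).
Local Notation L2 := (L2 mu).
Local Notation dot := (L2dot mu).
Local Notation q x := (complex.Re (dot x x)).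
Local Notation opGB := (op R GB).
Local Notation H := (L2_semi_hilbert mu).
Implicit Types (x y : GB -> C) (S U : opGB).

Lemma trunc_L2 e n x : L2 x -> L2 (trunc e n x).
Proof. exact: (bounded_L2 (trunc_bounded nu countG e n)). Qed.

Lemma trunc_lim (e : G -> nat) x (eps : R) : L2 x -> 0 < eps ->
  exists N, forall n, (N <= n)%N -> q (trunc e n x - x) < eps.
Proof.
move=> Lx eps0.
have [|||||N Nh] := @dominated_L2 _ _ _ mu
  (fun n (t : GB) => (e t.1 < n)%N%:R : R) (fun=> 1) x Lx _ _ _ _ _ eps eps0.
- move=> m; apply: (measurable_fun_fibrewise countG) => h.
  exact: (measurable_cst ((e h < m)%N%:R : R)).
- exact: measurable_cst.
- by move=> m t; case: (_ < _)%N; rewrite ?lexx ler01.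
- by move=> t; rewrite ler01 lexx.
- apply: aeW => t; apply: cvg_near_cst; exists (e t.1).+1 => // n /= en.
  by rewrite en.
exists N => n Nn.
have -> : trunc e n x - x
    = fun t => ((e t.1 < n)%N%:R : R)%:C * x t - (1 : R)%:C * x t; last exact: Nh.
apply/funext => t.
change ((e t.1 < n)%N%:R * x t - x t = ((e t.1 < n)%N%:R : R)%:C * x t - (1 : R)%:C * x t).
by rewrite mul1r; case: (_ < _)%N.
Qed.

Lemma trunc_nil e x : trunc e 0 x = fun=> 0.
Proof. by apply/funext => t; rewrite /trunc /mulop ltn0 mul0r. Qed.

Lemma trunc_hit e k x : injective e ->
  trunc e (e k).+1 x = fun t => trunc e (e k) x t + dproj k x t.
Proof.
move=> einj; apply/funext => t; rewrite /trunc /dproj /mulop -mulrDl ltnS leq_eqVlt.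
have -> : (e t.1 == e k) = (t.1 == k) by rewrite (inj_eq einj).
case: eqP => [->|_] /=; last by rewrite addr0.
by rewrite ltnn add0r.
Qed.

Lemma trunc_miss e n x : (forall k, e k <> n) -> trunc e n.+1 x = trunc e n x.
Proof.
move=> nok; apply/funext => t; rewrite /trunc /mulop ltnS leq_eqVlt.
by case: eqP => // et; exfalso; apply: (nok t.1).
Qed.

Lemma trunc_ind (P : (GB -> C) -> Prop) (e : G -> nat) x : injective e ->
  P (fun=> 0) -> (forall y z, P y -> P z -> P (fun t => y t + z t)) ->
  (forall k, P (dproj k x)) -> forall n, P (trunc e n x).
Proof.
move=> einj P0 PD Pk; elim=> [|n IH]; first by rewrite trunc_nil.
have [[k ek]|nok] := pselect (exists k, e k = n).
  by rewrite -ek trunc_hit //; apply: PD => //; rewrite ek.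
by rewrite trunc_miss // => k ek; apply: nok; exists k.
Qed.

(** Truncations along an enumeration of the group are finite sums of columns, so
    an additive property that holds for all columns holds on a dense subspace. *)
Lemma column_dense (P : (GB -> C) -> Prop) x : L2 x ->
  P (fun=> 0) -> (forall y z, P y -> P z -> P (fun t => y t + z t)) ->
  (forall k, P (dproj k x)) ->
  forall eps : R, 0 < eps -> exists y, [/\ L2 y, P y & q (y - x) < eps].
Proof.
move=> Lx P0 PD Pk eps eps0; have [e einj] := group_enum countG.
have [N Nh] := trunc_lim e Lx eps0.
exists (trunc e N x); split; [exact: trunc_L2| |exact: Nh].
exact: (trunc_ind (P := P)).
Qed.

Lemma bounded_ext S U : bounded_op mu S -> bounded_op mu U ->
  (forall k x, L2 x -> \forall t \ae mu, S (dproj k x) t = U (dproj k x) t) ->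
  op_eq mu S U.
Proof.
move=> bS bU SU; apply/op_eqP => x Lx.
have LSx := bounded_L2 bS Lx; have LUx := bounded_L2 bU Lx.
apply: q_sub0_ae => //; apply/le_anti; rewrite q_ge0 andbT.
apply/ler_addgt0Pr => e e0; rewrite add0r.
have [c c0 Sc] := bounded_qB bS; have [c' c0' Uc] := bounded_qB bU.
pose m := c + c' + 1; have m0 : 0 < m by rewrite /m ltr_wpDl // addr_ge0.
have em : 0 < e / (m *+ 2) by rewrite divr_gt0 // pmulrn_rgt0.
have [||k|y [Ly yP ye]] := @column_dense (fun y => L2 y /\
  \forall t \ae mu, S y t = U y t) x Lx _ _ _ _ em.
- split; first exact: L2_0.
  have z : \forall t \ae mu, (fun=> 0 : C) t = 0 by exact: aeW.
  by apply: ae_imp2 (bounded_0 bS (L2_0 mu) z) (bounded_0 bU (L2_0 mu) z) => t -> ->.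
- move=> y z [Ly yE] [Lz zE]; split; first exact: L2D.
  apply: ae_imp2 (ae_andP yE zE) (ae_andP (bounded_D bS Ly Lz) (bounded_D bU Ly Lz)).
  by move=> t [-> ->] [-> ->].
- split; first exact: dproj_L2.
  exact: SU.
have {yP} [_ yE] := yP.
have LSy := bounded_L2 bS Ly; have LUy := bounded_L2 bU Ly.
have -> : q (S x - U x) = q ((S x - S y) + (U y - U x)).
  have L1 := L2B LSx LUx; have L2' := L2D (L2B LSx LSy) (L2B LUy LUx).
  congr complex.Re; apply: (dot_ae L1 L2' L1 L2'); apply: ae_imp yE => t e1;
    by change (S x t - U x t = (S x t - S y t) + (U y t - U x t)); rewrite e1 addrA subrK.
apply: le_trans (qD_le H (L2B LSx LSy) (L2B LUy LUx)) _.
have h1 : q (S x - S y) <= c * q (y - x) by rewrite (q_sym H Ly Lx); exact: Sc.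
have h2 : q (U y - U x) <= c' * q (y - x) by exact: Uc.
have h3 : (m *+ 2) * q (y - x) <= e.
  by rewrite mulrC -ler_pdivlMr ?pmulrn_rgt0 // ltW.
have h4 : 0 <= q (y - x) by exact: q_ge0.
move: h1 h2 h3 h4; rewrite /m; move: (q (S x - S y)) (q (U y - U x)) (q (y - x)).
by move=> a b r; rewrite !mulr2n; nra.
Qed.

(** A uniformly bounded sequence that converges strongly on a dense subspace
    converges strongly everywhere. *)
Lemma vN_column_limit (A : set opGB) (S : nat -> opGB) U (c : R) : vN_algebra mu A ->
  (forall m, A (S m)) -> bounded_op mu U -> 0 <= c ->
  (forall m x, L2 x -> q (S m x) <= c * q x) ->
  (forall k x, L2 x -> forall e : R, 0 < e -> exists N, forall m, (N <= m)%N ->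
     q (S m (dproj k x) - U (dproj k x)) < e) -> A U.
Proof.
move=> vA AS bU c0 Sc lim; have bS m := vN_bounded vA (AS m).
have [c' c0' Uc] := bounded_q bU.
have strong x : L2 x -> forall e : R, 0 < e -> exists N, forall m, (N <= m)%N ->
    q (S m x - U x) < e.
  move=> Lx e e0.
  pose m := c + c' ^+ 2 + 1; have m0 : 0 < m.
    by rewrite /m ltr_wpDl // addr_ge0 ?sqr_ge0.
  have em : 0 < e / (m *+ 16) by rewrite divr_gt0 // pmulrn_rgt0.
  have [||k|y [Ly [_ yP] ye]] := @column_dense (fun y => L2 y /\
    forall e : R, 0 < e -> exists N, forall m, (N <= m)%N -> q (S m y - U y) < e)
    x Lx _ _ _ _ em.
  - split; first exact: L2_0.
    move=> e1 e10; exists 0%N => n _; rewrite q_ae0 //.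
      exact: L2B (bounded_L2 (bS n) (L2_0 mu)) (bounded_L2 bU (L2_0 mu)).
    have z : \forall t \ae mu, (fun=> 0 : C) t = 0 by exact: aeW.
    apply: ae_imp2 (bounded_0 (bS n) (L2_0 mu) z) (bounded_0 bU (L2_0 mu) z) => t e2 e3.
    by change (S n (fun=> 0) t - U (fun=> 0) t = 0); rewrite e2 e3 subrr.
  - move=> y z [Ly yP] [Lz zP]; split; first exact: L2D.
    move=> e1 e10; have e4 : 0 < e1 / 4 by exact: divr_gt0.
    have [N1 h1] := yP _ e4; have [N2 h2] := zP _ e4.
    exists (maxn N1 N2) => n; rewrite geq_max => /andP[n1 n2].
    have LSy := bounded_L2 (bS n) Ly; have LSz := bounded_L2 (bS n) Lz.
    have LUy := bounded_L2 bU Ly; have LUz := bounded_L2 bU Lz.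
    have Lyz := L2D Ly Lz.
    have La := L2B (bounded_L2 (bS n) Lyz) (bounded_L2 bU Lyz).
    have Lb := L2D (L2B LSy LUy) (L2B LSz LUz).
    have -> : q (S n (fun t => y t + z t) - U (fun t => y t + z t))
        = q ((S n y - U y) + (S n z - U z)).
      congr complex.Re; apply: (dot_ae La Lb La Lb); apply: ae_imp2 (bounded_D (bS n) Ly Lz) (bounded_D bU Ly Lz);
        move=> t e2 e3; change (S n (fun t => y t + z t) t - U (fun t => y t + z t) t
          = (S n y t - U y t) + (S n z t - U z t)); rewrite e2 e3; ring.
    apply: le_lt_trans (qD_le H (L2B LSy LUy) (L2B LSz LUz)) _.
    by have := h1 n n1; have := h2 n n2; rewrite !mulr2n; lra.
  - split; first exact: dproj_L2.
    exact: lim.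
  have e4 : 0 < e / 4 by exact: divr_gt0.
  have [N Nh] := yP _ e4; exists N => n Nn.
  have LSx := bounded_L2 (bS n) Lx; have LSy := bounded_L2 (bS n) Ly.
  have LUx := bounded_L2 bU Lx; have LUy := bounded_L2 bU Ly.
  have -> : S n x - U x = (S n y - U y) + ((S n x - S n y) + (U y - U x)).
    by apply/funext => t; change (S n x t - U x t = (S n y t - U y t)
      + ((S n x t - S n y t) + (U y t - U x t))); ring.
  apply: le_lt_trans (qD_le H (L2B LSy LUy) (L2D (L2B LSx LSy) (L2B LUy LUx))) _.
  have h0 := Nh n Nn.
  have h1 := qD_le H (L2B LSx LSy) (L2B LUy LUx).
  have h5 : 0 <= q (y - x) by exact: q_ge0.
  have h2 : q (S n x - S n y) <= m * q (y - x).
    have e2 := bounded_B (bS n) Lx Ly; have Lxy := L2B Lx Ly.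
    have L3 := bounded_L2 (bS n) Lxy; have L4 := L2B LSx LSy.
    rewrite -(dot_ae L3 L4 L3 L4 e2 e2) (q_sym H Ly Lx).
    apply: le_trans (Sc n _ Lxy) _; apply: ler_wpM2r; first exact: q_ge0.
    by rewrite /m -addrA lerDl addr_ge0 ?sqr_ge0.
  have h3 : q (U y - U x) <= m * q (y - x).
    have e2 := bounded_B bU Ly Lx; have Lyx := L2B Ly Lx.
    have L3 := bounded_L2 bU Lyx; have L4 := L2B LUy LUx.
    rewrite -(dot_ae L3 L4 L3 L4 e2 e2).
    apply: le_trans (Uc _ Lyx) _; apply: ler_wpM2r => //.
    by rewrite /m addrAC lerDr addr_ge0.
  have h4 : (m * q (y - x)) *+ 16 < e.
    by rewrite -mulrnAl mulrC -ltr_pdivlMr ?pmulrn_rgt0.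
  exact: (double_triangle h0 h1 h2 h3 h4).
apply: (vN_seq_limit vA AS bU) => x y Lx Ly e e0.
have qy1 : 0 < q y + 1 by apply: ltr_wpDl => //; exact: q_ge0.
have [N Nh] := strong x Lx _ (divr_gt0 (exprn_gt0 2 e0) qy1).
exists N => m Nm; have LS := bounded_L2 (bS m) Lx; have LU := bounded_L2 bU Lx.
rewrite -(dotBl H LU LS Ly) -(@ltr_pXn2r _ 2) ?nnegrE ?normc_ge0 ?ltW //.
apply: le_lt_trans (cauchy_schwarz H (L2B LU LS) Ly) _.
rewrite (q_sym H LU LS) -[ltRHS](divfK (lt0r_neq0 qy1)).
apply: (@le_lt_trans _ _ (q (S m x - U x) * (q y + 1))).
  by apply: ler_wpM2l; [exact: q_ge0|rewrite lerDl].
by rewrite ltr_pM2r // Nh.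
Qed.

End Truncation.

(** * Pulling back along a measure preserving map *)

Section Pullback.
Context {R : realType} {d d' : measure_display} {T : measurableType d}
  {T' : measurableType d'}.
Variables (mu : {measure set T -> \bar R}) (mu' : {measure set T' -> \bar R}) (pi : T -> T').
Hypotheses (mpi : measurable_fun setT pi)
  (push : forall A, measurable A -> mu (pi @^-1` A) = mu' A).
Local Notation C := (R[i]).

Lemma pull_int (f : T' -> \bar R) : measurable_fun setT f -> (forall t, 0 <= f t)%E ->
  (\int[mu']_t f t = \int[mu]_t f (pi t))%E.
Proof.
move=> mf f0; transitivity (\int[pushforward mu pi]_t f t)%E.
  by apply: eq_measure_integral => A mA _; rewrite -push.
by rewrite ge0_integral_pushforward.
Qed.

Lemma pull_L2 (k : T' -> C) : cmeasurable k -> L2 mu' k <-> L2 mu (k \o pi).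
Proof.
move=> mk; have e := pull_int ((measurable_EFinP _ _).2 (meas_normc2 mk))
  (fun t => ltac:(by rewrite lee_fin sqr_ge0)).
split=> -[_ fin]; split => //; first exact: (cmeas_comp mpi).
  by rewrite /= -e.
by rewrite e.
Qed.

Lemma pull_q (k : T' -> C) : cmeasurable k ->
  complex.Re (L2dot mu' k k) = complex.Re (L2dot mu (k \o pi) (k \o pi)).
Proof.
move=> mk; rewrite !qE /Rintegral; congr fine.
apply: (pull_int ((measurable_EFinP _ _).2 (meas_normc2 mk))) => t.
by rewrite lee_fin sqr_ge0.
Qed.

Lemma pull_ae (P : T' -> Prop) : (\forall t \ae mu', P t) -> \forall t \ae mu, P (pi t).
Proof.
move=> [N [mN N0 PN]]; exists (pi @^-1` N); split.
- by rewrite -[X in measurable X]setTI; exact: mpi.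
- by apply: etrans (push mN) _.
- by move=> t /= nP; exact: PN.
Qed.

Lemma pull_ae_inv (P : T' -> Prop) : measurable [set t | ~ P t] ->
  (\forall t \ae mu, P (pi t)) -> \forall t \ae mu', P t.
Proof.
move=> mP [N [mN N0 PN]]; exists [set t | ~ P t]; split => //.
apply: etrans (esym (push mP)) _; apply/eqP; rewrite -measure_le0 -N0.
apply: le_measure; rewrite ?inE //.
by rewrite -[X in measurable X]setTI; exact: mpi.
Qed.

Definition pullback : set (T -> C) :=
  [set x | L2 mu x /\ exists2 k, L2 mu' k & \forall t \ae mu, x t = k (pi t)].

Lemma pullback_L2 : pullback `<=` L2 mu. Proof. by move=> x []. Qed.

Lemma pullback_lin a x y : pullback x -> pullback y -> pullback (fun t => a * x t + y t).
Proof.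
move=> [Lx [k Lk xk]] [Ly [l Ll yl]]; split; first exact: L2_lin.
exists (fun t => a * k t + l t); first exact: L2_lin.
by apply: ae_imp2 xk yl => t -> ->.
Qed.

Lemma pullback_0 : pullback 0.
Proof.
by split; [exact: L2_0|exists (fun=> 0); [exact: L2_0|exact: aeW]].
Qed.

(** The subspace is closed because the functions it comes from form a
    complete space. *)
Lemma pullback_closed x : L2 mu x -> limit_point (L2dot mu) pullback x -> pullback x.
Proof.
move=> Lx lim; have H := L2_semi_hilbert mu; have H' := L2_semi_hilbert mu'.
split=> //.
have inv0 n : (0 : R) < n.+1%:R^-1 by rewrite invr_gt0.
have k n : {k | L2 mu' k & complex.Re (L2dot mu (k \o pi - x) (k \o pi - x)) < n.+1%:R^-1}.
  apply/cid2; have [y [Ly [k Lk yk]] yx] := lim _ (inv0 n); exists k => //.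
  have Lkpi := (pull_L2 Lk.1).1 Lk.
  have L1 := L2B Lkpi Lx; have L2' := L2B Ly Lx.
  rewrite (dot_ae L1 L2' L1 L2') //;
    by apply: ae_imp yk => t e1; change (k (pi t) - x t = y t - x t); rewrite e1.
pose u n := s2val (k n).
have Lu n : L2 mu' (u n) by rewrite /u; case: (k n).
have Lup n := (pull_L2 (Lu n).1).1 (Lu n).
have ux n : complex.Re (L2dot mu (u n \o pi - x) (u n \o pi - x)) < n.+1%:R^-1.
  by rewrite /u; case: (k n).
have small (e : R) : 0 < e -> exists N, forall n, (N <= n)%N -> (n.+1%:R^-1 : R) < e.
  move=> e0; exists (Num.truncn e^-1) => n Nn; rewrite invf_plt ?posrE //.
  by apply: lt_le_trans (truncnS_gt _) _; rewrite ler_nat.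
have [||l Ll ul] := sh_complete H' (u := u).
- exact: Lu.
- move=> e e0; have [N Nh] := small (e / 4) (divr_gt0 e0 (ltr0n _ 4)).
  exists N => m n Nm Nn; have Lmn := L2B (Lu m) (Lu n).
  rewrite (pull_q Lmn.1).
  have -> : (u m - u n) \o pi = (u m \o pi - x) - (u n \o pi - x).
    by apply/funext => t; change (u m (pi t) - u n (pi t)
      = (u m (pi t) - x t) - (u n (pi t) - x t)); ring.
  apply: le_lt_trans (qD_le H (L2B (Lup m) Lx) (shN H (L2B (Lup n) Lx))) _.
  rewrite (qN H (L2B (Lup n) Lx)).
  move: (ux m) (ux n) (Nh m Nm) (Nh n Nn); move: (m.+1%:R^-1 : R) (n.+1%:R^-1 : R) => i j.
  by rewrite !mulr2n; lra.
exists l => //; have Llp := (pull_L2 Ll.1).1 Ll.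
apply: q_sub0_ae => //; apply/le_anti; rewrite q_ge0 andbT.
apply/ler_addgt0Pr => e e0; rewrite add0r.
have e4 : 0 < e / 4 by exact: divr_gt0.
have [N Nh] := small _ e4; have [N' Nh'] := ul _ e4.
pose n := maxn N N'.
have h1 := ux n; have h2 := Nh n (leq_maxl N N'); have h3 := Nh' n (leq_maxr N N').
have Lul := L2B (Lu n) Ll; rewrite (pull_q Lul.1) in h3.
have -> : x - (fun t => l (pi t)) = - (u n \o pi - x) + ((u n - l) \o pi).
  by apply/funext => t; change (x t - l (pi t)
    = - (u n (pi t) - x t) + (u n (pi t) - l (pi t))); ring.
apply: le_trans (qD_le H (shN H (L2B (Lup n) Lx)) ((pull_L2 Lul.1).1 Lul)) _.
rewrite (qN H (L2B (Lup n) Lx)).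
by move: h1 h2 h3; move: (n.+1%:R^-1 : R) => i; rewrite !mulr2n; lra.
Qed.

End Pullback.

(** * Coefficients over a factor *)

Section FactorCoefficients.
Context {R : realType} {G : groupType} {dB : measure_display} {B : measurableType dB}.
Variables (nu : probability B R) (actB : G -> B -> B).
Context {dX : measure_display} {X : measurableType dX}.
Variables (xi : probability X R) (actX : G -> X -> X) (p : B -> X).
Hypotheses (countG : countable [set: G]) (nsB : nonsingular_space nu actB)
  (facX : factor_map nu actB xi actX p).
Local Notation C := (R[i]).
Local Notation GB := (discrete_group G * B)%type.
Local Notation GX := (discrete_group G * X)%type.
Local Notation mu := (crossed_measure G nu).
Local Notation muX := (crossed_measure G xi).
Local Notation opGB := (op R GB).
Local Notation F := (Linf_factor xi p).
Local Notation crossedX := (crossed_product nu actB F setT).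
Local Notation nsX := (factor_space facX).
Local Notation mp := (factor_measurable facX).
Local Notation pushp := (factor_push facX).

Lemma Linf_comp_factor f : Linf xi f -> Linf nu (f \o p).
Proof.
move=> [mf [c fc]]; split; first exact: (cmeas_comp mp mf).
by exists c; exact: (pull_ae mp pushp fc).
Qed.

Lemma factor_sub : F `<=` Linf nu.
Proof. by move=> _ [f Lf <-]; exact: Linf_comp_factor. Qed.

Lemma crossed_mono (E E' : set (B -> C)) (L L' : set G) : E `<=` E' -> L `<=` L' ->
  crossed_product nu actB E L `<=` crossed_product nu actB E' L'.
Proof.
move=> EE LL S SE M vM genM; apply: SE => // U [[f Ef <-]|[g Lg <-]].
  by apply: genM; left; exists f => //; exact: EE.
by apply: genM; right; exists g => //; exact: LL.
Qed.

Lemma crossedX_crossed S : crossedX S -> crossed_product nu actB (Linf nu) setT S.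
Proof. by apply: crossed_mono => //; exact: factor_sub. Qed.

Definition id_factor : GB -> GX := fun x => (x.1, p x.2).

Lemma measurable_id_factor : measurable_fun setT id_factor.
Proof.
apply: (measurable_fun_fibrewise countG) => h.
exact: (measurableT_comp (measurable_fiber_incl h) mp).
Qed.

Lemma push_id_factor (A : set GX) : measurable A ->
  mu (id_factor @^-1` A) = muX A.
Proof.
move=> mA; rewrite /crossed_measure /= /product_measure1.
apply: eq_integral => h _ /=; rewrite -pushp; last exact: measurable_xsection.
by congr (nu _); rewrite /xsection; apply/seteqP; split => b /=; rewrite !in_setE.
Qed.

Local Notation K := (pullback mu muX id_factor).
Local Notation P := (proj (L2_semi_hilbert mu) (@pullback_L2 _ _ _ _ _ mu muX id_factor)
  (@pullback_0 _ _ _ _ _ mu muX id_factor) (@pullback_lin _ _ _ _ _ mu muX id_factor)).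

Lemma mult_pullback f x : Linf xi f -> K x -> K (mult_op actB (f \o p) x).
Proof.
move=> Lf [Lx [k Lk xk]]; split.
  exact: (bounded_L2 (mult_bounded countG nsB (Linf_comp_factor Lf))).
exists (mult_op actX f k); first exact: (bounded_L2 (mult_bounded countG nsX Lf)).
have eqv : \forall t \ae mu, p (actB t.1 t.2) = actX t.1 (p t.2).
  by apply: (ae_fibers countG) => h /=; exact: (factor_equivariant facX).
by apply: ae_imp2 xk eqv => t e1 e2; rewrite /mult_op /= e1 e2.
Qed.

Lemma lambda_pullback g x : K x -> K (lambda g x).
Proof.
move=> [Lx [k Lk xk]]; split; first exact: (bounded_L2 (lambda_bounded nu countG g)).
exists (lambda g k); first exact: (bounded_L2 (lambda_bounded xi countG g)).
apply: (ae_fibers countG) => h.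
by apply: ae_imp (@ae_fiber _ _ _ _ nu _ (g^-1 * h)%g xk) => b.
Qed.

(** The projection onto the functions that factor through [X] commutes with the
    generators, hence with every element of the crossed product. *)
Lemma crossedX_proj S : crossedX S -> commute mu S P.
Proof.
have adjP : adj_closed mu [set P].
  by move=> _ ->; split; [exact: proj_bounded|exists P => //; exact: proj_adjoint].
suff : crossedX `<=` commutant mu [set P] by move=> h /h[_]; apply.
rewrite /crossed_product; apply: (vN_generated_sub (commutant_vN adjP)).
move=> {}S [[_ [f Lf <-] <-]|[g _ <-]].
  have Lfp := Linf_comp_factor Lf.
  have bS := mult_bounded countG nsB Lfp; split => // _ ->.
  apply: (proj_commute _ _ _ bS (mult_bounded countG nsB (LinfJ Lfp))
    (mult_adjoint countG nsB Lfp)).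
    by move=> k; exact: mult_pullback.
  by move=> k; apply: (mult_pullback (LinfJ Lf)).
have bS := lambda_bounded nu countG g; split => // _ ->.
apply: (proj_commute _ _ _ bS (lambda_bounded nu countG g^-1%g)
  (@lambda_adjoint _ _ _ _ nu countG g)).
  by move=> k; exact: lambda_pullback.
by move=> k; exact: lambda_pullback.
Qed.

Lemma delta_pullback k : K (delta k).
Proof.
split; first exact: delta_L2.
by exists (delta k); [exact: delta_L2|exact: aeW].
Qed.

(** The coefficient is read off [S (delta g^-1)], which factors through [X]
    because [delta g^-1] does and [S] commutes with the projection. *)
Lemma factor_coef S g : crossedX S ->
  exists2 f, Linf xi f & \forall b \ae nu, coef S g b = f (p b).
Proof.
move=> cS; have cB := crossedX_crossed cS.
have bS := crossed_bounded countG nsB cB.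
have Kd := delta_pullback g^-1%g; have Ld := pullback_L2 Kd.
have LSd := bounded_L2 bS Ld.
have PD x : L2 mu x -> L2 mu (P x) by exact: proj_D.
have Pd := q_sub0_ae (PD _ Ld) Ld (proj_fix (L2_semi_hilbert mu) _ _ _ Kd).
have h1 := bounded_ae bS (PD _ Ld) Ld Pd.
have /op_eqP /(_ _ Ld) /= h2 := crossedX_proj cS.
have [_ lim _] := projP (L2_semi_hilbert mu) (@pullback_L2 _ _ _ _ _ mu muX id_factor)
  (@pullback_0 _ _ _ _ _ mu muX id_factor) (@pullback_lin _ _ _ _ _ mu muX id_factor) LSd.
have [_ [k Lk Pk]] := pullback_closed measurable_id_factor push_id_factor (PD _ LSd) lim.
have Sk : \forall t \ae mu, S (delta g^-1%g) t = k (id_factor t).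
  by apply: ae_imp2 (ae_andP h1 h2) Pk => t [<- ->].
pose f x := k (1%g, x).
have mf : cmeasurable f by exact: cmeas_fiber Lk.1.
have cf : \forall b \ae nu, coef S g b = f (p b).
  by apply: ae_imp (@ae_fiber _ _ _ _ nu _ 1%g Sk) => b e; rewrite coefE e.
exists f => //; split => //.
have [_ [c Sc]] := coef_Linf countG nsB g cB.
exists c; apply: (pull_ae_inv mp pushp).
  have mb : measurable_fun setT (fun x => normc (f x) <= c).
    by apply: measurable_fun_ler => //; exact: meas_normc.
  rewrite (_ : [set t | ~ normc (f t) <= c] = (fun x => normc (f x) <= c) @^-1` [set false]).
    by rewrite -[X in measurable X]setTI; exact: mb.
  by apply/seteqP; split => x /=; [move=> /negP/negbTE|move=> ->].
by apply: ae_imp2 cf Sc => b ->.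
Qed.

End FactorCoefficients.

(** * Diagonal elements and states on multiplication operators *)

Section Diagonal.
Context {R : realType} {G : groupType} {d : measure_display} {B : measurableType d}.
Variables (nu : probability B R) (act : G -> B -> B).
Hypotheses (countG : countable [set: G]) (ns : nonsingular_space nu act).
Local Notation C := (R[i]).
Local Notation GB := (discrete_group G * B)%type.
Local Notation mu := (crossed_measure G nu).
Local Notation L2 := (L2 mu).
Local Notation dot := (L2dot mu).
Local Notation q x := (complex.Re (dot x x)).
Local Notation opGB := (op R GB).
Local Notation crossed := (crossed_product nu act (Linf nu) setT).
Local Notation mult := (mult_op act).

(** Commuting with the projections [dproj k] kills all entries off the diagonal. *)
Lemma crossed_diag S : crossed S ->
  (forall k, commute mu S (dproj k)) <-> op_eq mu S (mult_op act (coef S 1%g)).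
Proof.
move=> cS; have bS := crossed_bounded countG ns cS; have Lf := coef_Linf countG ns 1%g cS.
have bf := mult_bounded countG ns Lf; split => [SD|Sf k].
  apply: (bounded_ext countG bS bf) => k x Lx.
  have Ldx := dproj_L2 countG k Lx.
  have dd : dproj k (dproj k x) = dproj k x.
    by apply/funext => t; rewrite /dproj /mulop; case: (t.1 == k); rewrite ?mul1r ?mul0r.
  have /op_eqP /(_ _ Ldx) /= h := SD k; rewrite dd in h.
  apply: ae_imp2 h (crossed_symbol countG ns k cS Lx) => -[h b] /= e1 e2.
  rewrite e1 /dproj /mulop /mult_op /= e2; case: eqP => [->|_]; last by rewrite !mul0r mulr0.
  by rewrite mulgV !mul1r.
have bD := dproj_bounded nu countG k.
have h1 := op_eq_comp bS bD bD Sf (@op_eq_refl _ _ _ mu (dproj k)).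
have h2 : op_eq mu (mult (coef S 1%g) \o dproj k) (dproj k \o mult (coef S 1%g)).
  by apply: op_eqW => x t; rewrite /dproj /mulop /mult_op /= mulrCA.
have h3 := op_eq_comp bD bf bS (@op_eq_refl _ _ _ mu (dproj k)) (op_eq_sym Sf).
exact: op_eq_trans h1 (op_eq_trans h2 h3).
Qed.

Lemma multM (f g : B -> C) : mult f \o mult g = mult (fun b => f b * g b).
Proof. by apply/funext => x; apply/funext => t; rewrite /mult_op /= mulrA. Qed.

Lemma mult_lin a (f g : B -> C) :
  op_lin a (mult f) (mult g) = mult (fun b => a * f b + g b).
Proof. by apply/funext => x; apply/funext => t; rewrite /mult_op /op_lin; ring. Qed.

Lemma mult1 : mult (fun=> 1 : C) = (idfun : opGB).
Proof. by apply/funext => x; apply/funext => t; rewrite /mult_op mul1r. Qed.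

Lemma mult_ae (f g : B -> C) : (\forall b \ae nu, f b = g b) ->
  op_eq mu (mult f) (mult g).
Proof.
move=> fg; apply/op_eqP => x Lx; apply: (ae_fibers countG) => h.
by apply: ae_imp (ns_ae ns h fg) => b e; rewrite /mult_op /= e.
Qed.

Lemma Linf_real (x : B -> R) (c : R) : measurable_fun setT x ->
  (forall b, `|x b| <= c) -> Linf nu (fun b => (x b)%:C).
Proof.
move=> mx xc; split; first exact: cmeas_real.
by exists c; apply: aeW => b; rewrite normc_real.
Qed.

Lemma mult_norm (f : B -> C) (c : R) : cmeasurable f -> (forall b, normc (f b) <= c) ->
  0 <= c -> op_norm_le mu (mult f) c.
Proof.
move=> mf fc c0; have Lf : Linf nu f by split => //; exists c; exact: aeW.
apply/op_norm_leP => // [x|x Lx]; first exact: (bounded_L2 (mult_bounded countG ns Lf)).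
have [] // := @mulop_q _ _ _ mu (fun t : GB => f (act t.1 t.2)) c x (Linf_mult countG ns Lf).1 _ Lx.
exact: aeW.
Qed.

Section States.
Variable A : set opGB.
Hypotheses (cA : cstar_algebra mu A) (AC : A `<=` crossed)
  (Adiag : forall S, A S -> op_eq mu S (mult (coef S 1%g))).

Lemma cstar_op_eq S U : A S -> bounded_op mu U -> op_eq mu S U -> A U.
Proof.
move=> AS bU SU; apply: cA.2 => // e e0; exists S => // x Lx.
have bS := star_bounded cA.1 AS.
have Z : \forall t \ae mu, op_lin (-1) S U x t = 0.
  by move/op_eqP : SU => /(_ x Lx); apply: ae_imp => t; rewrite /op_lin => ->; rewrite mulN1r addNr.
have LZ : L2 (op_lin (-1) S U x) by exact: (bounded_L2 (bounded_op_lin (-1) bS bU)).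
have : L2norm mu (op_lin (-1) S U x) ^+ 2 = 0 by rewrite -q_norm q_ae0.
move=> /eqP; rewrite sqrf_eq0 => /eqP ->.
by rewrite mulr_ge0 ?L2norm_ge0 // ltW.
Qed.

(** The fixed point of [z = (x + z ^ 2) / 2] is [1 - sqrt (1 - x)]; the
    iteration converges uniformly when [|x| <= 3/4], which makes
    [sqrt (1 - x)] a norm limit of polynomials in [x]. *)
Lemma cstar_sqrt (x : B -> R) : measurable_fun setT x -> (forall b, `|x b| <= 3 / 4) ->
  A (mult (fun b => (x b)%:C)) -> A (mult (fun b => (Num.sqrt (1 - x b))%:C)).
Proof.
move=> mx x34 Ax; have sA := cA.1.
pose z b := 1 - Num.sqrt (1 - x b).
have x_ge b : 0 <= 1 - x b by have := x34 b; rewrite ler_norml; lra.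
have zb b : `|z b| <= 2^-1.
  have h1 : 2^-1 <= Num.sqrt (1 - x b).
    rewrite -(@ler_pXn2r _ 2) ?nnegrE ?sqrtr_ge0 ?invr_ge0 // sqr_sqrtr //.
    by have := x34 b; rewrite ler_norml expr2; lra.
  have h2 : Num.sqrt (1 - x b) <= 3 / 2.
    rewrite -(@ler_pXn2r _ 2) ?nnegrE ?sqrtr_ge0 ?divr_ge0 // sqr_sqrtr //.
    by have := x34 b; rewrite ler_norml expr2; lra.
  by rewrite /z ler_norml; move: h1 h2; move: (Num.sqrt _) => r; lra.
have zfix b : z b = (x b + z b ^+ 2) / 2.
  by have := sqr_sqrtr (x_ge b); rewrite /z; move: (Num.sqrt _) => r e;
    rewrite sqrrB e expr1n mul1r mulr2n; field.
pose fix it n : B -> R := if n is m.+1 then fun b => (x b + it m b ^+ 2) / 2 else fun=> 0.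
have itb n b : `|it n b| <= 2^-1.
  elim: n => [|n IH] /=; first by rewrite normr0 invr_ge0.
  rewrite normrM (ger0_norm (_ : 0 <= 2^-1)) ?invr_ge0 // ler_pdivrMr // mulVf //.
  apply: le_trans (ler_normD _ _) _; rewrite normrX.
  have h : `|it n b| ^+ 2 <= 4^-1.
    have -> : 4^-1 = 2^-1 ^+ 2 :> R by rewrite exprVn -natrX.
    by rewrite ler_pXn2r ?nnegrE ?invr_ge0.
  by have := x34 b; move: h; lra.
have itz n b : `|it n b - z b| <= 2^-1 ^+ n.
  elim: n => [|n IH] /=.
    by rewrite sub0r normrN expr0; have := zb b; lra.
  have -> : (x b + it n b ^+ 2) / 2 - z b = (it n b - z b) * ((it n b + z b) / 2).
    by rewrite {1}zfix; field.
  rewrite normrM exprSr; apply: ler_pM => //.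
  rewrite normrM (ger0_norm (_ : 0 <= 2^-1)) ?invr_ge0 // ler_pdivrMr // mulVf //.
  by apply: le_trans (ler_normD _ _) _; have := itb n b; have := zb b; lra.
have mit n : measurable_fun setT (it n).
  elim: n => [|n IH] /=; first exact: measurable_cst.
  apply: measurable_funM => //; apply: measurable_funD => //.
  exact: measurable_funX.
have mz : measurable_fun setT z.
  apply: measurable_funB; first exact: measurable_cst.
  apply: (measurableT_comp (f := @Num.sqrt R)).
    by apply: continuous_measurable_fun; exact: sqrt_continuous.
  by apply: measurable_funB => //; exact: measurable_cst.
have A0 : A (mult (fun=> 0 : C)).
  have -> : mult (fun=> 0 : C) = op_lin (-1) idfun idfun.
    by apply/funext => y; apply/funext => t; rewrite /mult_op /op_lin mul0r mulN1r addNr.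
  exact: (star_lin sA _ (star_one sA) (star_one sA)).
have Ait n : A (mult (fun b => (it n b)%:C)).
  elim: n => [|n IH]; first exact: A0.
  have := star_lin sA (2^-1 : R)%:C Ax (star_lin sA (2^-1 : R)%:C (star_comp sA IH IH) A0).
  rewrite multM !mult_lin; congr (A (mult _)); apply/funext => b.
  by apply: eq_ReIm => /=; field.
have Az : A (mult (fun b => (z b)%:C)).
  apply: cA.2 => [|e e0]; first exact: (mult_bounded countG ns (Linf_real mz zb)).
  have [n ne] : exists n, (2^-1 ^+ n : R) < e.
    have := @cvg_geometric R 1 2^-1.
    rewrite ger0_norm ?invr_ge0 // invf_lt1 ?ltr1n // => /(_ isT) /cvgr_lt /(_ _ e0).
    by case=> k _ h; exists k; have := h k (leqnn k); rewrite /= mul1r.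
  exists (mult (fun b => (it n b)%:C)) => // y Ly; rewrite mult_lin.
  apply: le_trans (mult_norm (c := 2^-1 ^+ n) _ _ _ Ly) _.
  - apply: cmeasD; last exact: cmeas_real.
    by apply: cmeasM; [exact: cmeas_cst|exact: cmeas_real].
  - move=> b; have -> : -1 * (it n b)%:C + (z b)%:C = (z b - it n b)%:C.
      by apply: eq_ReIm => /=; ring.
    by rewrite normc_real distrC.
  - by rewrite exprn_ge0 ?invr_ge0.
  - by rewrite ler_wpM2r ?L2norm_ge0 // ltW.
have := star_lin sA (-1) Az (star_one sA); rewrite -mult1 mult_lin.
congr (A (mult _)); apply/funext => b.
by apply: eq_ReIm => /=; rewrite /z; ring.
Qed.

Variable tau : opGB -> C.
Hypothesis tau_state : is_state mu A tau.

Lemma state_le1 (x : B -> R) : measurable_fun setT x -> (forall b, `|x b| <= 3 / 4) ->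
  A (mult (fun b => (x b)%:C)) -> 0 <= 1 - tau (mult (fun b => (x b)%:C)).
Proof.
move=> mx x34 Ax; pose y b := Num.sqrt (1 - x b).
have Ay : A (mult (fun b => (y b)%:C)) by exact: cstar_sqrt.
have x_ge b : 0 <= 1 - x b by have := x34 b; rewrite ler_norml; lra.
have my : measurable_fun setT y.
  apply: (measurableT_comp (f := @Num.sqrt R)).
    by apply: continuous_measurable_fun; exact: sqrt_continuous.
  by apply: measurable_funB => //; exact: measurable_cst.
have Ly : Linf nu (fun b => (y b)%:C).
  apply: (@Linf_real y 2 my) => b; rewrite ger0_norm ?sqrtr_ge0 //.
  rewrite -(@ler_pXn2r _ 2) ?nnegrE ?sqrtr_ge0 // sqr_sqrtr //.
  by have := x34 b; rewrite ler_norml expr2; lra.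
have adj : adjoint mu (mult (fun b => (y b)%:C)) (mult (fun b => (y b)%:C)).
  have := mult_adjoint countG ns Ly.
  by rewrite (_ : (fun b => ((y b)%:C)^*) = fun b => (y b)%:C) //; apply/funext => b; exact: conjcr.
have := state_pos tau_state Ay Ay adj.
have sA := cA.1.
have -> : mult (fun b => (y b)%:C) \o mult (fun b => (y b)%:C)
    = op_lin (-1) (mult (fun b => (x b)%:C)) idfun.
  rewrite multM -mult1 mult_lin; congr mult; apply/funext => b.
  have := sqr_sqrtr (x_ge b); rewrite -/(y b) expr2 => e.
  by apply: eq_ReIm => /=; [rewrite -[RHS]addrC; move: e; lra|ring].
rewrite (state_lin tau_state) ?(state_one tau_state) //; last exact: star_one sA.
by rewrite mulN1r addrC.
Qed.

Lemma state_scale a S : A S -> tau (op_lin (a - 1) S S) = a * tau S.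
Proof. by move=> AS; rewrite (state_lin tau_state) //; ring. Qed.

(** Both [1 - x] and [1 + x] are squares of selfadjoint elements. *)
Lemma state_real_bound (x : B -> R) : measurable_fun setT x -> (forall b, `|x b| <= 3 / 4) ->
  A (mult (fun b => (x b)%:C)) -> normc (tau (mult (fun b => (x b)%:C))) <= 1.
Proof.
move=> mx x34 Ax; have h1 := state_le1 mx x34 Ax.
have ANx : A (mult (fun b => (- x b)%:C)).
  have := star_lin cA.1 (- 1 - 1) Ax Ax; rewrite mult_lin; congr (A (mult _)).
  by apply/funext => b; apply: eq_ReIm => /=; ring.
have Nx34 b : `|(\- x) b| <= 3 / 4 by rewrite /= normrN; exact: x34.
have h2 := state_le1 (measurable_funN mx) Nx34 ANx.
have e : tau (mult (fun b => (- x b)%:C)) = - tau (mult (fun b => (x b)%:C)).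
  rewrite -mulN1r -(state_scale _ Ax) mult_lin; congr (tau (mult _)).
  by apply/funext => b; apply: eq_ReIm => /=; ring.
move: h1 h2; rewrite e; case: (tau _) => u v.
rewrite !lecE /= => /andP[/eqP v0 h1] /andP[_ h2].
have -> : v = 0 by move: v0; lra.
by rewrite expr0n /= addr0 sqrtr_sqr ler_norml; move: h1 h2; lra.
Qed.

(** States are norm continuous. The real and imaginary parts of the coefficient
    of [S] are rescaled to lie between -1/2 and 1/2, where the bound for real
    functions applies. *)
Lemma state_bound S (c : R) : A S -> 0 < c -> op_norm_le mu S c ->
  normc (tau S) <= 4 * c.
Proof.
move=> AS c0 Sc; have sA := cA.1; have bS := star_bounded sA AS.
have cS := AC AS; pose f := coef S 1%g; have Lf : Linf nu f := coef_Linf countG ns 1%g cS.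
have fc : \forall b \ae nu, normc (f b) <= c.
  apply: (coef_bound countG ns 1%g cS (ltW c0)).
  by apply/(op_norm_leP (ltW c0)) => // x; exact: bounded_L2.
have bf := mult_bounded countG ns Lf.
have SF := Adiag AS.
have Af : A (mult f) by exact: cstar_op_eq SF.
have AfJ : A (mult (fun b => (f b)^*)).
  by apply: (star_adj sA Af (mult_bounded countG ns (LinfJ Lf))); exact: mult_adjoint.
(* The coefficient is bounded by [c] almost everywhere only; the truncation
   provides bounds at every point. *)
pose cut (u : R) := if `|u| <= c then u / (2 * c) else 0.
have cut34 u : `|cut u| <= 3 / 4.
  rewrite /cut; case: ifP => [uc|_]; last by rewrite normr0.
  rewrite normrM normfV (ger0_norm (_ : 0 <= 2 * c)); last by lra.
  by rewrite ler_pdivrMr; lra.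
have mcut (v : B -> R) : measurable_fun setT v -> measurable_fun setT (cut \o v).
  move=> mv; apply: measurable_fun_ifT.
  - apply: measurable_fun_ler; last exact: measurable_cst.
    exact: measurableT_comp.
  - by apply: measurable_funM => //; exact: measurable_cst.
  - exact: measurable_cst.
pose x b := cut (complex.Re (f b)); pose y b := cut (complex.Im (f b)).
have mx : measurable_fun setT x by exact: (mcut _ Lf.1.1).
have my : measurable_fun setT y by exact: (mcut _ Lf.1.2).
have xE : \forall b \ae nu, complex.Re (f b) = 2 * c * x b.
  apply: ae_imp fc => b fb; rewrite /x /cut (le_trans (abs_Re_normc _) fb).
  by field; rewrite gt_eqF.
have yE : \forall b \ae nu, complex.Im (f b) = 2 * c * y b.
  apply: ae_imp fc => b fb; rewrite /y /cut (le_trans (abs_Im_normc _) fb).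
  by field; rewrite gt_eqF.
have Lx := Linf_real mx (fun b => cut34 _); have Ly := Linf_real my (fun b => cut34 _).
have Ax : A (mult (fun b => (x b)%:C)).
  pose a : C := ((4 * c)^-1)%:C.
  have := star_lin sA a Af (star_lin sA (a - 1) AfJ AfJ); rewrite !mult_lin => h.
  apply: cstar_op_eq h (mult_bounded countG ns Lx) _.
  apply: mult_ae; apply: ae_imp xE => b; case: (f b) => u v /= ->.
  by apply: eq_ReIm => /=; field; rewrite gt_eqF.
have Ay : A (mult (fun b => (y b)%:C)).
  pose a : C := 0 +i* (- (4 * c)^-1).
  have := star_lin sA a Af (star_lin sA (- a - 1) AfJ AfJ); rewrite !mult_lin => h.
  apply: cstar_op_eq h (mult_bounded countG ns Ly) _.
  apply: mult_ae; apply: ae_imp yE => b; case: (f b) => u v /= ->.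
  by apply: eq_ReIm => /=; field; rewrite gt_eqF.
have tx := state_real_bound mx (fun b => cut34 _) Ax.
have ty := state_real_bound my (fun b => cut34 _) Ay.
pose a1 : C := (2 * c)%:C; pose a2 : C := 0 +i* (2 * c).
have A2 := star_lin sA (a2 - 1) Ay Ay; have A1 := star_lin sA a1 Ax A2.
have -> : tau S = a1 * tau (mult (fun b => (x b)%:C)) + a2 * tau (mult (fun b => (y b)%:C)).
  rewrite -(state_scale a2 Ay) -(state_lin tau_state) //.
  apply: (state_eq tau_state) => //; apply: op_eq_trans SF _; rewrite !mult_lin.
  apply: mult_ae; apply: ae_imp2 xE yE => b; rewrite -/f /a1 /a2; case: (f b) => u v /= -> ->.
  by apply: eq_ReIm => /=; ring.
apply: le_trans (le_normcD _ _) _; rewrite !normcM.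
have -> : normc a1 = 2 * c by rewrite normc_real ger0_norm //; lra.
have -> : normc a2 = 2 * c.
  by rewrite /= expr0n /= add0r sqrtr_sqr ger0_norm //; lra.
have c2 : 0 <= 2 * c by lra.
have := ler_wpM2l c2 tx; have := ler_wpM2l c2 ty; lra.
Qed.

End States.

End Diagonal.

(** * Singular expectations on diagonal algebras separate the orbits *)

Section Separation.
Context {R : realType} {G : groupType} {d : measure_display} {B : measurableType d}.
Variables (nu : probability B R) (act : G -> B -> B).
Hypotheses (countG : countable [set: G]) (ns : nonsingular_space nu act).
Local Notation C := (R[i]).
Local Notation GB := (discrete_group G * B)%type.
Local Notation mu := (crossed_measure G nu).
Local Notation L2 := (L2 mu).
Local Notation dot := (L2dot mu).
Local Notation q x := (complex.Re (dot x x)).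
Local Notation opGB := (op R GB).
Local Notation crossed := (crossed_product nu act (Linf nu) setT).
Local Notation mult := (mult_op act).
Local Notation E := canonical_expectation.

Lemma ae_forallG (P : G -> B -> Prop) : (forall g, \forall b \ae nu, P g b) ->
  \forall b \ae nu, forall g, P g b.
Proof.
move=> aeP; have [e einj] := group_enum countG.
have h : \forall b \ae nu, forall n g, e g = n -> P g b.
  apply: ae_foralln => n.
  have [[g eg]|nog] := pselect (exists g, e g = n); last first.
    by apply: aeW => b g eg; exfalso; apply: nog; exists g.
  by apply: ae_imp (aeP g) => b Pg g' eg'; rewrite (einj g' g) // eg' eg.
by apply: ae_imp h => b h g; exact: (h (e g)).
Qed.

Lemma conj_norm g S (c : R) : bounded_op mu S -> 0 <= c -> op_norm_le mu S c ->
  op_norm_le mu (conj_op g S) c.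
Proof.
move=> bS c0 Sc x Lx.
have [L1 q1] := lambda_L2 countG g^-1%g Lx.
have [_ q2] := lambda_L2 countG g (bounded_L2 bS L1).
have iso (y z : GB -> C) : q y <= 1 * q z -> L2norm mu y <= L2norm mu z.
  by rewrite mul1r !q_norm ler_pXn2r ?nnegrE ?L2norm_ge0.
apply: le_trans (iso _ _ q2) _; apply: le_trans (Sc _ L1) _.
by apply: ler_wpM2l => //; exact: iso.
Qed.

Lemma conj_bounded g S : bounded_op mu S -> bounded_op mu (conj_op g S).
Proof.
move=> bS; have b1 := lambda_bounded nu countG g; have b2 := lambda_bounded nu countG g^-1%g.
exact: bounded_comp (bounded_comp b1 bS) b2.
Qed.

(** Singular states take different values at some element of the algebra, hence,
    by continuity, at some term of a norm dense sequence. *)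
Lemma singular_separates (N : set opGB) : N `<=` crossed ->
  (forall S, N S -> op_eq mu S (mult (coef S 1%g))) ->
  expectation_singular nu act N ->
  exists2 D : nat -> opGB, (forall n, N (D n)) &
    \forall b \ae nu, forall s, s != 1%g -> exists n, E (D n) b <> E (D n) (act s b).
Proof.
move=> NC Ndiag [A [theta [[cA AN _ invA [D AD dense]] [st _ equi expect] sing]]].
exists D => [n|]; first exact: AN.
have AC : A `<=` crossed by move=> S /AN /NC.
have Adiag S : A S -> op_eq mu S (mult (coef S 1%g)) by move=> /AN /Ndiag.
have ED : \forall b \ae nu, forall n, E (D n) b = theta b (D n).
  by apply: ae_foralln => n; have /ae_eqP := expect _ (AD n).
have EDs : \forall b \ae nu, forall g n, E (D n) (act g b) = theta (act g b) (D n).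
  by apply: ae_forallG => g; exact: (ns_ae ns g ED).
have equi' := ae_forallG equi.
apply: ae_imp2 (ae_andP ED EDs) (ae_andP equi' sing) => b [e1 e2] [e3 e4] s s1.
apply: contrapT => same.
have agree n : theta b (conj_op s^-1%g (D n)) = theta b (D n).
  rewrite -e3 // -e2 -e1; apply: contrapT => ne; apply: same; exists n.
  by move=> e; apply: ne.
have [I [F [a [pF aA lim1 lim0]]]] := e4 s s1.
(* If all the terms of the dense sequence agreed, approximating [a i] within
   [k / 4] would place 1 within [4 k] of 0, against [16 k = 1]. *)
pose k : R := 16^-1; have k0 : 0 < k by rewrite invr_gt0.
have kC : 0 < k%:C :> C by rewrite ltcR.
move/cvgrPdist_lt : lim1 => /(_ _ kC) lim1; move/cvgrPdist_lt : lim0 => /(_ _ kC) lim0.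
have [i [i1 i0]] : exists i, `|1 - theta b (conj_op s^-1%g (a i))| < k%:C /\
    `|0 - theta b (a i)| < k%:C.
  by have [i h] := @filter_ex _ F _ _ (filterI lim1 lim0); exists i.
have {}i1 : normc (1 - theta b (conj_op s^-1%g (a i))) < k by rewrite -ltcR.
have {}i0 : normc (theta b (a i)) < k by move: i0; rewrite sub0r normrN -ltcR.
have [Aai _] := aA i.
have e0 : 0 < k / 4 by rewrite divr_gt0.
have [n nc] := dense _ (k / 4) Aai e0.
have sA := cA.1.
have Ad : A (op_lin (-1) (D n) (a i)) by exact: (star_lin sA).
have bd := star_bounded sA Ad.
have h1 := state_bound countG ns cA AC Adiag (st b) Ad e0 nc.
have Acd : A (conj_op s^-1%g (op_lin (-1) (D n) (a i))) by exact: invA.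
have h2 := state_bound countG ns cA AC Adiag (st b) Acd e0 (conj_norm _ bd (ltW e0) nc).
have t1 := state_lin (st b) (-1) (AD n) Aai.
have t2 : theta b (conj_op s^-1%g (op_lin (-1) (D n) (a i)))
    = -1 * theta b (conj_op s^-1%g (D n)) + theta b (conj_op s^-1%g (a i)).
  by apply: (state_lin (st b) (-1)); exact: invA.
rewrite t1 in h1; rewrite t2 agree in h2.
move: h1 h2 i0 i1; set u := theta b (D n); set v := theta b (a i).
set w := theta b (conj_op s^-1%g (a i)) => h1 h2 h3 h4.
have : normc (1 : C) <= normc (1 - w) + normc (-1 * u + w) + (normc (-1 * u + v) + normc v).
  rewrite [X in normc X <= _](_ : 1 = (1 - w) + (-1 * u + w) + (- (-1 * u + v) + v));
    last by ring.
  have tri (y z : C) : normc (y + z) <= normc y + normc z by exact: le_normcD.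
  apply: le_trans (tri _ _) _; apply: lerD; first exact: tri.
  by apply: le_trans (tri _ _) _; rewrite normcN.
rewrite normc1.
have k16 : k * 16 = 1 by rewrite mulVf.
by move: h1 h2 h3 h4 k16; rewrite (mulrC 4) divfK //; lra.
Qed.

End Separation.

(** * The Fourier components of an intermediate algebra *)

(** The half planes [Re < r] and [Im < r] with [r] rational separate the points
    of the complex plane. The values 1 and -1, instead of 0 and 1, make the
    multiplication operators unitary. *)
Lemma sign_sequence (R : realType) (d : measure_display) (X : measurableType d)
    (k : nat -> X -> R[i]) : (forall n, cmeasurable (k n)) ->
  exists u : nat -> X -> R, [/\ forall m, measurable_fun setT (u m),
    forall m x, u m x = 1 \/ u m x = -1 &
    forall x y, (exists n, k n x <> k n y) -> exists m, u m x <> u m y].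
Proof.
move=> mk.
pose part (c : bool) : R[i] -> R := if c then @complex.Re R else @complex.Im R.
pose v (i : nat * bool * rat) x : R :=
  if part i.1.2 (k i.1.1 x) < ratr i.2 then 1 else -1.
pose u m x : R := if unpickle m is Some i then v i x else 1.
have upm m x : u m x = 1 \/ u m x = -1.
  by rewrite /u /v; case: unpickle => [i|]; [case: ifP; [left|right]|left].
exists u; split => // [m|x y [n kn]].
  rewrite /u; case: unpickle => [[[n c] r]|]; last exact: measurable_cst.
  apply: measurable_fun_ifT; [|exact: measurable_cst|exact: measurable_cst].
  apply: measurable_fun_ltr; last exact: measurable_cst.
  by case: c; [exact: (mk n).1|exact: (mk n).2].
have sep (c : bool) x' y' : part c (k n x') < part c (k n y') -> exists m, u m x' <> u m y'.
  move=> /rat_in_itvoo[r]; rewrite in_itv /= => /andP[r1 r2].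
  exists (pickle (n, c, r)); rewrite /u pickleK /v /= r1 ltNge (ltW r2) /=.
  by move=> /eqP; rewrite -subr_eq0 opprK -mulr2n pnatr_eq0.
have differ : exists c, part c (k n x) <> part c (k n y).
  apply: contrapT => same; apply: kn.
  by apply: eq_ReIm; apply: contrapT => ne; apply: same; [exists true|exists false].
have [c /eqP] := differ; rewrite neq_lt => /orP[/sep//|/sep[m um]].
by exists m => e; apply: um.
Qed.

Section FourierComponents.
Context {R : realType} {G : groupType} {dB : measure_display} {B : measurableType dB}.
Variables (nu : probability B R) (actB : G -> B -> B).
Context {dX : measure_display} {X : measurableType dX}.
Variables (xi : probability X R) (actX : G -> X -> X) (p : B -> X).
Hypotheses (countG : countable [set: G]) (nsB : nonsingular_space nu actB)
  (facX : factor_map nu actB xi actX p).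
Local Notation C := (R[i]).
Local Notation GB := (discrete_group G * B)%type.
Local Notation mu := (crossed_measure G nu).
Local Notation L2 := (L2 mu).
Local Notation dot := (L2dot mu).
Local Notation q x := (complex.Re (dot x x)).
Local Notation opGB := (op R GB).
Local Notation F := (Linf_factor xi p).
Local Notation crossedX := (crossed_product nu actB F setT).
Local Notation crossed := (crossed_product nu actB (Linf nu) setT).
Local Notation mult := (mult_op actB).
Local Notation H := (L2_semi_hilbert mu).
Local Notation nsX := (factor_space facX).
Local Notation mp := (factor_measurable facX).

Variable M : set opGB.
Hypotheses (vnM : vN_algebra mu M) (subM : mult @` F `<=` M)
  (Msub : M `<=` crossedX).

Lemma M_crossed : M `<=` crossed.
Proof. by move=> S /Msub; exact: (crossedX_crossed facX). Qed.

Lemma M_mult f : Linf xi f -> M (mult (f \o p)).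
Proof. by move=> Lf; apply: subM; exists (f \o p) => //; exists f. Qed.

Lemma M_coef S g : M S ->
  exists2 f, Linf xi f & \forall b \ae nu, coef S g b = f (p b).
Proof. by move=> /Msub; exact: (factor_coef countG nsB facX). Qed.

Definition separating (u : nat -> X -> R) : Prop :=
  \forall b \ae nu, forall s, s != 1%g -> exists m, u m (p b) <> u m (p (actB s b)).

(** Averaging [S] with its conjugates by the functions [u m] with values
    [1] and [-1] multiplies the coefficient of [lambda h] by the indicator
    functions of the sets where [u m x = u m (g h^-1 x)]; a separating sequence
    leaves in the limit the coefficient of [lambda g] alone. *)
Lemma fourier_component (u : nat -> X -> R) S g f :
  (forall m, measurable_fun setT (u m)) -> (forall m x, u m x = 1 \/ u m x = -1) ->
  separating u -> M S -> Linf xi f -> (\forall b \ae nu, coef S g b = f (p b)) ->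
  M (mult (f \o p) \o @lambda R G dB B g).
Proof.
move=> mu_ upm sepu MS Lf Sf; have cS := M_crossed MS; have bS := vN_bounded vnM MS.
have [c c0 Sc] := bounded_q bS.
have Lfp := Linf_comp_factor facX Lf.
have bU : bounded_op mu (mult (f \o p) \o @lambda R G dB B g).
  exact: bounded_comp (mult_bounded countG nsB Lfp) (lambda_bounded nu countG g).
pose uC m x : C := (u m x)%:C.
have nuC m x : normc (uC m x) = 1.
  by rewrite normc_real; case: (upm m x) => ->; rewrite ?normrN normr1.
have LuC m : Linf xi (uC m).
  by split; [exact: cmeas_real|exists 1; apply: aeW => x; rewrite nuC].
have LvC m : Linf xi (uC m \o actX g) by exact: (Linf_act nsX).
pose um m := mult (uC m \o p); pose vm m := mult ((uC m \o actX g) \o p).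
have Mum m : M (um m) by exact: M_mult.
have Mvm m : M (vm m) by exact: M_mult.
pose T m W : opGB := (um m \o W) \o vm m.
pose step m W : opGB := op_lin (2^-1) W (op_lin (2^-1 - 1) (T m W) (T m W)).
pose Sm := fix Sm n : opGB := if n is m.+1 then step m (Sm m) else S.
have MT m W : M W -> M (T m W).
  by move=> MW; apply: (vN_comp vnM _ (Mvm m)); exact: (vN_comp vnM (Mum m)).
have MSm m : M (Sm m).
  elim: m => [|m IH] //=; rewrite /step.
  by apply: (vN_lin _ vnM) => //; apply: (vN_lin _ vnM); exact: MT.
have iso (w : X -> C) (y : GB -> C) : Linf xi w -> (forall x, normc (w x) = 1) -> L2 y ->
    q (mult (w \o p) y) <= q y.
  move=> Lw w1 Ly; have Lwp := Linf_mult countG nsB (Linf_comp_factor facX Lw).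
  have [] := @mulop_q _ _ _ mu (fun t : GB => w (p (actB t.1 t.2))) 1 y Lwp.1 _ Ly.
    by apply: aeW => t; rewrite w1.
  by rewrite expr1n mul1r.
have normSm m x : L2 x -> q (Sm m x) <= c ^+ 2 * q x.
  elim: m x => [|m IH] x Lx; first exact: Sc.
  have bm := vN_bounded vnM (MSm m); have bT := vN_bounded vnM (MT m _ (MSm m)).
  have LSx := bounded_L2 bm Lx; have LTx := bounded_L2 bT Lx.
  have Lvx := bounded_L2 (vN_bounded vnM (Mvm m)) Lx.
  have h1 : q (T m (Sm m) x) <= c ^+ 2 * q x.
    apply: le_trans (iso _ _ (LuC m) (nuC m) (bounded_L2 bm Lvx)) _.
    apply: le_trans (IH _ Lvx) _; apply: ler_wpM2l; first exact: sqr_ge0.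
    by apply: iso => // y; exact: nuC.
  have h2 := IH x Lx.
  have -> : Sm m.+1 x = (2^-1 : C) *: (Sm m x + T m (Sm m) x).
    apply/funext => t; change (2^-1 * Sm m x t + ((2^-1 - 1) * T m (Sm m) x t + T m (Sm m) x t)
      = 2^-1 * (Sm m x t + T m (Sm m) x t)); ring.
  rewrite (qZ H _ (L2D LSx LTx)).
  have -> : normc (2^-1 : C) ^+ 2 = 4^-1.
    have -> : (2^-1 : C) = (2^-1 : R)%:C by rewrite fmorphV rmorph_nat.
    by rewrite normc_real ger0_norm ?invr_ge0 //; field.
  have := qD_le H LSx LTx; rewrite !mulr2n; move: h1 h2.
  move: (q (T m (Sm m) x)) (q (Sm m x)) (q (Sm m x + T m (Sm m) x)) (c ^+ 2 * q x).
  by move=> a b r e; lra.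
apply: (vN_column_limit (S := Sm) countG vnM MSm bU (sqr_ge0 c) normSm).
move=> k x Lx; have Ldx := dproj_L2 countG k Lx; have LSdx := bounded_L2 bS Ldx.
(* The row [t.1] and the column [k] of the [m]-th average carry the factor
   [gam m], which is 0 or 1; on the row [g k] it stays equal to 1, and on every
   other row it is eventually 0. *)
pose al m (t : GB) := u m (p (actB t.1 t.2)).
pose be m (t : GB) := u m (actX g (p (actB k t.2))).
pose gam := fix gam n (t : GB) : R :=
  if n is m.+1 then gam m t * ((1 + al m t * be m t) / 2) else 1.
pose gam0 (t : GB) : R := (t.1 == (g * k)%g)%:R.
have mal m : measurable_fun setT (al m).
  apply: (measurable_fun_fibrewise countG) => h.
  exact: (measurableT_comp (mu_ m) (measurableT_comp mp (act_measurable nsB h))).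
have mbe m : measurable_fun setT (be m).
  apply: (measurable_fun_fibrewise countG) => h.
  exact: (measurableT_comp (mu_ m) (measurableT_comp (act_measurable nsX g)
    (measurableT_comp mp (act_measurable nsB k)))).
have mgam m : measurable_fun setT (gam m).
  elim: m => [|m IH] /=; first exact: measurable_cst.
  apply: measurable_funM => //; apply: measurable_funM => //.
  by apply: measurable_funD => //; apply: measurable_funM.
have mgam0 : measurable_fun setT gam0.
  by apply: (measurable_fun_fibrewise countG) => h; exact: (measurable_cst ((h == (g * k)%g)%:R : R)).
have fac m t : (al m t = be m t /\ (1 + al m t * be m t) / 2 = 1) \/
    (al m t <> be m t /\ (1 + al m t * be m t) / 2 = 0).
  have n11 : (1 : R) <> -1 by move=> /eqP; rewrite -subr_eq0 opprK -mulr2n pnatr_eq0.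
  rewrite /al /be; case: (upm m (p (actB t.1 t.2))) => ->;
    case: (upm m (actX g (p (actB k t.2)))) => ->; [left|right|right|left]; split => //;
    rewrite ?mul1r ?mulr1 ?mulrNN ?mulr1 ?subrr ?mul0r //; try (by field); by move=> /esym.
have gam01 m t : gam m t = 0 \/ gam m t = 1.
  elim: m => [|m IH] /=; first by right.
  by case: (fac m t) => -[_ ->]; rewrite ?mulr1 ?mulr0; [|left].
have blocks m : \forall t \ae mu, Sm m (dproj k x) t = (gam m t)%:C * S (dproj k x) t.
  elim: m => [|m IH]; first by apply: aeW => t; rewrite mul1r.
  have bm := vN_bounded vnM (MSm m).
  have vE : vm m (dproj k x) = chimul ((uC m \o actX g) \o p \o actB k) (dproj k x).
    apply/funext => t; rewrite /vm /mult_op /chimul /dproj /mulop /=.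
    by case: eqP => [->//|_]; rewrite mul0r !mulr0.
  have Lz : Linf nu ((uC m \o actX g) \o p \o actB k).
    exact: (Linf_act nsB k (Linf_comp_factor facX (LvC m))).
  have cz : commute mu (Sm m) (chimul ((uC m \o actX g) \o p \o actB k)).
    have [_] := crossed_right countG nsB (M_crossed (MSm m)); apply.
    by left; exists ((uC m \o actX g) \o p \o actB k).
  have /op_eqP /(_ _ Ldx) /= h := cz.
  apply: ae_imp2 IH h => t e1 e2.
  have umE (y : GB -> C) t' : um m y t' = (al m t')%:C * y t' by [].
  rewrite /step /op_lin /T /= vE !umE e2 /chimul /mulop e1 /=.
  rewrite (_ : ((gam m t * ((1 + al m t * be m t) / 2))%:C)
    = (gam m t)%:C * ((1 + (al m t)%:C * (be m t)%:C) / 2)); last first.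
    by rewrite rmorphM /= rmorphM /= rmorphD /= rmorphM /= fmorphV rmorph_nat rmorph1.
  by rewrite -/(be m t) /uC; field.
have lim : \forall t \ae mu, gam ^~ t @ \oo --> gam0 t.
  have equi : \forall b \ae nu, p (actB (g * k)%g b) = actX g (p (actB k b)).
    apply: ae_imp (ns_ae nsB k (factor_equivariant facX g)) => b.
    by rewrite (act_mul nsB).
  apply: (ae_fibers countG) => h.
  apply: ae_imp2 equi (ns_ae nsB (g * k)%g sepu) => b e1 e2.
  apply: cvg_near_cst; rewrite /gam0 /=; case: (h =P _) => [hgk|ne].
    apply: nearW => n; elim: n => [//|n IH] /=; rewrite IH mul1r.
    by case: (fac n (h, b)) => -[] //; rewrite /al /be /= hgk e1.
  have s1 : (h * (g * k)^-1)%g != 1%g.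
    by apply/eqP => /(congr1 (fun y => (y * (g * k))%g)); rewrite mulgVK mul1g.
  have [m umne] := e2 _ s1.
  exists m.+1 => // n /= mn; rewrite -(subnK mn) addnC.
  elim: (n - m.+1)%N => [|j IH]; last first.
    rewrite addnS; set i := (m.+1 + j)%N in IH *.
    change (gam i (h, b) * ((1 + al i (h, b) * be i (h, b)) / 2) = 0).
    by rewrite IH mul0r.
  rewrite addn0 /=; case: (fac m (h, b)) => -[al_be ->]; last by rewrite mulr0.
  exfalso; apply: umne; move: al_be; rewrite /al /be /= -e1 => <-.
  by rewrite -(act_mul nsB) mulgVK.
have Uae : \forall t \ae mu, (mult (f \o p) \o @lambda R G dB B g) (dproj k x) t
    = (gam0 t)%:C * S (dproj k x) t.
  apply: ae_imp2 (crossed_symbol countG nsB k cS Lx) (_ : \forall t \ae mu,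
    coef S g (actB t.1 t.2) = f (p (actB t.1 t.2))); last first.
    by apply: (ae_fibers countG) => h; exact: (ns_ae nsB h Sf).
  move=> [h b] /= e1 e2; rewrite e1 /gam0 /mult_op /lambda /dproj /mulop /=.
  have -> : (g^-1 * h == k)%g = (h == g * k)%g by rewrite -(inj_eq (mulgI g)) mulVKg.
  case: eqP => [hgk|_]; last by rewrite !mul0r mulr0.
  by move: e2; rewrite hgk => e2; rewrite mulgK mulKg !mul1r e2.
move=> e e0.
have [||N Nh] := @dominated_L2 _ _ _ mu gam gam0 _ LSdx mgam mgam0 _ _ lim e e0.
- by move=> m t; case: (gam01 m t) => ->; rewrite ?lexx ?ler01.
- by move=> t; rewrite /gam0; case: (_ == _); rewrite ?lexx ?ler01.
exists N => m Nm; apply: le_lt_trans (Nh m Nm).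
have LSm := bounded_L2 (vN_bounded vnM (MSm m)) Ldx; have LU := bounded_L2 bU Ldx.
have L1 := L2B LSm LU.
have eq1 : \forall t \ae mu, (Sm m (dproj k x) - (mult (f \o p) \o @lambda R G dB B g) (dproj k x)) t
    = (gam m t)%:C * S (dproj k x) t - (gam0 t)%:C * S (dproj k x) t.
  apply: ae_imp2 (blocks m) Uae => t e1 e2.
  change (Sm m (dproj k x) t - (mult (f \o p) \o @lambda R G dB B g) (dproj k x) t
    = (gam m t)%:C * S (dproj k x) t - (gam0 t)%:C * S (dproj k x) t).
  by rewrite e1 e2.
have L2' : L2 (fun t => (gam m t)%:C * S (dproj k x) t - (gam0 t)%:C * S (dproj k x) t).
  apply: L2_ae L1 _; last by apply: ae_imp eq1 => t; exact: esym.
  apply: cmeasD; [|apply: cmeasN]; apply: cmeasM; [exact: cmeas_real|exact: LSdx.1|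
    exact: cmeas_real|exact: LSdx.1].
by rewrite (dot_ae L1 L2' L1 L2' eq1 eq1).
Qed.

End FourierComponents.

(** * The diagonal part and the separation of orbits *)

Section OrbitSeparation.
Context {R : realType} {G : groupType} {dB : measure_display} {B : measurableType dB}.
Variables (nu : probability B R) (actB : G -> B -> B).
Context {dX : measure_display} {X : measurableType dX}.
Variables (xi : probability X R) (actX : G -> X -> X) (p : B -> X).
Hypotheses (countG : countable [set: G]) (nsB : nonsingular_space nu actB)
  (shB : SH_property nu actB) (facX : factor_map nu actB xi actX p)
  (ntX : nontrivial_space xi).
Local Notation C := (R[i]).
Local Notation GB := (discrete_group G * B)%type.
Local Notation mu := (crossed_measure G nu).
Local Notation L2 := (L2 mu).
Local Notation opGB := (op R GB).
Local Notation F := (Linf_factor xi p).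
Local Notation crossedX := (crossed_product nu actB F setT).
Local Notation crossed := (crossed_product nu actB (Linf nu) setT).
Local Notation mult := (mult_op actB).
Local Notation E := canonical_expectation.
Local Notation mp := (factor_measurable facX).
Local Notation pushp := (factor_push facX).

Variable M : set opGB.
Hypotheses (vnM : vN_algebra mu M) (invM : conj_invariant M)
  (subM : mult @` F `<=` M) (Msub : M `<=` crossedX).

Definition block_diagonal : set opGB := commutant mu [set dproj k | k in [set: G]].

Lemma dproj_adj_closed : adj_closed mu [set dproj k | k in [set: G]].
Proof.
move=> _ [k _ <-]; split; first exact: dproj_bounded.
by exists (dproj k); [exists k|exact: dproj_adjoint].
Qed.

(** The diagonal part of [M]; as an algebra of functions it is [L^oo(X)]. *)
Definition diagonal_part : set opGB := M `&` block_diagonal.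

Lemma diagonal_vN : vN_algebra mu diagonal_part.
Proof. by apply: vN_setI => //; exact: (commutant_vN dproj_adj_closed). Qed.

Lemma lambdaVK g (x : GB -> C) : lambda g^-1%g (lambda g x) = x.
Proof.
by apply/funext => -[h b]; rewrite /lambda /= invgK mulKg.
Qed.

Lemma conj_commute g (S U : opGB) : bounded_op mu S -> bounded_op mu U ->
  commute mu S U -> commute mu (conj_op g S) (conj_op g U).
Proof.
move=> bS bU /op_eqP SU; apply/op_eqP => x Lx.
have b1 := lambda_bounded nu countG g; have b2 := lambda_bounded nu countG g^-1%g.
have L1 := bounded_L2 b2 Lx; have h := SU _ L1; rewrite /= in h.
have := bounded_ae b1 (bounded_L2 bS (bounded_L2 bU L1)) (bounded_L2 bU (bounded_L2 bS L1)) h.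
by rewrite /conj_op /= !lambdaVK.
Qed.

Lemma conj_dproj g k : conj_op g (dproj k : opGB) = dproj (g * k)%g.
Proof.
apply/funext => x; rewrite /conj_op /= lambda_dproj; congr (dproj _ _).
by apply/funext => -[h b]; rewrite /lambda /= invgK mulVKg.
Qed.

Lemma block_diagonal_conj : conj_invariant block_diagonal.
Proof.
move=> g S [bS SD]; split; first exact: (conj_bounded countG).
move=> _ [k _ <-]; rewrite -[k](mulVKg g) -conj_dproj.
apply: conj_commute => //; first exact: dproj_bounded.
by apply: SD; exists (g^-1 * k)%g.
Qed.

Lemma diagonal_conj : conj_invariant diagonal_part.
Proof. by move=> g S [MS DS]; split; [exact: invM|exact: block_diagonal_conj]. Qed.

Lemma diagonal_crossed : diagonal_part `<=` crossed.
Proof. by move=> S [/Msub/(crossedX_crossed facX)]. Qed.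

Lemma diagonal_mult f : Linf xi f -> diagonal_part (mult (f \o p)).
Proof.
move=> Lf; split; first exact: (M_mult subM).
split; first exact: (mult_bounded countG nsB (Linf_comp_factor facX Lf)).
by move=> _ [k _ <-]; apply: op_eqW => x t; rewrite /dproj /mulop /mult_op /= mulrCA.
Qed.

Lemma diagonal_op_eq S : diagonal_part S -> op_eq mu S (mult (coef S 1%g)).
Proof.
move=> dS; have cS := diagonal_crossed dS.
by apply: (crossed_diag countG nsB cS).1 => k; apply: dS.2.2; exists k.
Qed.

Lemma expectation_mult (f : B -> C) : E (mult f) = f.
Proof.
apply/funext => b; rewrite /canonical_expectation /mult_op /delta_one /=.
by rewrite (act_one nsB) eqxx mulr1.
Qed.

Lemma measurable_neq_cst (f : X -> C) c : cmeasurable f -> measurable [set x | ~ f x = c].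
Proof.
move=> mf; have mb : measurable_fun setT
    (fun x => (complex.Re (f x) == complex.Re c) && (complex.Im (f x) == complex.Im c)).
  by apply: measurable_and; apply: measurable_fun_eqr;
    [exact: mf.1|exact: measurable_cst|exact: mf.2|exact: measurable_cst].
rewrite (_ : [set x | _] = (fun x => (complex.Re (f x) == complex.Re c)
    && (complex.Im (f x) == complex.Im c)) @^-1` [set false]).
  by rewrite -[X in measurable X]setTI; exact: mb.
apply/seteqP; split => x /=.
  by move=> ne; apply/negP => /andP[/eqP r /eqP i]; apply: ne; exact: eq_ReIm.
by move=> + e; rewrite e !eqxx.
Qed.

(** The diagonal part contains [L^oo(X)], so its expectation is not constant. *)
Lemma diagonal_singular : expectation_singular nu actB diagonal_part.
Proof.
have [//|const] := shB diagonal_vN diagonal_conj diagonal_crossed.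
exfalso; have [f Lf nf] := ntX.
have [c cE] := const _ (diagonal_mult Lf); apply: (nf c); apply/ae_eqP.
apply: (pull_ae_inv mp pushp); first exact: (measurable_neq_cst _ Lf.1).
by move/ae_eqP : cE; rewrite expectation_mult.
Qed.

(** The action on [X] is essentially free, in the form of countably many
    functions on [X] that separate the points of almost every orbit. *)
Lemma separating_exists : exists u : nat -> X -> R,
  [/\ forall m, measurable_fun setT (u m), forall m x, u m x = 1 \/ u m x = -1 &
    separating nu actB p u].
Proof.
have [D DN sepD] := singular_separates countG nsB diagonal_crossed diagonal_op_eq
  diagonal_singular.
have f n : {f | Linf xi f & \forall b \ae nu, coef (D n) 1%g b = f (p b)}.
  apply/cid2; exact: (M_coef countG nsB facX Msub 1%g (DN n).1).
pose k n := s2val (f n).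
have Lk n : Linf xi (k n) by rewrite /k; case: (f n).
have kE : \forall b \ae nu, forall n, E (D n) b = k n (p b).
  by apply: ae_foralln => n; rewrite /k; case: (f n) => h _ /=; rewrite coef1.
have [u [mu_ upm usep]] := sign_sequence (fun n => (Lk n).1).
exists u; split => //.
have kEs : \forall b \ae nu, forall g n, E (D n) (actB g b) = k n (p (actB g b)).
  by apply: (ae_forallG countG) => g; exact: (ns_ae nsB g kE).
apply: ae_imp2 (ae_andP kE kEs) sepD => b [e1 e2] e3 s s1.
have [n ne] := e3 s s1; apply: usep; exists n.
by rewrite -e1 -e2.
Qed.

Lemma component_in S g f : M S -> Linf xi f ->
  (\forall b \ae nu, coef S g b = f (p b)) -> M (mult (f \o p) \o @lambda R G dB B g).
Proof.
have [u [mu_ upm usep]] := separating_exists.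
exact: (fourier_component countG nsB facX vnM subM Msub mu_ upm usep).
Qed.

End OrbitSeparation.

(** * Maximal supports of the Fourier components *)

Section Supports.
Context {R : realType} {G : groupType} {dB : measure_display} {B : measurableType dB}.
Variables (nu : probability B R) (actB : G -> B -> B).
Context {dX : measure_display} {X : measurableType dX}.
Variables (xi : probability X R) (actX : G -> X -> X) (p : B -> X).
Hypotheses (countG : countable [set: G]) (nsB : nonsingular_space nu actB)
  (facX : factor_map nu actB xi actX p).
Local Notation C := (R[i]).
Local Notation GB := (discrete_group G * B)%type.
Local Notation mu := (crossed_measure G nu).
Local Notation L2 := (L2 mu).
Local Notation dot := (L2dot mu).
Local Notation q x := (complex.Re (dot x x)).
Local Notation opGB := (op R GB).
Local Notation F := (Linf_factor xi p).
Local Notation crossedX := (crossed_product nu actB F setT).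
Local Notation mult := (mult_op actB).
Local Notation mp := (factor_measurable facX).
Local Notation pushp := (factor_push facX).

Lemma measurable_mem (A : set X) : measurable A -> measurable_fun setT (fun x => x \in A).
Proof. by move=> mA; apply: (measurable_fun_bool true); rewrite setTI preimage_mem_true. Qed.

Definition ind (A : set X) : X -> C := fun x => (x \in A)%:R.

Lemma Linf_ind A : measurable A -> Linf xi (ind A).
Proof. by move=> mA; apply: Linf_bool; exact: measurable_mem. Qed.

Variable M : set opGB.
Hypotheses (vnM : vN_algebra mu M) (subM : mult @` F `<=` M)
  (Msub : M `<=` crossedX)
  (compM : forall S g f, M S -> Linf xi f -> (\forall b \ae nu, coef S g b = f (p b)) ->
    M (mult (f \o p) \o @lambda R G dB B g)).
Local Notation term g f := (mult (f \o p) \o @lambda R G dB B g).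

Lemma term_bounded g f : Linf xi f -> bounded_op mu (term g f).
Proof.
move=> Lf; apply: bounded_comp (lambda_bounded nu countG g).
exact: (mult_bounded countG nsB (Linf_comp_factor facX Lf)).
Qed.

Lemma term_mul g f k : M (term g f) -> Linf xi k -> M (term g (fun x => k x * f x)).
Proof.
move=> Mf Lk; have -> : term g (fun x => k x * f x) = mult (k \o p) \o term g f.
  by apply/funext => x; apply/funext => t; rewrite /mult_op /= mulrA.
by apply: (vN_comp vnM) => //; exact: (M_mult subM).
Qed.

Lemma term_add g f k : M (term g f) -> M (term g k) -> M (term g (fun x => f x + k x)).
Proof.
move=> Mf Mk; have -> : term g (fun x => f x + k x) = op_lin 1 (term g f) (term g k).
  by apply/funext => x; apply/funext => t; rewrite /mult_op /op_lin /= mul1r mulrDl.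
exact: (vN_lin _ vnM).
Qed.

Definition supports (g : G) : set (set X) :=
  [set A | measurable A /\ M (term g (ind A))].

Lemma supports_sub g A A' : supports g A -> measurable A' -> A' `<=` A -> supports g A'.
Proof.
move=> [mA MA] mA' sub; split=> //.
have := term_mul MA (Linf_ind mA').
rewrite (_ : (fun x => ind A' x * ind A x) = ind A') //; apply/funext => x.
rewrite /ind; case: (boolP (x \in A')); last by rewrite mul0r.
by rewrite inE => /sub /mem_set ->; rewrite mul1r.
Qed.

Lemma supportsU g A A' : supports g A -> supports g A' -> supports g (A `|` A').
Proof.
move=> sA [mA' MA']; have mA := sA.1; split; first exact: measurableU.
have [_ MD] := supports_sub sA (measurableD mA mA') (@subDsetl _ A A').
have := term_add MD MA'.
rewrite (_ : (fun x => _ + _) = ind (A `|` A')) //; apply/funext => x.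
rewrite /ind in_setU in_setD.
by case: (x \in A'); case: (x \in A); rewrite /= ?addr0 ?add0r.
Qed.

Lemma supports0 g : supports g set0.
Proof.
split=> //; have h : M idfun := star_one vnM.1.
have := vN_lin (-1) vnM h h; congr (M _).
apply/funext => x; apply/funext => t.
by rewrite /op_lin /mult_op /ind /= in_set0 mul0r mulN1r addNr.
Qed.

Lemma supports_bigcup g (A : nat -> set X) : (forall n, supports g (A n)) ->
  supports g (\bigcup_n A n).
Proof.
move=> sA; pose V n := \bigcup_(i < n) A i.
have sV n : supports g (V n).
  rewrite /V bigcup_mkord; elim: n => [|n IH]; first by rewrite big_ord0; exact: supports0.
  by rewrite big_ord_recr /=; apply: supportsU.
have mU : measurable (\bigcup_n A n).
  by apply: bigcupT_measurable => n; exact: (sA n).1.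
split=> //; set U := \bigcup_n A n.
pose c n (t : GB) : R := (p (actB t.1 t.2) \in V n)%:R.
pose c0 (t : GB) : R := (p (actB t.1 t.2) \in U)%:R.
have mc (W : set X) : measurable W ->
    measurable_fun setT (fun t : GB => (p (actB t.1 t.2) \in W)%:R : R).
  move=> mW; apply: (measurable_fun_fibrewise countG) => h.
  rewrite (_ : (fun b => _) = (fun b : bool => if b then 1 else 0 : R) \o
    (fun x => x \in W) \o (p \o actB h)); last by apply/funext => b /=; case: (_ \in _).
  apply: measurableT_comp (measurableT_comp mp (act_measurable nsB h)).
  by apply: measurableT_comp (measurable_mem mW).
have bU := term_bounded g (Linf_ind mU).
have VU n : V n `<=` U by move=> x [i _ Ai]; exists i.
have nl x : L2 x -> forall n, q (term g (ind (V n)) x) <= 1 * q x.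
  move=> Lx n; have [Ll ql] := lambda_L2 (nu := nu) countG g Lx.
  apply: le_trans ql.
  have Lw := Linf_mult countG nsB (Linf_comp_factor facX (Linf_ind (sV n).1)).
  have [] := @mulop_q _ _ _ mu _ 1 _ Lw.1 _ Ll; last by rewrite expr1n mul1r.
  by apply: aeW => t; rewrite /ind /=; case: (_ \in _); rewrite ?normc0 ?normc1.
apply: (vN_column_limit (S := fun n => term g (ind (V n))) countG vnM
  (fun n => (sV n).2) bU ler01) => [n x Lx|k x Lx e e0]; first exact: nl.
have Ly := (lambda_L2 (nu := nu) countG g (dproj_L2 countG k Lx)).1.
set y := lambda g (dproj k x) in Ly.
have [|||||N Nh] := @dominated_L2 _ _ _ mu c c0 y Ly _ _ _ _ _ e e0.
- by move=> n; apply: mc; exact: (sV n).1.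
- exact: mc.
- by move=> n t; rewrite /c; case: (_ \in _); rewrite ?lexx ?ler01.
- by move=> t; rewrite /c0; case: (_ \in _); rewrite ?lexx ?ler01.
- apply: aeW => t; apply: cvg_near_cst; rewrite /c /c0.
  case: (boolP (_ \in U)) => [|nU].
    rewrite inE => -[i _ Ai]; exists i.+1 => // n /= ni.
    by rewrite mem_set //; exists i.
  apply: nearW => n; rewrite memNset // => /VU /mem_set.
  by rewrite (negbTE nU).
have cE (b : bool) : b%:R = (b%:R : R)%:C :> C by case: b.
have eqy n : term g (ind (V n)) (dproj k x) - term g (ind U) (dproj k x)
    = fun t => (c n t)%:C * y t - (c0 t)%:C * y t.
  apply/funext => t.
  change (ind (V n) (p (actB t.1 t.2)) * y t - ind U (p (actB t.1 t.2)) * y t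
    = (c n t)%:C * y t - (c0 t)%:C * y t).
  by rewrite /ind !cE.
by exists N => n Nn; rewrite eqy; exact: Nh.
Qed.

(** On the set where [|f|] exceeds [1 / (n + 1)] the function [f] has a bounded
    inverse, by which the term [f lambda_g] can be divided. *)
Lemma supports_neq0 g f : Linf xi f -> M (term g f) -> supports g [set x | f x != 0].
Proof.
move=> Lf Mf; pose A n := [set x | n.+1%:R^-1 < normc (f x)].
have mn : measurable_fun setT (fun x => normc (f x)) by exact: (meas_normc Lf.1).
have mA' n : measurable_fun setT (fun x => n.+1%:R^-1 < normc (f x)).
  by apply: measurable_fun_ltr; [exact: measurable_cst|exact: mn].
have mA n : measurable (A n).
  have := mA' n measurableT [set true] I; rewrite setTI.
  by congr measurable; apply/seteqP; split => x.
have i0 n : (0 : R) < n.+1%:R^-1 by rewrite invr_gt0.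
rewrite (_ : [set x | _] = \bigcup_n A n).
  apply: supports_bigcup => n; split=> //.
  pose r x : R := if n.+1%:R^-1 < normc (f x) then expR (- ln (normc (f x) ^+ 2)) else 0.
  pose k x : C := (r x)%:C * (f x)^*.
  have rE x : r x = if n.+1%:R^-1 < normc (f x) then (normc (f x) ^+ 2)^-1 else 0.
    rewrite /r; case: ifP => // nf; rewrite expRN lnK // posrE.
    by apply: exprn_gt0; exact: lt_trans nf.
  have mr : measurable_fun setT r.
    apply: measurable_fun_ifT; [exact: mA'| |exact: measurable_cst].
    apply: measurableT_comp; first exact: measurable_expR.
    apply: measurable_funN; apply: measurableT_comp; first exact: measurable_ln.
    exact: meas_normc2 Lf.1.
  have Lk : Linf xi k.
    split; first by apply: cmeasM; [exact: cmeas_real|exact: (cmeasJ Lf.1)].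
    exists n.+1%:R; apply: aeW => x; rewrite /k normcM cnormJ normc_real rE.
    case: ifP => nf; last by rewrite normr0 mul0r.
    have f0 := lt_trans (i0 n) nf.
    rewrite ger0_norm ?invr_ge0 ?sqr_ge0 // expr2 invfM divfK ?gt_eqF //.
    by rewrite -[leRHS]invrK lef_pV2 ?posrE // ltW.
  have := term_mul Mf Lk.
  rewrite (_ : (fun x => _) = ind (A n)) //; apply/funext => x.
  rewrite /k -mulrA [_^* * _]mulrC cmulJ -rmorphM /= rE /ind.
  case: ifP => nf; last by rewrite mul0r memNset //= /A /= nf.
  rewrite mulVf ?mem_set //.
  by rewrite expf_neq0 // gt_eqF // (lt_trans (i0 n) nf).
apply/seteqP; split => x /=.
  move=> f0; have nf : 0 < normc (f x).
    rewrite lt_def normc_ge0 andbT; apply: contra f0 => /eqP /eq0_normc ->.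
    exact: eqxx.
  exists (Num.truncn (normc (f x))^-1) => //; rewrite /A /= invf_plt ?posrE //.
  exact: truncnS_gt.
move=> [n _]; rewrite /A /= => nf; apply/eqP => f0.
by move: nf; rewrite f0 normc0 ltNge ltW.
Qed.

(** Exhaustion: the supremum of the measures of the sets in [supports g] is
    attained by a countable union. *)
Lemma max_support g : exists2 Z, supports g Z &
  forall A, supports g A -> xi (A `\` Z) = 0%E.
Proof.
pose s := ereal_sup [set xi A | A in supports g].
have s_fin : s \is a fin_num.
  rewrite ge0_fin_numE; last first.
    apply: (le_trans (measure_ge0 xi set0)); apply: ereal_sup_ubound; exists set0 => //.
    exact: supports0.
  apply: (@le_lt_trans _ _ 1%E); last exact: ltry.
  by apply: ge_ereal_sup => _ [A [mA _] <-]; exact: probability_le1.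
have i0 n : (0 : R) < n.+1%:R^-1 by rewrite invr_gt0.
have A n : {A | supports g A & (s - (n.+1%:R^-1)%:E < xi A)%E}.
  apply/cid2; have [_ [A sA <-] h] := ub_ereal_sup_adherent (i0 n) s_fin.
  by exists A.
pose Z := \bigcup_n s2val (A n).
have sZ : supports g Z by apply: supports_bigcup => n; case: (A n).
exists Z => // D sD; have mDZ : measurable (D `\` Z).
  by apply: measurableD; [exact: sD.1|exact: sZ.1].
have mZ := sZ.1.
have finX E : measurable E -> xi E \is a fin_num by move=> mE; exact: fin_num_measure.
apply/eqP; rewrite eq_le measure_ge0 andbT; apply/lee_addgt0Pr => e e0; rewrite add0e.
have [n ne] : exists n, n.+1%:R^-1 < e.
  by exists (Num.truncn e^-1); rewrite invf_plt ?posrE // truncnS_gt.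
have h1 : (xi (D `\` Z) + xi Z <= s)%E.
  rewrite -measureU //; last first.
    by apply/seteqP; split => // x [[_ nZ] /nZ].
  apply: ereal_sup_ubound; exists ((D `\` Z) `|` Z) => //; apply: supportsU => //.
  by apply: supports_sub sD mDZ _ => x [].
have h2 : (s - (n.+1%:R^-1)%:E < xi Z)%E.
  apply: lt_le_trans (_ : xi (s2val (A n)) <= _)%E; first by case: (A n).
  apply: le_measure; rewrite ?inE //; last by move=> x Ax; exists n.
  by case: (A n) => ? [].
move: h1 h2 ne; rewrite -(fineK s_fin) -(fineK (finX _ mZ)) -(fineK (finX _ mDZ)).
rewrite -EFinD lee_fin -EFinB lte_fin lee_fin.
by move: (n.+1%:R^-1 : R) (fine s) (fine _) (fine _) => i a b c; lra.
Qed.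

End Supports.

(** * Centrality of the supports *)

Section CentralSupports.
Context {R : realType} {G : groupType} {dB : measure_display} {B : measurableType dB}.
Variables (nu : probability B R) (actB : G -> B -> B).
Context {dX : measure_display} {X : measurableType dX}.
Variables (xi : probability X R) (actX : G -> X -> X) (p : B -> X).
Hypotheses (countG : countable [set: G]) (nsB : nonsingular_space nu actB)
  (facX : factor_map nu actB xi actX p).
Local Notation C := (R[i]).
Local Notation GB := (discrete_group G * B)%type.
Local Notation mu := (crossed_measure G nu).
Local Notation L2 := (L2 mu).
Local Notation opGB := (op R GB).
Local Notation F := (Linf_factor xi p).
Local Notation crossedX := (crossed_product nu actB F setT).
Local Notation mult := (mult_op actB).
Local Notation lam := (@lambda R G dB B).
Local Notation mp := (factor_measurable facX).
Local Notation pushp := (factor_push facX).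

Variable M : set opGB.
Hypotheses (vnM : vN_algebra mu M) (invM : conj_invariant M) (subM : mult @` F `<=` M)
  (Msub : M `<=` crossedX)
  (compM : forall S g f, M S -> Linf xi f -> (\forall b \ae nu, coef S g b = f (p b)) ->
    M (mult (f \o p) \o lam g)).
Local Notation supports := (supports actB p M).
Variable Z : G -> set X.
Hypotheses (supZ : forall g, supports g (Z g))
  (maxZ : forall g A, supports g A -> xi (A `\` Z g) = 0%E).

Lemma coef_term w g : coef (mult w \o lam g) g = w.
Proof.
have -> : coef (mult w \o lam g) g = canonical_expectation (mult w).
  rewrite /coef; congr canonical_expectation.
  by apply/funext => x; rewrite /= -[x in RHS](lambdaVK g^-1%g) invgK.
exact: (expectation_mult nsB).
Qed.

(** The set where the coefficient does not vanish belongs to [supports g], and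
    [Z g] contains almost all of it. *)
Lemma coef_supported S g : M S -> \forall b \ae nu, coef S g b != 0 -> Z g (p b).
Proof.
move=> MS; have [f Lf Sf] := M_coef countG nsB facX Msub g MS.
have sf := supports_neq0 countG nsB facX vnM subM Lf (compM MS Lf Sf).
have mZ := (supZ g).1; have mD := measurableD sf.1 mZ.
have h : \forall x \ae xi, ~ ([set x | f x != 0] `\` Z g) x.
  exists ([set x | f x != 0] `\` Z g); split=> //; first exact: maxZ.
  by move=> x /contrapT.
apply: ae_imp2 Sf (pull_ae mp pushp h) => b -> nD f0.
by apply: contrapT => nZ; apply: nD.
Qed.

Lemma term_supported w g : M (mult w \o lam g) ->
  \forall b \ae nu, w b != 0 -> Z g (p b).
Proof. by move=> /(coef_supported g); rewrite coef_term. Qed.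

Local Notation z g b := (Z g (p b)).

Local Notation oneZ g := (@ind R _ _ (Z g)).

Lemma ind_neq0 g x : Z g x -> oneZ g x != 0.
Proof. by move=> Zx; rewrite /ind mem_set // oner_neq0. Qed.

(** Conjugates, products and adjoints of the terms [1_(Z g) lambda_g] are again
    terms, whose supports are contained in the maximal ones. *)
Lemma support_conj a k : \forall b \ae nu, z k (actB a^-1%g b) -> z (a * k * a^-1)%g b.
Proof.
have := invM a (supZ k).2; set S := conj_op _ _.
have -> : S = mult ((oneZ k \o p) \o actB a^-1%g) \o lam (a * k * a^-1)%g.
  apply/funext => x; rewrite /S /conj_op /= (lambda_mult nsB); congr mult_op.
  by rewrite !lambdaM.
move/term_supported; apply: ae_imp => b h zk; apply: h; exact: ind_neq0.
Qed.

Lemma support_mul g k : \forall b \ae nu,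
  z g b -> z k (actB g^-1%g b) -> z (g * k)%g b.
Proof.
have := vN_comp vnM (supZ g).2 (supZ k).2; set S := (X in M X).
have -> : S = mult (fun b => oneZ g (p b) * oneZ k (p (actB g^-1%g b)))
    \o lam (g * k)%g.
  apply/funext => x; rewrite /S /= (lambda_mult nsB) lambdaM.
  by apply/funext => t; rewrite /mult_op /= mulrA.
move/term_supported; apply: ae_imp => b h zg zk; apply: h.
by rewrite mulf_neq0 // ind_neq0.
Qed.

Lemma term_adj f g : Linf xi f -> M (mult (f \o p) \o lam g) ->
  M (mult (fun b => (f (p (actB g b)))^*) \o lam g^-1%g).
Proof.
move=> Lf Mf; have Lfp := Linf_comp_factor facX Lf.
apply: (vN_adj vnM Mf _ (mult_lambda_adjoint countG nsB g Lfp)).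
exact: bounded_comp (mult_bounded countG nsB (LinfJ (Linf_act nsB g Lfp)))
  (lambda_bounded nu countG _).
Qed.

Lemma support_inv g : \forall b \ae nu, z g (actB g b) -> z (g^-1)%g b.
Proof.
have := term_adj (Linf_ind xi (supZ g).1) (supZ g).2.
move/term_supported; apply: ae_imp => b h zg; apply: h.
by rewrite conjC_eq0; exact: ind_neq0.
Qed.

(** The elements [g] with [z g b] form a group: the pairs [(g, b)] with [z g b],
    seen as arrows from [g^-1 b] to [b], form a groupoid that is invariant under
    the conjugation by the whole of the group, so that [h] and [k] compose to
    [k h = h (h^-1 k h)]. *)
Lemma support_invariant : \forall b \ae nu, forall g k,
  z g b -> (z k b <-> z k (actB g^-1%g b)).
Proof.
have orb (P : B -> Prop) : (\forall b \ae nu, P b) ->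
    \forall b \ae nu, forall a, P (actB a b).
  by move=> aeP; apply: (ae_forallG countG) => a; exact: (ns_ae nsB a aeP).
have c := orb _ (ae_forallG countG (fun a => ae_forallG countG (support_conj a))).
have m := ae_forallG countG (fun g => ae_forallG countG (support_mul g)).
have i := orb _ (ae_forallG countG support_inv).
apply: ae_imp2 (ae_andP c m) i => b [{}c {}m] {}i.
have conj a k : z k b -> z (a * k * a^-1)%g (actB a b).
  by move=> zk; apply: c; rewrite (actK nsB).
have conjV a k : z k (actB a^-1%g b) -> z (a * k * a^-1)%g b.
  by move=> zk; have := c 1%g a k; rewrite (act_one nsB); apply.
have mul h k : z h b -> z k b -> z (k * h)%g b.
  move=> zh zk; have := conj h^-1%g k zk; rewrite invgK => z1.
  by have := m h _ zh z1; rewrite mulgA mulVKg.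
have inv g : z g b -> z g^-1%g b.
  move=> zg; have := i g^-1%g g; rewrite (actVK nsB) => /(_ zg) /conjV.
  by rewrite mulgV mul1g.
move=> g k zg; split=> [zk|/conjV zk].
  have := conj g^-1%g _ (mul _ _ (inv _ zg) (mul _ _ zk zg)).
  by rewrite !invgK !mulgA mulVg mul1g mulgVK.
have := mul _ _ zg (mul _ _ zk (inv _ zg)).
by rewrite !mulgA mulVg mul1g mulgVK.
Qed.

(** Wherever the coefficient of [lambda g] in [S] does not vanish, [Z g] holds,
    so that the indicator function of [Z k] takes the same value on both sides of
    [lambda g]. *)
Lemma support_central S k : M S -> commute mu S (mult (oneZ k \o p)).
Proof.
move=> MS; have cS := M_crossed facX Msub MS; have bS := vN_bounded vnM MS.
have Lw := Linf_comp_factor facX (Linf_ind xi (supZ k).1).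
have bw := mult_bounded countG nsB Lw.
apply: (bounded_ext countG (bounded_comp bS bw) (bounded_comp bw bS)) => h x Lx /=.
have -> : mult (oneZ k \o p) (dproj h x) = dproj h (mult (oneZ k \o p) x).
  by apply/funext => t; rewrite /dproj /mulop /mult_op mulrCA.
have Lwx := bounded_L2 bw Lx.
have inv := ae_andP support_invariant (ae_forallG countG (fun g => coef_supported g MS)).
have {}inv : \forall t \ae mu, (forall g k, z g (actB t.1 t.2) ->
    (z k (actB t.1 t.2) <-> z k (actB g^-1%g (actB t.1 t.2)))) /\
    forall g, coef S g (actB t.1 t.2) != 0 -> z g (actB t.1 t.2).
  by apply: (ae_fibers countG) => a; exact: (ns_ae nsB a inv).
apply: ae_imp2 (ae_andP (crossed_symbol countG nsB h cS Lwx)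
  (crossed_symbol countG nsB h cS Lx)) inv => -[a b] /= [-> e] [zinv supp].
rewrite /mult_op /= e mulrCA mulrA; have [->|ne0] := eqVneq (coef S (a * h^-1)%g (actB a b)) 0.
  by rewrite !mul0r !mulr0 mul0r.
have := zinv _ k (supp _ ne0).
rewrite invgM invgK -(act_mul nsB) mulgVK => zk.
rewrite mulrA; do 2 congr (_ * _).
by rewrite /ind; congr ((nat_of_bool _)%:R); apply/idP/idP; rewrite !inE => /zk.
Qed.

End CentralSupports.

(** * Fourier synthesis *)

Section Synthesis.
Context {R : realType} {G : groupType} {d : measure_display} {B : measurableType d}.
Variables (nu : probability B R) (act : G -> B -> B).
Hypotheses (countG : countable [set: G]) (ns : nonsingular_space nu act).
Local Notation C := (R[i]).
Local Notation GB := (discrete_group G * B)%type.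
Local Notation mu := (crossed_measure G nu).
Local Notation L2 := (L2 mu).
Local Notation dot := (L2dot mu).
Local Notation q x := (complex.Re (dot x x)).
Local Notation opGB := (op R GB).
Local Notation crossed := (crossed_product nu act (Linf nu) setT).
Local Notation mult := (mult_op act).
Local Notation lam := (@lambda R G d B).
Local Notation H := (L2_semi_hilbert mu).

Section Adjointable.
Variable M : set opGB.
Hypothesis vnM : vN_algebra mu M.

(** As bounded operators have adjoints, this is all of [M]; carrying the adjoint
    along makes it a set to which the bicommutant theorem applies directly. *)
Definition adjointable : set opGB := [set T | M T /\ exists2 T', M T' & adjoint mu T T'].

Lemma adjointable_sub : adjointable `<=` M.
Proof. by move=> T []. Qed.

Lemma adjointable_adj : adj_closed mu adjointable.
Proof.
move=> T [MT [T' MT' TT]]; have bT := vN_bounded vnM MT; have bT' := vN_bounded vnM MT'.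
split=> //; exists T' => //; split=> //; exists T => //.
exact: adjoint_sym.
Qed.

Lemma adjointable_id : adjointable idfun.
Proof. by have M1 : M idfun := star_one vnM.1; split=> //; exists idfun. Qed.

Lemma adjointable_lin a S T : adjointable S -> adjointable T -> adjointable (op_lin a S T).
Proof.
move=> [MS [S' MS' SS]] [MT [T' MT' TT]]; split; first exact: (vN_lin _ vnM).
exists (op_lin a^* S' T'); first exact: (vN_lin _ vnM).
by apply: adjoint_lin => //; exact: (vN_bounded vnM).
Qed.

Lemma adjointable_comp S T : adjointable S -> adjointable T -> adjointable (S \o T).
Proof.
move=> [MS [S' MS' SS]] [MT [T' MT' TT]]; split; first exact: (vN_comp vnM).
exists (T' \o S'); first exact: (vN_comp vnM).
by apply: adjoint_comp => //; exact: (vN_bounded vnM).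
Qed.

Lemma adjointable_mult_lambda f g : Linf nu f -> M (mult f \o lam g) ->
  adjointable (mult f \o lam g).
Proof.
move=> Lf Mf; split=> //; have a := mult_lambda_adjoint countG ns g Lf.
exists (mult (fun b => (f (act g b))^*) \o lam g^-1%g) => //; apply: (vN_adj vnM Mf _ a).
exact: bounded_comp (mult_bounded countG ns (LinfJ (Linf_act ns g Lf)))
  (lambda_bounded nu countG _).
Qed.

End Adjointable.

Lemma dproj_mult_lambda h g c f (x : GB -> C) : h = (g * c)%g ->
  dproj h (mult f (lam g x)) = mult f (lam g (dproj c x)).
Proof.
move=> ->; rewrite lambda_dproj; apply/funext => t.
by rewrite /dproj /mulop /mult_op mulrCA.
Qed.

Lemma crossed_block S g k x : crossed S -> L2 x -> \forall t \ae mu,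
  dproj (g * k)%g (S (dproj k x)) t = mult (coef S g) (lam g (dproj k x)) t.
Proof.
move=> cS Lx; apply: ae_imp (crossed_symbol countG ns k cS Lx) => -[h b] /= e.
rewrite lambda_dproj /dproj /mulop /mult_op /= e /lambda /=.
case: eqP => [->|_]; last by rewrite !mul0r mulr0.
by rewrite mulgK mulKg !mul1r.
Qed.

(** The series of the [coef S g lambda_g] does not converge to [S] for the weak
    topology in general; the bicommutant theorem replaces the convergence, since
    an operator that commutes with all the terms commutes with [S]. *)
Lemma fourier_synthesis M S : vN_algebra mu M -> crossed S ->
  (forall g, M (mult (coef S g) \o lam g)) -> M S.
Proof.
move=> vnM cS MS; have bS := crossed_bounded countG ns cS.
apply: (bicommutant_vN vnM (@adjointable_sub M) (adjointable_id vnM)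
  (adjointable_lin vnM) (adjointable_comp vnM) (adjointable_adj vnM) bS) => U [bU UA].
apply: (bounded_ext countG (bounded_comp bS bU) (bounded_comp bU bS)) => k x Lx /=.
set y := dproj k x; have Ly : L2 y by exact: dproj_L2.
set w := U y; have Lw : L2 w := bounded_L2 bU Ly.
have LSy := bounded_L2 bS Ly; have LSw := bounded_L2 bS Lw.
have LUSy := bounded_L2 bU LSy.
have [e einj] := group_enum countG.
suff fib h' : \forall t \ae mu, dproj h' (S w) t = dproj h' (U (S y)) t.
  apply: (ae_fibers countG) => h.
  apply: ae_imp (@ae_fiber _ _ _ _ nu _ h (fib h)) => b.
  by rewrite /dproj /mulop /= eqxx !mul1r.
have bD := dproj_bounded nu countG h'.
(* [S w] is expanded over the columns [c] of [w], and [U (S y)] over the rows [h]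
   of [S y]; in the row [h'] the term of [c] corresponds to [h = h' c^-1 k], and
   [e'] enumerates the [c] in the order in which [e] enumerates the [h]. *)
pose e' c := e (h' * c^-1 * k)%g.
have einj' : injective e' by move=> c c' /einj /mulIg /mulgI /invg_inj.
have block c : \forall t \ae mu,
    dproj h' (S (dproj c w)) t = dproj h' (U (dproj (h' * c^-1 * k)%g (S y))) t.
  set g := (h' * c^-1)%g; have gc : h' = (g * c)%g by rewrite mulgVK.
  pose T := mult (coef S g) \o lam g.
  have Tadj : adjointable M T.
    by apply: (adjointable_mult_lambda vnM) => //; exact: (coef_Linf countG ns).
  have bT := vN_bounded vnM Tadj.1.
  have /op_eqP /(_ _ Ly) /= UT := UA T Tadj.
  have Lb := bounded_L2 (dproj_bounded nu countG (g * k)%g) LSy.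
  have h1 := bounded_ae (bounded_comp bD bU) Lb (bounded_L2 bT Ly)
    (crossed_block g k cS Lx).
  have h2 := bounded_ae bD (bounded_L2 bU (bounded_L2 bT Ly)) (bounded_L2 bT Lw) UT.
  have h3 := crossed_block g c cS Lw; rewrite -gc in h3.
  apply: ae_imp2 (ae_andP h1 h2) h3 => t [e1 e2] e3; rewrite e3.
  by apply: etrans (esym (etrans e1 e2)); rewrite /T /= (dproj_mult_lambda _ _ gc).
have partial n : \forall t \ae mu,
    dproj h' (S (trunc e' n w)) t = dproj h' (U (trunc e n (S y))) t.
  have bDS := bounded_comp bD bS; have bDU := bounded_comp bD bU.
  elim: n => [|n IH].
    rewrite !trunc_nil; have z : \forall t \ae mu, (fun=> 0 : C) t = 0 by exact: aeW.
    by apply: ae_imp2 (bounded_0 bDS (L2_0 mu) z) (bounded_0 bDU (L2_0 mu) z) => t /= -> ->.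
  have [[c ec]|noc] := pselect (exists c, e' c = n); last first.
    rewrite !trunc_miss // => [h eh|c ec]; apply: noc; last by exists c.
    exists (k * h^-1 * h')%g; rewrite -eh /e'; congr e.
    by rewrite !invgM invgK !mulgA mulgV mul1g mulgVK.
  have eh : e (h' * c^-1 * k)%g = n by [].
  rewrite -[in trunc e' _]ec -[in trunc e _]eh !trunc_hit // ec eh.
  have L1 := trunc_L2 countG e' n Lw; have L3 := trunc_L2 countG e n LSy.
  have LD a u : L2 u -> L2 (dproj a u) := @dproj_L2 _ _ _ _ nu countG a u.
  apply: ae_imp2 (ae_andP (bounded_D bDS L1 (LD c _ Lw))
    (bounded_D bDU L3 (LD (h' * c^-1 * k)%g _ LSy))) (ae_andP IH (block c)).
  by move=> t /= [-> ->] [-> ->].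
have [c c0 Sc] := bounded_qB (bounded_comp bD bS).
have [c' c0' Uc] := bounded_qB (bounded_comp bD bU).
have LDS := bounded_L2 bD LSw; have LDU := bounded_L2 bD LUSy.
apply: q_sub0_ae => //; apply/le_anti; rewrite q_ge0 andbT.
apply/ler_addgt0Pr => eps eps0; rewrite add0r.
pose m := c + c' + 1; have m0 : 0 < m by rewrite /m ltr_wpDl // addr_ge0.
have em : 0 < eps / (m *+ 4) by rewrite divr_gt0 // pmulrn_rgt0.
have [N1 h1] := trunc_lim countG e' Lw em; have [N2 h2] := trunc_lim countG e LSy em.
pose n := maxn N1 N2.
have {}h1 := h1 n (leq_maxl _ _); have {}h2 := h2 n (leq_maxr _ _).
have Lt1 := trunc_L2 countG e' n Lw; have Lt2 := trunc_L2 countG e n LSy.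
have La := bounded_L2 (bounded_comp bD bS) Lt1.
have Lb := bounded_L2 (bounded_comp bD bU) Lt2.
have -> : q (dproj h' (S w) - dproj h' (U (S y)))
    = q ((dproj h' (S w) - (dproj h' \o S) (trunc e' n w))
       + ((dproj h' \o U) (trunc e n (S y)) - dproj h' (U (S y)))).
  have L1 := L2B LDS LDU; have L3 := L2D (L2B LDS La) (L2B Lb LDU).
  congr complex.Re; apply: (dot_ae L1 L3 L1 L3); apply: ae_imp (partial n) => t e1;
    change (dproj h' (S w) t - dproj h' (U (S y)) t
      = (dproj h' (S w) t - dproj h' (S (trunc e' n w)) t)
       + (dproj h' (U (trunc e n (S y))) t - dproj h' (U (S y)) t));
    by rewrite e1 addrA subrK.
apply: le_trans (qD_le H (L2B LDS La) (L2B Lb LDU)) _.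
have h3 := Sc _ _ Lt1 Lw; have h4 := Uc _ _ Lt2 LSy.
have arith (a b r s : R) : a <= c * r -> b <= c' * s -> r < eps / (m *+ 4) ->
    s < eps / (m *+ 4) -> 0 <= r -> 0 <= s -> a *+ 2 + b *+ 2 <= eps.
  rewrite !ltr_pdivlMr ?pmulrn_rgt0 // => h5 h6 h7 h8 r0 s0.
  have h9 : c * r <= m * r by apply: ler_wpM2r => //; rewrite /m -addrA lerDl addr_ge0.
  have h10 : c' * s <= m * s by apply: ler_wpM2r => //; rewrite /m addrAC lerDr addr_ge0.
  move: h7 h8; rewrite !mulrnAr ![_ * m]mulrC !(mulrS _ 3) !(mulrS _ 2) !mulr2n.
  by move: h5 h6 h9 h10; lra.
rewrite (q_sym H LDS La).
exact: (arith _ _ _ _ h3 h4 h1 h2 (q_ge0 _ _) (q_ge0 _ _)).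
Qed.

End Synthesis.

(** * The dichotomy for the supports *)

Section Dichotomy.
Context {R : realType} {G : groupType} {dB : measure_display} {B : measurableType dB}.
Variables (nu : probability B R) (actB : G -> B -> B).
Context {dX : measure_display} {X : measurableType dX}.
Variables (xi : probability X R) (actX : G -> X -> X) (p : B -> X).
Hypotheses (countG : countable [set: G]) (nsB : nonsingular_space nu actB)
  (shB : SH_property nu actB) (facX : factor_map nu actB xi actX p)
  (ntX : nontrivial_space xi).
Local Notation C := (R[i]).
Local Notation GB := (discrete_group G * B)%type.
Local Notation mu := (crossed_measure G nu).
Local Notation L2 := (L2 mu).
Local Notation opGB := (op R GB).
Local Notation F := (Linf_factor xi p).
Local Notation crossedX := (crossed_product nu actB F setT).
Local Notation crossed := (crossed_product nu actB (Linf nu) setT).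
Local Notation mult := (mult_op actB).
Local Notation lam := (@lambda R G dB B).
Local Notation mp := (factor_measurable facX).
Local Notation pushp := (factor_push facX).

Variable M : set opGB.
Hypotheses (vnM : vN_algebra mu M) (invM : conj_invariant M) (subM : mult @` F `<=` M)
  (Msub : M `<=` crossedX).

Lemma conj_opK g (S : opGB) : conj_op g (conj_op g^-1%g S) = S.
Proof.
apply/funext => x; rewrite /conj_op /= !invgK.
have K (y : GB -> C) : lam g (lam g^-1%g y) = y by rewrite -{1}[g]invgK lambdaVK.
by rewrite !K.
Qed.

Lemma adjointable_conj : conj_invariant (adjointable nu M).
Proof.
move=> g S [MS [S' MS' SS]]; split; first exact: invM.
exists (conj_op g S'); first exact: invM.
have b2 := lambda_bounded nu countG g^-1%g.
have bS := vN_bounded vnM MS; have bS' := vN_bounded vnM MS'.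
have a1 := @lambda_adjoint _ _ _ _ nu countG g.
have a2 := @lambda_adjoint _ _ _ _ nu countG g^-1%g; rewrite invgK in a2.
exact: (adjoint_comp (bounded_comp bS' b2) b2 (adjoint_comp b2 bS a1 SS) a2).
Qed.

(** The diagonal part of the centre of [M]. *)
Definition central_part : set opGB :=
  diagonal_part nu M `&` commutant mu (adjointable nu M).

Lemma central_vN : vN_algebra mu central_part.
Proof.
by apply: vN_setI (diagonal_vN countG vnM) (commutant_vN _); exact: adjointable_adj.
Qed.

Lemma central_conj : conj_invariant central_part.
Proof.
move=> g S [dS [bS SA]]; split; first exact: (diagonal_conj countG invM).
split=> [|T AT]; first exact: (conj_bounded countG).
rewrite -[T](conj_opK g); have AT' : adjointable nu M (conj_op g^-1%g T).
  exact: adjointable_conj.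
by apply: (conj_commute countG g bS (vN_bounded vnM AT'.1)); exact: SA.
Qed.

Lemma central_crossed : central_part `<=` crossed.
Proof. by move=> S [/(diagonal_crossed facX Msub)]. Qed.

Lemma component_of S g : M S ->
  exists2 f, Linf xi f & (\forall b \ae nu, coef S g b = f (p b)) /\
    M (mult (f \o p) \o lam g).
Proof.
move=> MS; have [f Lf Sf] := M_coef countG nsB facX Msub g MS; exists f => //.
by split=> //; exact: (component_in countG nsB shB facX ntX vnM invM subM Msub MS Lf Sf).
Qed.

(** A term [f lambda_g] of an element of [M] commutes with the central part, so
    that the central functions take equal values at [b] and at [g^-1 b] wherever
    [f] does not vanish. *)
Lemma central_singular S g : expectation_singular nu actB central_part -> M S ->
  g != 1%g -> \forall b \ae nu, coef S g b = 0.
Proof.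
move=> sing MS g1; have [f Lf [Sf Mf]] := component_of g MS.
have dE : forall T, central_part T -> op_eq mu T (mult (coef T 1%g)).
  by move=> T [dT _]; exact: (diagonal_op_eq countG nsB facX Msub dT).
have [D DN sepD] := singular_separates countG nsB central_crossed dE sing.
have Lfp := Linf_comp_factor facX Lf.
have AV := adjointable_mult_lambda countG nsB vnM Lfp Mf.
set V := mult (f \o p) \o lam g in AV; have bV := vN_bounded vnM AV.1.
have Ld : L2 (delta g^-1%g) by exact: delta_L2.
have h n : \forall b \ae nu, f (p b) * (canonical_expectation (D n) b
    - canonical_expectation (D n) (actB g^-1%g b)) = 0.
  have [_ [bD /(_ V AV) /op_eqP /(_ _ Ld) /= c]] := DN n.
  have Dd := dE _ (DN n); move/op_eqP : (Dd) => De.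
  have bm := mult_bounded countG nsB (coef_Linf countG nsB 1%g (central_crossed (DN n))).
  have e1 := De _ (bounded_L2 bV Ld).
  have e2 := bounded_ae bV (bounded_L2 bD Ld) (bounded_L2 bm Ld) (De _ Ld).
  have := @ae_fiber _ _ _ _ nu _ 1%g (ae_andP c (ae_andP e1 e2)).
  apply: ae_imp => b [+ [h1 h2]]; rewrite h1 h2 /V /mult_op /lambda /delta /= mulg1 eqxx.
  rewrite !(act_one nsB) !mulr1 coef1 => e.
  by rewrite mulrBr [X in X - _]mulrC e subrr.
have h' := ae_foralln h.
apply: ae_imp2 (ae_andP Sf h') sepD => b [-> {}h'] sep.
have [|n ne] := sep g^-1%g; first by rewrite invg_eq1.
have /eqP := h' n; rewrite mulf_eq0 subr_eq0 => /orP[/eqP//|/eqP e].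
by exfalso; apply: ne.
Qed.

Lemma lambda_one_in : M (lam 1%g).
Proof. by rewrite lambda1; exact: (star_one vnM.1). Qed.

(** Either [lambda_g] lies in [M], or the [g]-th coefficients vanish on [M]: the
    support of the [g]-th coefficients is central, hence of measure zero or one
    when the expectation is constant on the central part. *)
Lemma lambda_dichotomy g : M (lam g) \/ forall S, M S -> \forall b \ae nu, coef S g b = 0.
Proof.
have [->|g1] := eqVneq g 1%g; first by left; exact: lambda_one_in.
have [sing|const] := shB central_vN central_conj central_crossed.
  by right=> S MS; exact: central_singular.
pose compM := component_in countG nsB shB facX ntX vnM invM subM Msub.
have Zex k := max_support (xi := xi) countG nsB facX vnM subM k.
pose Z k := s2val (cid2 (Zex k)).
have supZ k : supports actB p M k (Z k) by rewrite /Z; case: cid2.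
have maxZ k A : supports actB p M k A -> xi (A `\` Z k) = 0%E.
  by rewrite /Z; case: cid2 => Zk sZ mZ; exact: mZ.
have LZ := Linf_ind xi (supZ g).1; have LZp := Linf_comp_factor facX LZ.
have cZ : central_part (mult (ind (Z g) \o p)).
  split; first exact: (diagonal_mult countG nsB facX subM LZ).
  split=> [|T [MT _]]; first exact: (mult_bounded countG nsB).
  apply: commute_sym.
  exact: (support_central countG nsB facX vnM invM subM Msub (@compM) supZ maxZ g MT).
have [c /ae_eqP] := const _ cZ; rewrite (expectation_mult nsB) => Zc.
have [c1|c1] := eqVneq c 1.
  left; apply: (vN_op_eq vnM (supZ g).2 (lambda_bounded nu countG g)).
  have e : op_eq mu (mult (ind (Z g) \o p)) (mult (fun=> 1)).
    by apply: (mult_ae countG nsB); apply: ae_imp Zc => b ->.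
  have bl := lambda_bounded nu countG g; move/op_eqP : e => e; apply/op_eqP => x Lx.
  by apply: ae_imp (e _ (bounded_L2 bl Lx)) => t /= ->; rewrite /mult_op mul1r.
right=> S MS.
have := coef_supported countG nsB facX vnM subM Msub (@compM) supZ maxZ g MS.
apply: ae_imp2 Zc => b /= bc supp; apply/eqP/contraT => /supp Zb.
by move: c1; rewrite -bc /ind mem_set // eqxx.
Qed.

Lemma lambda_normal : normal_subgroup [set g | M (lam g)].
Proof.
split=> [|g h Mg Mh|g Mg|g h Mh] /=; first exact: lambda_one_in.
- by rewrite lambdaM; exact: (vN_comp vnM).
- apply: (vN_adj vnM Mg (lambda_bounded nu countG _)).
  exact: (@lambda_adjoint _ _ _ _ nu countG g).
- have := invM g Mh; rewrite /conj_op.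
  by rewrite !lambdaM.
Qed.

(** Each Fourier term [f_g lambda_g] of an element of [M] either vanishes or is
    the product of [f_g] in [L^oo(X)] with an element [lambda_g] of [M]; the
    element is recovered from its terms by synthesis. *)
Lemma crossed_lambda : M = crossed_product nu actB F [set g | M (lam g)].
Proof.
apply/seteqP; split => [S MS|]; last first.
  by apply: (vN_generated_sub vnM) => T [|[g Mg <-]//]; exact: subM.
move=> M' vnM' genM'; have cS := M_crossed facX Msub MS.
apply: (fourier_synthesis countG nsB vnM' cS) => g.
have Lc := coef_Linf countG nsB g cS.
have bc := bounded_comp (mult_bounded countG nsB Lc) (lambda_bounded nu countG g).
have bl := lambda_bounded nu countG g.
have ext (f : B -> C) : (\forall b \ae nu, coef S g b = f b) ->
    op_eq mu (mult f \o lam g) (mult (coef S g) \o lam g).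
  move=> Sf; have /op_eqP e := mult_ae countG nsB Sf.
  apply/op_eqP => x Lx /=.
  by apply: ae_imp (e _ (bounded_L2 bl Lx)) => t ->.
have [f Lf [Sf _]] := component_of g MS.
have M'f k : Linf xi k -> M' (mult (k \o p)).
  by move=> Lk; apply: genM'; left; exists (k \o p) => //; exists k.
have [Mg|coef0] := lambda_dichotomy g.
  apply: (vN_op_eq vnM' _ bc (ext _ Sf)); apply: (vN_comp vnM' (M'f _ Lf)).
  by apply: genM'; right; exists g.
apply: (vN_op_eq vnM' _ bc (ext _ (coef0 S MS))).
have M0 := M'f _ (Linf_cst xi 0).
have -> : mult (fun=> 0) \o lam g = mult ((fun=> 0) \o p).
  by apply/funext => x; apply/funext => t; rewrite /mult_op /= !mul0r.
exact: M0.
Qed.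

End Dichotomy.

Local Close Scope ring_scope.
Local Close Scope complex_scope.
Unset Implicit Arguments.

Theorem theorem1p2 (R : realType) (G : groupType)
    (dB : measure_display) (B : measurableType dB)
    (nu : probability B R) (actB : G -> B -> B)
    (dX : measure_display) (X : measurableType dX)
    (xi : probability X R) (actX : G -> X -> X) (p : B -> X)
    (countG : countable [set: G])
    (nsB : nonsingular_space nu actB)
    (ergB : ergodic nu actB)
    (shB : SH_property nu actB)
    (facX : factor_map nu actB xi actX p)
    (ntX : nontrivial_space xi)
    (M : set (op R (GB G B)))
    (vnM : vN_algebra (crossed_measure G nu) M)
    (invM : conj_invariant M)
    (subM : mult_op actB @` Linf_factor xi p `<=` M)
    (Msub : M `<=` crossed_product nu actB (Linf_factor xi p) setT) :
  exists2 L : set G, normal_subgroup L &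
    M = crossed_product nu actB (Linf_factor xi p) L.
Proof.
exists [set g | M (lambda g)]; first exact: (lambda_normal countG vnM invM).
exact: (crossed_lambda countG nsB shB facX ntX vnM invM subM Msub).
Qed.
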